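(* Let $(\mathcal{X},f,\mu)$ be asymptotically hyperbolic, and let $\rho$ be the density of $\mu$. Then the following hold. (1) Let $\tau>0$, $r_n=\tau/(2n)$ and $R_n(r_n,x):=\#\{1\le j\le n:\ d(f^jx,x)\le r_n\}$. Then for all integers $k\ge0$, $$\lim_{n\to\infty}\mu\left(x\in\mathcal{X}:\ R_n(r_n,x)=k\right)=\int_{\mathcal{X}}\frac{\tau^k\rho(x)^{k+1}}{k!}\,e^{-\rho(x)\tau}\,dx .$$ (2) Assume one of the following alternatives: (i) the density $\rho$ is strictly positive, and $(r_n)$ is a sequence satisfying $r_n>\frac{c\log\log n}{n}$, where $2c\,(\inf_{x\in\mathcal{X}}\rho(x))>1$; (ii) the density $\rho$ is uniformly Hölder continuous, and $(r_n)$ is a sequence satisfying $r_n>\frac{(\log n)^{\gamma}}{2n}$ with $\gamma>\gamma_0$, where $\gamma_0$ is such that $\sum_{k\ge1}\int_{\mathcal{X}}\rho(x)e^{-\epsilon k^{\gamma_0}\rho(x)}\,dx<\infty$ for all $\epsilon>0$. Then, in either case, $$\mu\left(x\in\mathcal{X}:\ \min_{1\le k\le n}d(f^kx,x)<r_n\ \text{eventually}\right)=1 .$$ (3) Suppose that the sequence $(r_n)$ satisfies $\sum_{n=1}^{\infty}\int_{\mathcal{X}}\mu(B(x,r_n))\,d\mu(x)<\infty$. Then $$\mu\left(x\in\mathcal{X}:\ \min_{1\le k\le n}d(f^kx,x)>r_n\ \text{eventually}\right)=1 .$$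
   Context: $\mathcal{X}\subset\mathbb{R}$ is an interval with metric $d(x,y)=|x-y|$, $f:\mathcal{X}\to\mathcal{X}$ is a measurable map, and $\mu$ is an ergodic $f$-invariant Borel probability measure which is absolutely continuous with respect to Lebesgue measure (an acip), with density $\rho$. $B(x,r)$ is the ball of centre $x$ and radius $r$. ''Eventually'' means for all sufficiently large $n$ (depending on $x$). Hyperbolic recurrence. Let $Y\subset\mathbb{R}$, $F:Y\to Y$ (defined almost everywhere) and $\nu$ an ergodic $F$-invariant absolutely continuous probability measure on $Y$. Put $\|\varphi\|_1=\int|\varphi|\,d\nu$ and $\|\varphi\|_{\mathrm{BV}}=\mathrm{var}(\varphi)+\sup|\varphi|$, where $\mathrm{var}(\varphi)$ is the supremum of $\sum_{i=1}^m|\varphi(x_i)-\varphi(x_{i-1})|$ over finite sequences $x_0<\dots<x_m$ in $Y$; $\mathrm{BV}$ is the space of functions with $\|\varphi\|_{\mathrm{BV}}<\infty$. The system $(Y,F,\nu)$ is hyperbolic recurrent if the density of $\nu$ belongs to $\mathrm{BV}$ and: (A1) there is a rate function $\Theta(j)=C_0e^{-c_0j}$ with $C_0,c_0>0$ such that for all $\varphi_1\in\mathrm{BV}$, $\varphi_2\in L^1(\nu)$ and all $j$, $\left|\int\varphi_1\cdot\varphi_2\circ F^j\,d\nu-\int\varphi_1\,d\nu\int\varphi_2\,d\nu\right|\le\Theta(j)\|\varphi_1\|_{\mathrm{BV}}\|\varphi_2\|_1$; (A2) with $E_j(r):=\{x\in Y:\ d(x,F^jx)\le r\}$: whenever $r_n\approx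 n^{-a}$ for some $a>0$ (meaning that the ratio $r_n/n^{-a}$ lies in $[c^{-1},c]$ for a uniform constant $c>1$), there exist $\beta_0\in(0,1)$ and $C>0$ such that $\nu(E_j(r_n))\le Cr_n^{\beta_0}$ for all $1\le j\le(\log n)^2$, with $C$ independent of $j$ (and $n$). Asymptotic hyperbolicity. $(\mathcal{X},f,\mu)$ is asymptotically hyperbolic if for each $\varepsilon>0$ one may remove from $\mathcal{X}$ some set $U_\varepsilon=\bigcup_iU_{\varepsilon,i}$, with the $U_{\varepsilon,i}$ connected, such that (i) $\mu(U_\varepsilon)\le\varepsilon$; and (ii) for $Y_\varepsilon:=\mathcal{X}\setminus U_\varepsilon$ and $\tau_\varepsilon$ the first return time to $Y_\varepsilon$ under $f$, the system $(Y_\varepsilon,F_\varepsilon=f^{\tau_\varepsilon},\mu_\varepsilon)$ is hyperbolic recurrent, where $\mu_\varepsilon=\mu|_{Y_\varepsilon}/\mu(Y_\varepsilon)$.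
   Formalization: In (3) the sequence (r_n) is assumed nonincreasing; without this (3) fails, e.g. for the doubling map with r_n = 1/m^2 at n = 2^m (m ≥ 1) and r_n = 2^{-n} otherwise, where (2)(i) contradicts it. *)

(* Defs.v *)
From mathcomp Require Import all_boot all_order all_algebra.
From mathcomp Require Import all_classical all_reals all_analysis.
Set Implicit Arguments.
Unset Strict Implicit.
Unset Printing Implicit Defensive.
Import Order.TTheory GRing.Theory Num.Theory.
Import numFieldNormedType.Exports.
Local Open Scope classical_set_scope.
Local Open Scope ring_scope.

(* A system on X `<=` R is given by a total map T : R -> R and a probability mu
   on R; only the values of T on X matter, and [is_density] forces mu X = 1. *)

Definition is_density (R : realType) (X : set R)
    (mu : probability (measurableTypeR R) R) (rho : R -> R) : Prop :=
  [/\ measurable_fun (X : set (measurableTypeR R)) rho,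
      (forall x, X x -> 0 <= rho x) &
      forall A : set (measurableTypeR R), measurable A ->
        mu A = (\int[lebesgue_measure]_(x in A `&` X) (rho x)%:E)%E].

Definition invariant_measure (R : realType) (X : set R) (T : R -> R)
    (mu : probability (measurableTypeR R) R) : Prop :=
  forall A : set (measurableTypeR R), measurable A ->
    mu (X `&` T @^-1` A) = mu A.

Definition ergodic (R : realType) (X : set R) (T : R -> R)
    (mu : probability (measurableTypeR R) R) : Prop :=
  forall A : set (measurableTypeR R), measurable A -> A `<=` X ->
    X `&` T @^-1` A = A -> mu A = 0%E \/ mu A = 1%E.

Definition ergodic_acip (R : realType) (X : set R) (T : R -> R)
    (mu : probability (measurableTypeR R) R) : Prop :=
  [/\ measurable (X : set (measurableTypeR R)),
      (forall x, X x -> X (T x)),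
      measurable_fun (X : set (measurableTypeR R))
        (T : measurableTypeR R -> measurableTypeR R),
      invariant_measure X T mu /\ ergodic X T mu &
      exists rho, is_density X mu rho].

Definition var (R : realType) (Y : set R) (phi : R -> R) : \bar R :=
  ereal_sup [set (\sum_(1 <= i < size s) `|phi s`_i - phi s`_i.-1|)%:E
            | s in [set s : seq R | sorted <%R s /\ [set` s] `<=` Y]].

Definition BV_norm (R : realType) (Y : set R) (phi : R -> R) : \bar R :=
  (var Y phi + ereal_sup [set `|phi x|%:E | x in Y])%E.

Definition in_BV (R : realType) (Y : set R) (phi : R -> R) : Prop :=
  (BV_norm Y phi < +oo)%E.

Definition exponential_mixing (R : realType) (Y : set R) (F : R -> R)
    (nu : probability (measurableTypeR R) R) : Prop :=
  exists C0 c0 : R, [/\ 0 < C0, 0 < c0 &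
    forall (phi1 phi2 : R -> R) (j : nat),
      in_BV Y phi1 ->
      nu.-integrable (Y : set (measurableTypeR R)) (EFin \o phi2) ->
      (`| \int[nu]_(x in Y) (phi1 x * phi2 (iter j F x))%:E
          - (\int[nu]_(x in Y) (phi1 x)%:E) * (\int[nu]_(x in Y) (phi2 x)%:E) |
       <= (C0 * expR (- (c0 * j%:R)))%:E * BV_norm Y phi1
          * \int[nu]_(x in Y) `|phi2 x|%:E)%E].

Definition short_return (R : realType) (Y : set R) (F : R -> R)
    (j : nat) (r : R) : set R :=
  [set x | Y x /\ `|x - iter j F x| <= r].

(* The bounds are asked for n >= 1 only: n^-a has no meaning at n = 0. *)
Definition power_like (R : realType) (r : nat -> R) (a : R) : Prop :=
  exists2 c : R, 1 < c &
    forall n : nat, (0 < n)%N -> c^-1 <= r n / n%:R `^ (- a) <= c.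

Definition short_return_bound (R : realType) (Y : set R) (F : R -> R)
    (nu : probability (measurableTypeR R) R) : Prop :=
  forall (r : nat -> R) (a : R), 0 < a -> power_like r a ->
  exists beta0 C : R, [/\ 0 < beta0 < 1, 0 < C &
    forall n j : nat, (0 < n)%N -> (0 < j)%N -> j%:R <= (ln (n%:R : R)) ^+ 2 ->
      (nu (short_return Y F j (r n)) <= (C * r n `^ beta0)%:E)%E].

(* The almost everywhere defined map F is represented by a total self-map of Y;
   its values on a nu-null set are irrelevant.  A density is only determined up
   to null sets, so it is some version of it that is asked to be in BV. *)
Definition hyperbolic_recurrent (R : realType) (Y : set R) (F : R -> R)
    (nu : probability (measurableTypeR R) R) : Prop :=
  [/\ ergodic_acip Y F nu,
      (exists2 h, is_density Y nu h & in_BV Y h),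
      exponential_mixing Y F nu &
      short_return_bound Y F nu].

(* The value 0 stands for an infinite return time. *)
Definition first_return_time (R : realType) (f : R -> R) (Y : set R) (x : R)
    : nat :=
  match pselect (exists n, `[< (0 < n)%N /\ Y (iter n f x) >]) with
  | left h => ex_minn h
  | right _ => 0
  end.

(* Points that never return, a null set by Poincare recurrence, are fixed. *)
Definition first_return_map (R : realType) (f : R -> R) (Y : set R) (x : R)
    : R := iter (first_return_time f Y x) f x.

(* [mnormalize (mrestr mu mY) mu] is the measure A |-> mu (A `&` Y) / mu Y; its
   last argument is a default that is only used if mu Y = 0. *)
Definition asymptotically_hyperbolic (R : realType) (X : set R) (f : R -> R)
    (mu : probability (measurableTypeR R) R) : Prop :=
  forall e : R, 0 < e ->
  exists U : nat -> set R,
    [/\ forall i, U i `<=` X,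
        forall i, connected (U i),
        (mu (\bigcup_i U i) <= e%:E)%E &
        let Y : set (measurableTypeR R) := X `\` \bigcup_i U i in
        (0 < mu Y)%E /\
        exists mY : measurable Y,
          hyperbolic_recurrent Y (first_return_map f Y)
            (mnormalize (mrestr mu mY) mu)].

Definition return_count (R : realType) (f : R -> R) (n : nat) (r x : R) : nat :=
  count (fun j => `|iter j f x - x| <= r) (iota 1 n).

(* The minimum over 1 <= k <= n, for n >= 1: the initial value of the iterated
   minimum is its k = 1 term. *)
Definition closest_return (R : realType) (f : R -> R) (n : nat) (x : R) : R :=
  \big[Num.min/`|f x - x|]_(1 <= k < n.+1) `|iter k f x - x|.

Definition uniformly_hoelder (R : realType) (X : set R) (g : R -> R) : Prop :=
  exists a K : R, [/\ 0 < a <= 1, 0 < K &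
    forall x y, X x -> X y -> `|g x - g y| <= K * `|x - y| `^ a].

(* Main.v *)
(* Fix a set Y of almost full measure on which the first return map T is exponentially mixing
   for the conditional measure P, which has bounded density. Cut the line into cells that are
   short compared with r. For x in a given cell, the times at which the T-orbit of x is within r
   of x are sandwiched between its visits to two fixed intervals, the intersection (thin) and the
   hull (fat) of the balls B(x,r) centred in the cell. For an interval J let N_n count the visits
   to J up to time n and put a_n = E z^N_n with 0 <= z <= 1; then
   a_{n+1} = a_n - (1 - z) E[1_J z^N_n], and mixing decouples 1_J from z^N_n up to returns to J
   within q steps, so that a_n is close to (1 - (1 - z) P(J))^n, also when restricted to a cell.
   Summed over the cells, the short returns cost a bounded multiple of the sum over g <= q of
   P(|T^g x - x| <= 3r), which (A2) controls quantitatively, whereas mixing and the bounded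
   density alone show that it vanishes in the limit. By Lebesgue differentiation P(J) is
   asymptotic to 2 r rho(x) / mu(Y), and by Birkhoff's theorem the f-orbit visits Y about
   n mu(Y) times up to time n.
   For (1), the generating functions converge for 0 < z < 1, because returns of f to B(x,r)
   outside Y are excursions from Y of measure at most mu(B(x,r) \ Y) = o(r). For (2), take z = 0
   along a geometric sequence of times and apply the Borel-Cantelli lemma. For (3), mixing bounds
   the measure of the points with a return at a late time by the square sum of the measures of
   the cells, which is at most the mean of mu(B(x,r)), and Borel-Cantelli applies again. *)
Require Import Defs.
From mathcomp Require Import all_boot all_order all_algebra.
From mathcomp Require Import all_classical all_reals all_analysis.
From mathcomp Require Import measurable_realfun.
From mathcomp Require Import ring lra.
Set Implicit Arguments.
Unset Strict Implicit.
Unset Printing Implicit Defensive.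
Import Order.TTheory GRing.Theory Num.Theory.
Import numFieldNormedType.Exports.
Local Open Scope classical_set_scope.
Local Open Scope ring_scope.

(** * Probability and expectation as real numbers *)

(** Mixing compares two fixed functions, whereas the target of a return moves with its starting
    point; fixing the cell of the starting point freezes the target, and only indicators of
    intervals are ever inserted as [phi1] in (A1). The price is one mixing error per cell, for about
    1 / r cells, and this dictates the gap q. In (2) the errors must be summable along times of
    order lam^k, so q is a large multiple of k, that is of log n, a range covered by (A2). The
    recursion for the generating function multiplies old errors by a factor at most 1, so that n
    steps cost n one-step errors. The return of an orbit outside Y is invisible to the first return
    map. In (2) such returns can be ignored, since one close return suffices; in (1) and (3) they
    must be bounded, and excursions reaching a set J from Y have measure at most mu(J) whatever
    their length, so that no bound on return times is needed. In (1) there is a second difference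
    between the two maps: the clock, as the number of visits to Y up to time n is random. *)

Section bounded_expectation.
Context d (T : measurableType d) (R : realType) (P : probability T R).

Definition pr (A : set T) : R := fine (P A).

(** Boundedness makes integrability automatic under any probability, so that expectations are linear
    with no side condition other than closure properties. *)
Definition bmeasurable (g : T -> R) : Prop :=
  measurable_fun setT g /\ exists K, forall x, `|g x| <= K.

Lemma pr_EFin A : measurable A -> P A = (pr A)%:E.
Proof. by move=> mA; rewrite /pr fineK// fin_num_measure. Qed.

Lemma pr_ge0 A : 0 <= pr A.
Proof. exact: fine_ge0. Qed.

Lemma le_pr A B : measurable A -> measurable B -> A `<=` B -> pr A <= pr B.
Proof. by move=> mA mB AB; rewrite -lee_fin -!pr_EFin// le_measure// inE. Qed.

Lemma pr_le1 A : measurable A -> pr A <= 1.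
Proof. by move=> mA; rewrite -lee_fin -pr_EFin// probability_le1. Qed.

Lemma prT : pr setT = 1.
Proof. by rewrite /pr probability_setT. Qed.

Lemma pr0 : pr set0 = 0.
Proof. by rewrite /pr measure0. Qed.

Lemma prC A : measurable A -> pr (~` A) = 1 - pr A.
Proof. by move=> mA; rewrite /pr probability_setC// fineB// fin_num_measure. Qed.

Lemma prU A B : measurable A -> measurable B -> pr (A `|` B) <= pr A + pr B.
Proof.
move=> mA mB; rewrite -lee_fin EFinD -!pr_EFin//; last exact: measurableU.
exact: measureU2.
Qed.

Lemma prDI A B : measurable A -> measurable B ->
  pr A = pr (A `&` B) + pr (A `\` B).
Proof.
move=> mA mB; apply: EFin_inj; rewrite EFinD -!pr_EFin//.
- rewrite -measureU//; [|exact: measurableI|exact: measurableD|].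
    by rewrite setUIDK.
  by apply/seteqP; split => // x [[_ Bx] [_]].
- exact: measurableD.
- exact: measurableI.
Qed.

Lemma pr_bigcup_ord n (A : nat -> set T) : (forall k, measurable (A k)) ->
  pr (\big[setU/set0]_(k < n) A k) <= \sum_(k < n) pr (A k).
Proof.
move=> mA; elim: n => [|n IH]; first by rewrite !big_ord0 pr0.
rewrite !big_ord_recr/=; apply: le_trans (prU _ _) _ => //.
  exact: bigsetU_measurable.
by rewrite lerD2r.
Qed.

Lemma bm_cst c : bmeasurable (fun=> c).
Proof. by split; [exact: measurable_cst|exists `|c|]. Qed.

Lemma bm_indic A : measurable A -> bmeasurable (\1_A).
Proof.
move=> mA; split; first exact: measurable_indic.
by exists 1 => x; rewrite indicE ger0_norm//; case: (_ \in _).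
Qed.

Lemma bmD f g : bmeasurable f -> bmeasurable g -> bmeasurable (fun x => f x + g x).
Proof.
move=> [mf [K fK]] [mg [L gL]]; split; first exact: measurable_funD.
by exists (K + L) => x; rewrite (le_trans (ler_normD _ _))// lerD.
Qed.

Lemma bmN f : bmeasurable f -> bmeasurable (fun x => - f x).
Proof.
move=> [mf [K fK]]; split; first exact: (measurable_funN mf).
by exists K => x; rewrite normrN.
Qed.

Lemma bmB f g : bmeasurable f -> bmeasurable g -> bmeasurable (fun x => f x - g x).
Proof. by move=> bf bg; apply: bmD => //; exact: bmN. Qed.

Lemma bmM f g : bmeasurable f -> bmeasurable g -> bmeasurable (fun x => f x * g x).
Proof.
move=> [mf [K fK]] [mg [L gL]]; split; first exact: measurable_funM.
by exists (K * L) => x; rewrite normrM ler_pM.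
Qed.

Lemma bm_sum (I : Type) (s : seq I) (Q : pred I) (f : I -> T -> R) :
  (forall i, bmeasurable (f i)) -> bmeasurable (fun x => \sum_(i <- s | Q i) f i x).
Proof.
move=> bf; elim: s => [|i s IH].
  by under eq_fun do rewrite big_nil; exact: bm_cst.
under eq_fun do rewrite big_cons; case: (Q i) => //; exact: bmD.
Qed.

Lemma bm_comp (g : T -> R) (h : T -> T) : measurable_fun setT h ->
  bmeasurable g -> bmeasurable (fun x => g (h x)).
Proof.
move=> mh [mg [K gK]]; split; first exact: (measurableT_comp mg).
by exists K => x.
Qed.

Lemma bm_itv (g : T -> R) a b : measurable_fun setT g ->
  (forall x, a <= g x <= b) -> bmeasurable g.
Proof.
move=> mg gab; split => //; exists (`|a| + `|b|) => x.
have /andP[h1 h2] := gab x; rewrite ler_norml; apply/andP; split.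
  rewrite (le_trans _ h1)// opprD lerBlDr (le_trans (y := a))//.
    by rewrite lerNl (le_trans (ler_norm _))// normrN.
  by rewrite lerDl.
by rewrite (le_trans h2)// (le_trans (ler_norm _))// lerDr.
Qed.

Lemma bm_integrable g : bmeasurable g -> P.-integrable setT (EFin \o g).
Proof.
move=> [mg [K gK]]; apply: measurable_bounded_integrable => //.
  by rewrite (le_lt_trans (probability_le1 _ _))// ltry.
by exists K; split; [exact: num_real|move=> y Ky x _ /=; rewrite (le_trans (gK x))// ltW].
Qed.

Definition ex (g : T -> R) : R := \int[P]_x g x.

Lemma ex_EFin g : bmeasurable g -> (\int[P]_x (g x)%:E)%E = (ex g)%:E.
Proof.
by move=> bg; rewrite /ex /Rintegral fineK// integrable_fin_num//; exact: bm_integrable.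
Qed.

Lemma exD f g : bmeasurable f -> bmeasurable g ->
  ex (fun x => f x + g x) = ex f + ex g.
Proof. by move=> bf bg; rewrite /ex RintegralD//; exact: bm_integrable. Qed.

Lemma exB f g : bmeasurable f -> bmeasurable g ->
  ex (fun x => f x - g x) = ex f - ex g.
Proof. by move=> bf bg; rewrite /ex RintegralB//; exact: bm_integrable. Qed.

Lemma exZ c g : bmeasurable g -> ex (fun x => c * g x) = c * ex g.
Proof. by move=> bg; rewrite /ex RintegralZl//; exact: bm_integrable. Qed.

Lemma ex_cst c : ex (fun=> c) = c.
Proof. by rewrite /ex Rintegral_cst// -[X in _ * X]/(pr setT) prT mulr1. Qed.

Lemma ex_indic A : measurable A -> ex (\1_A) = pr A.
Proof. by move=> mA; rewrite /ex /Rintegral integral_indic// setIT. Qed.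

Lemma le_ex f g : bmeasurable f -> bmeasurable g -> (forall x, f x <= g x) ->
  ex f <= ex g.
Proof. by move=> bf bg fg; apply: le_Rintegral => //; exact: bm_integrable. Qed.

Lemma ex_ge0 g : (forall x, 0 <= g x) -> 0 <= ex g.
Proof. by move=> g0; apply: Rintegral_ge0. Qed.

Lemma eq_ex f g : f =1 g -> ex f = ex g.
Proof. by move=> /funext ->. Qed.

Lemma ex_sum (I : Type) (s : seq I) (Q : pred I) (f : I -> T -> R) :
  (forall i, bmeasurable (f i)) ->
  ex (fun x => \sum_(i <- s | Q i) f i x) = \sum_(i <- s | Q i) ex (f i).
Proof.
move=> bf; elim: s => [|i s IH].
  by under eq_ex do rewrite big_nil; rewrite big_nil ex_cst.
rewrite big_cons; under eq_ex do rewrite big_cons.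
by case: (Q i) => //; rewrite exD ?IH//; exact: bm_sum.
Qed.

Lemma norm_ex_le g h : bmeasurable g -> bmeasurable h ->
  (forall x, `|g x| <= h x) -> `|ex g| <= ex h.
Proof.
move=> bg bh gh; rewrite ler_norml; apply/andP; split.
  rewrite -mulN1r -exZ//; apply: le_ex => //.
    by apply: bmM => //; exact: bm_cst.
  by move=> x; rewrite mulN1r; have := gh x; rewrite ler_norml => /andP[].
by apply: le_ex => // x; rewrite (le_trans (ler_norm _)).
Qed.

Section preserving.
Context (h : T -> T) (mh : measurable_fun setT h)
  (hP : forall A, measurable A -> P (h @^-1` A) = P A).

Lemma measurable_iter n : measurable_fun setT (iter n h).
Proof.
by elim: n => [|n IH]; [exact: measurable_id|exact: (measurableT_comp mh IH)].
Qed.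

Lemma measurable_iter_preimage n A : measurable A -> measurable (iter n h @^-1` A).
Proof. by move=> mA; rewrite -[X in measurable X]setTI; exact: measurable_iter. Qed.

Lemma iter_preserving n A : measurable A -> P (iter n h @^-1` A) = P A.
Proof.
move=> mA; elim: n => [//|n IH].
rewrite -IH -[RHS]hP; last exact: measurable_iter_preimage.
suff -> : iter n.+1 h @^-1` A = h @^-1` (iter n h @^-1` A) by [].
by apply/seteqP; split => x; rewrite /preimage/= -iterS iterSr.
Qed.

Lemma pr_iter n A : measurable A -> pr (iter n h @^-1` A) = pr A.
Proof. by move=> mA; rewrite /pr iter_preserving. Qed.

Lemma ex_comp g : bmeasurable g -> (forall x, 0 <= g x) -> ex (fun x => g (h x)) = ex g.
Proof.
move=> [mg _] g0; rewrite /ex /Rintegral; congr fine.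
have mg' : measurable_fun setT (EFin \o g) by exact/measurable_EFinP.
rewrite -[LHS](ge0_integral_pushforward mh P measurableT mg'); last by move=> y _; rewrite lee_fin.
by apply: eq_measure_integral => A mA _; exact: hP.
Qed.

Lemma ex_iter n g : bmeasurable g -> (forall x, 0 <= g x) ->
  ex (fun x => g (iter n h x)) = ex g.
Proof.
move=> bg g0; elim: n => [//|n IH].
rewrite -IH -(@ex_comp (fun x => g (iter n h x)))//; last first.
  by apply: bm_comp => //; exact: measurable_iter.
by apply: eq_ex => x; rewrite -iterSr.
Qed.

End preserving.
End bounded_expectation.

(** * Visits to an interval under exponential mixing *)

(** What the cell arguments retain of hyperbolic recurrence: invariance, a density bounded by [H],
    and (A1) for indicators of intervals against functions with values in [0, 1], the norm of the
    indicator being absorbed in [C]. (A2) is kept apart, in [ind_short]. *)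
Record mixing_system (R : realType) (P : probability (measurableTypeR R) R)
    (T : R -> R) (C th H : R) : Prop := MixingSystem {
  ms_meas : measurable_fun setT (T : measurableTypeR R -> measurableTypeR R);
  ms_pres : forall A : set (measurableTypeR R), measurable A ->
    P (T @^-1` A) = P A;
  ms_C : 0 <= C;
  ms_th : 0 < th < 1;
  ms_H : 0 <= H;
  ms_dens : forall a b, a <= b -> pr P `[a, b] <= H * (b - a);
  ms_mix : forall (i : interval R) (g : measurableTypeR R -> R) j,
    measurable_fun setT g -> (forall x, 0 <= g x <= 1) ->
    `|ex P (fun x => \1_[set` i] x * g (iter j T x)) - pr P [set` i] * ex P g|
      <= C * th ^+ j * ex P g }.

Definition visits (R : realType) (T : R -> R) (J : set R) (n : nat) (x : R) : nat :=
  count (fun j => iter j T x \in J) (iota 1 n).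

Section visits.
Context (R : realType) (T : R -> R).
Implicit Types (J : set R) (n q : nat).

Lemma visitsD J q n x :
  visits T J (q + n) x = (visits T J q x + visits T J n (iter q T x))%N.
Proof.
rewrite /visits iotaD count_cat; congr addn.
rewrite addnC iotaDl count_map; apply: eq_count => j /=.
by rewrite addnC iterD.
Qed.

Lemma visits_sum J n x :
  (visits T J n x)%:R = \sum_(g <- iota 1 n) \1_J (iter g T x) :> R.
Proof.
rewrite /visits; elim: (iota 1 n) => [|g s IH] /=; first by rewrite big_nil.
by rewrite big_cons natrD IH indicE.
Qed.

Lemma visitsS J n x :
  visits T J n.+1 x = ((T x \in J) + visits T J n (T x))%N.
Proof. by rewrite -add1n visitsD [visits _ _ 1 _]/visits /= addn0. Qed.

Lemma visitsSr J n x :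
  visits T J n.+1 x = (visits T J n x + (iter n.+1 T x \in J))%N.
Proof. by have := visitsD J n 1 x; rewrite addn1 [visits _ _ 1 _]/visits /= addn0. Qed.

(** One visit contributes a factor that is affine in an indicator. Peeling off the last time serves
    measurability by induction; peeling off the first one, in [expr_visitsS], serves the recursion
    through invariance. *)
Lemma expr_visitsSr J n x (z : R) : z ^+ visits T J n.+1 x =
  z ^+ visits T J n x * (1 - (1 - z) * \1_J (iter n.+1 T x)).
Proof.
rewrite visitsSr exprD indicE; congr *%R.
by case: (_ \in _); rewrite /= ?expr1 ?expr0 ?mulr1 ?mulr0 ?subr0 ?subKr.
Qed.

Lemma expr_visitsS J n x (z : R) : z ^+ visits T J n.+1 x =
  (1 - (1 - z) * \1_J (T x)) * z ^+ visits T J n (T x).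
Proof.
rewrite visitsS exprD indicE; congr *%R.
by case: (_ \in _); rewrite /= ?expr1 ?expr0 ?mulr1 ?mulr0 ?subr0 ?subKr.
Qed.

Lemma expr_itv01 (z : R) n : 0 <= z <= 1 -> 0 <= z ^+ n <= 1.
Proof. by move=> /andP[z0 z1]; rewrite exprn_ge0//= exprn_ile1. Qed.

Lemma onem_expr_le (z : R) n : 0 <= z <= 1 -> 1 - z ^+ n <= n%:R.
Proof.
move=> z01; elim: n => [|n IH]; first by rewrite expr0 subrr.
rewrite exprSr -natr1; have /andP[h0 h1] := expr_itv01 n z01.
by move: z01 IH => /andP[z0 z1] IH; nra.
Qed.

(** Splitting the count at time [q] factors the power, and [1 - z ^+ a <= a] charges the lost factor
    to the visits up to [q]. If [n < q], the truncated [n - q] is 0 and the bound persists, the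
    visits up to [n] being among those up to [q]. *)
Lemma expr_visits_shift J q n x (z : R) : 0 <= z <= 1 ->
  0 <= z ^+ visits T J (n - q) (iter q T x) - z ^+ visits T J n x
    <= \sum_(g <- iota 1 q) \1_J (iter g T x).
Proof.
move=> z01; rewrite -visits_sum.
have [nq|/ltnW qn] := leqP n q.
  have -> : (n - q = 0)%N by apply/eqP; rewrite subn_eq0.
  rewrite expr0 subr_ge0 (andP (expr_itv01 _ z01)).2 /=.
  rewrite (le_trans (onem_expr_le _ z01))// ler_nat.
  by rewrite -(subnKC nq) visitsD leq_addr.
rewrite -{2 4}(subnKC qn) visitsD exprD.
have /andP[h0 h1] := expr_itv01 (visits T J q x) z01.
have /andP[h2 h3] := expr_itv01 (visits T J (n - q) (iter q T x)) z01.
have := onem_expr_le (visits T J q x) z01.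
by move=> h4; apply/andP; split; nra.
Qed.

End visits.

Section mixing.
Context (R : realType) (P : probability (measurableTypeR R) R) (T : R -> R)
  (C th H : R) (ms : mixing_system P T C th H).
Implicit Types (i : interval R) (J : set (measurableTypeR R)).

Let mT := ms_meas ms.
Let pT := ms_pres ms.

Lemma ms_th0 j : 0 <= th ^+ j.
Proof. by rewrite exprn_ge0//; have /andP[/ltW] := ms_th ms. Qed.

Lemma ms_Cth0 j : 0 <= C * th ^+ j.
Proof. by rewrite mulr_ge0// ?ms_th0// (ms_C ms). Qed.

Lemma measurable_pre j J : measurable J -> measurable (iter j T @^-1` J).
Proof. exact: (measurable_iter_preimage mT). Qed.

Lemma measurable_itvR i : measurable ([set` i] : set (measurableTypeR R)).
Proof. exact: measurable_itv. Qed.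

Lemma bm_indic_iter j J : measurable J -> bmeasurable (fun x : measurableTypeR R => \1_J (iter j T x) : R).
Proof. by move=> mJ; apply: bm_comp (bm_indic _ mJ); exact: measurable_iter. Qed.

Lemma bm_visits J n (z : R) : measurable J -> 0 <= z <= 1 ->
  bmeasurable (fun x : measurableTypeR R => z ^+ visits T J n x).
Proof.
move=> mJ z01; elim: n => [|n IH].
  by under eq_fun do rewrite expr0; exact: bm_cst.
under eq_fun do rewrite expr_visitsSr.
apply: bmM => //; apply: bmB; first exact: bm_cst.
by apply: bmM; [exact: bm_cst|exact: bm_indic_iter].
Qed.

Lemma ex_indicI (A B : set (measurableTypeR R)) j : measurable A -> measurable B ->
  ex P (fun x => \1_A x * \1_B (iter j T x)) = pr P (A `&` iter j T @^-1` B).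
Proof.
move=> mA mB; rewrite -ex_indic; last exact: measurableI (measurable_pre _ _).
by apply: eq_ex => x; rewrite indicI.
Qed.

Lemma ex_indic_iter j J : measurable J ->
  ex P (fun x => \1_J (iter j T x)) = pr P J.
Proof.
move=> mJ; rewrite -(ex_indic P mJ).
by rewrite -(ex_iter mT pT j (bm_indic _ mJ)).
Qed.

Lemma mixing_sets i j J : measurable J ->
  pr P ([set` i] `&` iter j T @^-1` J) <= (pr P [set` i] + C * th ^+ j) * pr P J.
Proof.
move=> mJ; rewrite -(ex_indicI _ (measurable_itvR i) mJ).
have J01 (x : R) : 0 <= (\1_J x : R) <= 1.
  by rewrite indicE; case: (_ \in _); rewrite ?lexx ?ler01.
have := ms_mix ms i j (bm_indic R mJ).1 J01.
rewrite (ex_indic P mJ).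
by rewrite ler_norml mulrDl => /andP[_]; rewrite lerBlDl.
Qed.

(** Three comparisons: the first [q] times are dropped from the count, which costs the returns from
    the first interval to [J] within [q] steps; the gap so created is bridged by mixing; the dropped
    times are restored in the second factor, where by stationarity they cost [q] times the measure
    of [J]. *)
Lemma decoupling i J n q (z : R) : measurable J -> 0 <= z <= 1 ->
  `|ex P (fun x => \1_[set` i] x * z ^+ visits T J n x)
    - pr P [set` i] * ex P (fun x => z ^+ visits T J n x)|
  <= \sum_(g <- iota 1 q) pr P ([set` i] `&` iter g T @^-1` J)
     + C * th ^+ q + q%:R * pr P [set` i] * pr P J.
Proof.
move=> mJ z01.
pose phi x := z ^+ visits T J (n - q) x.
have bphi : bmeasurable (phi : measurableTypeR R -> R) by exact: bm_visits.
have bphiq : bmeasurable (fun x : measurableTypeR R => phi (iter q T x)).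
  by apply: bm_comp => //; exact: measurable_iter.
have bI : bmeasurable (\1_[set` i] : measurableTypeR R -> R).
  by apply: bm_indic; exact: measurable_itvR.
have bN := bm_visits n mJ z01.
have phi01 x : 0 <= phi x <= 1 by exact: expr_itv01.
have ephi : ex P (fun x => phi (iter q T x)) = ex P phi.
  by apply: (ex_iter mT pT) => // x; have /andP[] := phi01 x.
have h1 : `|ex P (fun x => \1_[set` i] x * z ^+ visits T J n x) -
            ex P (fun x => \1_[set` i] x * phi (iter q T x))|
    <= \sum_(g <- iota 1 q) pr P ([set` i] `&` iter g T @^-1` J).
  rewrite -exB; [|exact: bmM|exact: bmM].
  under eq_bigr do rewrite -ex_indicI//.
  rewrite -ex_sum; last by move=> g; apply: bmM => //; exact: bm_indic_iter.
  apply: norm_ex_le.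
  - by apply: bmB; exact: bmM.
  - by apply: bm_sum => g; apply: bmM => //; exact: bm_indic_iter.
  - move=> x; rewrite -mulrBr -mulr_sumr normrM ger0_norm//.
    apply: ler_wpM2l => //.
    have /andP[a b] := expr_visits_shift T J q n x z01.
    by rewrite distrC ger0_norm.
have h2 : `|ex P (fun x => \1_[set` i] x * phi (iter q T x)) - pr P [set` i] * ex P phi|
    <= C * th ^+ q.
  apply: le_trans (ms_mix ms i q bphi.1 phi01) _.
  rewrite -[leRHS]mulr1 ler_wpM2l ?ms_Cth0//.
  by rewrite -[leRHS](ex_cst P 1); apply: le_ex => //; [exact: bm_cst|move=> x; have /andP[] := phi01 x].
have h3 : `|ex P phi - ex P (fun x => z ^+ visits T J n x)| <= q%:R * pr P J.
  rewrite -ephi -exB//.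
  have -> : q%:R * pr P J = ex P (fun x => \sum_(g <- iota 1 q) \1_J (iter g T x)).
    rewrite ex_sum; last by move=> g; exact: bm_indic_iter.
    under eq_bigr do rewrite ex_indic_iter//.
    by rewrite big_const_seq count_predT size_iota iter_addr_0 mulr_natl.
  apply: norm_ex_le.
  - exact: bmB.
  - by apply: bm_sum => g; exact: bm_indic_iter.
  - move=> x; have /andP[a b] := expr_visits_shift T J q n x z01.
    by rewrite ger0_norm.
have I0 := pr_ge0 P [set` i].
set a := ex P _ in h1 *; set b := ex P _ in h1 h2; set c := ex P phi in h2 h3.
set e := ex P _ in h3 *.
rewrite (_ : a - _ = (a - b) + (b - pr P [set` i] * c) + pr P [set` i] * (c - e)); last ring.
rewrite (le_trans (ler_normD _ _))// lerD//.
  by rewrite (le_trans (ler_normD _ _))// lerD.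
by rewrite normrM (ger0_norm I0) mulrAC mulrC ler_wpM2r.
Qed.

(** The error of [decoupling] when both intervals are [J]: the cost of one step of the recursion. *)
Definition rec_err q J := \sum_(g <- iota 1 q) pr P (J `&` iter g T @^-1` J)
  + C * th ^+ q + q%:R * pr P J ^+ 2.

(** The recursion multiplies the previous error by [1 - (1 - z) p], which lies in [0, 1], and adds
    at most one [rec_err]; errors therefore grow only linearly in [n]. *)
Lemma visits_pgf i n q (z : R) : 0 <= z <= 1 ->
  `|ex P (fun x => z ^+ visits T [set` i] n x) - (1 - (1 - z) * pr P [set` i]) ^+ n|
  <= n%:R * rec_err q [set` i].
Proof.
move=> z01; set J := [set` i].
have mJ : measurable (J : set (measurableTypeR R)) by exact: measurable_itvR.
elim: n => [|n IH].
  by under eq_ex do rewrite expr0; rewrite ex_cst expr0 subrr normr0 mul0r.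
set a := fun n => ex P (fun x => z ^+ visits T J n x).
have rec : a n.+1 = a n - (1 - z) * ex P (fun x => \1_J x * z ^+ visits T J n x).
  rewrite /a; under eq_ex do rewrite expr_visitsS.
  (* The integrand depends on [T x] only, so invariance removes the shift. *)
  rewrite (@ex_comp _ _ _ P T mT pT (fun x => (1 - (1 - z) * \1_J x) * z ^+ visits T J n x)).
  - rewrite -exZ; last by apply: bmM; [exact: bm_indic|exact: bm_visits].
    rewrite -exB; last 2 first.
    + exact: bm_visits.
    + by apply: bmM; [exact: bm_cst|apply: bmM; [exact: bm_indic|exact: bm_visits]].
    + by apply: eq_ex => x; ring.
  - apply: bmM; last exact: bm_visits.
    apply: bmB; first exact: bm_cst.
    by apply: bmM; [exact: bm_cst|exact: bm_indic].
  - move=> x; rewrite mulr_ge0//; last by have /andP[] := expr_itv01 (visits T J n x) z01.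
    by rewrite indicE; case/andP: z01 => z0 z1; case: (_ \in _); rewrite /= ?mulr1 ?mulr0; lra.
have := decoupling i n q mJ z01; rewrite -/J -/(a n).
rewrite (_ : _ + _ + q%:R * _ * _ = rec_err q J); last by rewrite /rec_err; ring.
set b := ex P _ in rec *; set p := pr P J; move=> dec.
have p0 : 0 <= p by exact: pr_ge0.
have p1 : p <= 1 by exact: pr_le1.
case/andP: z01 => z0 z1.
have zp0 : 0 <= (1 - z) * p by rewrite mulr_ge0// subr_ge0.
have zp1 : (1 - z) * p <= 1 by rewrite mulr_ile1 ?subr_ge0//; lra.
set e := rec_err q J in IH dec *.
have E : a n.+1 - (1 - (1 - z) * p) ^+ n.+1 =
  (1 - (1 - z) * p) * (a n - (1 - (1 - z) * p) ^+ n) - (1 - z) * (b - p * a n).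
  by rewrite rec exprS; ring.
rewrite -/(a n.+1) E (_ : n.+1%:R * e = n%:R * e + e); last by rewrite -natr1 mulrDl mul1r.
rewrite (le_trans (ler_normB _ _))// lerD//.
  rewrite normrM (le_trans _ IH)// -[leRHS]mul1r ler_wpM2r// ger0_norm; lra.
rewrite normrM -[leRHS]mul1r ler_pM// ger0_norm; lra.
Qed.

Lemma local_visits_pgf i i' n q (z : R) : 0 <= z <= 1 ->
  `|ex P (fun x => \1_[set` i] x * z ^+ visits T [set` i'] n x)
    - pr P [set` i] * (1 - (1 - z) * pr P [set` i']) ^+ n|
  <= \sum_(g <- iota 1 q) pr P ([set` i] `&` iter g T @^-1` [set` i'])
     + C * th ^+ q + q%:R * pr P [set` i] * pr P [set` i']
     + pr P [set` i] * (n%:R * rec_err q [set` i']).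
Proof.
move=> z01.
have h1 := decoupling i n q (measurable_itvR i') z01.
have h2 := visits_pgf i' n q z01.
have I0 := pr_ge0 P [set` i].
set b := ex P _ in h1 *; set a := ex P _ in h1 h2.
rewrite (_ : b - _ = (b - pr P [set` i] * a)
  + pr P [set` i] * (a - (1 - (1 - z) * pr P [set` i']) ^+ n)); last ring.
rewrite (le_trans (ler_normD _ _))// lerD//.
by rewrite normrM (ger0_norm I0) ler_wpM2l.
Qed.

End mixing.

(** * Cells *)

Definition cell (R : realType) (a s : R) (k : nat) : interval R :=
  `[a + s * k%:R, a + s * k.+1%:R[.

Definition fat_cell (R : realType) (a s r : R) (k : nat) : interval R :=
  `[a + s * k%:R - r, a + s * k.+1%:R + r].

Section cells.
Context (R : realType).
Implicit Types (a s r x : R).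

Lemma in_cell a s k x :
  (x \in [set` cell a s k]) = (a + s * k%:R <= x < a + s * k.+1%:R).
Proof. by rewrite mem_setE in_itv. Qed.

Lemma in_fat_cell a s r k x :
  (x \in [set` fat_cell a s r k]) = (a + s * k%:R - r <= x <= a + s * k.+1%:R + r).
Proof. by rewrite mem_setE in_itv. Qed.

Lemma count_range_le (u v : R) M : u - 1 <= v ->
  \sum_(k < M) ((u <= k%:R <= v)%R%:R : R) <= v - u + 1.
Proof.
(* The second bound, by [M - u], is what makes the induction work: when [M] falls in the range it
   gives the first one, since [M <= v]. *)
move=> uv; suff [] : \sum_(k < M) ((u <= k%:R <= v)%R%:R : R) <= v - u + 1 /\
    (\sum_(k < M) ((u <= k%:R <= v)%R%:R : R) <= Num.max 0 (M%:R - u)) by [].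
elim: M => [|M [IH1 IH2]].
  by rewrite big_ord0 le_max lexx; split => //; lra.
rewrite big_ord_recr/=; have [/andP[uM Mv]|_] := boolP (u <= M%:R <= v).
  rewrite (max_idPr _) in IH2; last by rewrite subr_ge0.
  rewrite (max_idPr _); last by rewrite -(natr1 M); lra.
  by rewrite  -(natr1 M) /= mulr1n; split; lra.
rewrite addr0; split => //; apply: le_trans IH2 _.
by rewrite ge_max !le_max lexx/= -(natr1 M); apply/orP; right; lra.
Qed.

(** The indices of the fat cells containing [x] fill a range of length [2 r / s + 1], and
    [1 <= r / s] absorbs the rounding. *)
Lemma fat_cell_multiplicity a s r x M : 0 < s <= r ->
  \sum_(k < M) (\1_[set` fat_cell a s r k] x : R) <= 4 * r / s.
Proof.
move=> /andP[s0 sr].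
have s1 : 1 <= r / s by rewrite ler_pdivlMr ?mul1r.
apply: (@le_trans _ _ (\sum_(k < M) (((x - r - a) / s - 1 <= k%:R <= (x + r - a) / s)%R%:R : R))).
  apply: ler_sum => k _; rewrite indicE in_fat_cell ler_nat.
  have [|//] := boolP (a + s * k%:R - r <= x <= _).
  rewrite -natr1 => /andP[h1 h2]; rewrite (_ : _ && _ = true)//.
  by rewrite lerBlDr ler_pdivrMr// ler_pdivlMr//; apply/andP; split; nra.
apply: le_trans (count_range_le _ _) _.
  have : (x - r - a) / s <= (x + r - a) / s by rewrite ler_pM2r ?invr_gt0//; lra.
  by lra.
rewrite (_ : (x + r - a) / s - _ + 1 = 2 * (r / s) + 2); last by field; rewrite gt_eqF.
by lra.
Qed.

Lemma cell_cover a s M x : 0 < s -> a <= x < a + s * M%:R ->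
  exists2 k, (k < M)%N & x \in [set` cell a s k].
Proof.
move=> s0 /andP[ax xM]; exists (Num.truncn ((x - a) / s)).
  by rewrite truncn_lt_nat ?divr_ge0 ?subr_ge0// ?ltW// ltr_pdivrMr//; lra.
rewrite in_cell; have /truncn_itv/andP[h1 h2] : 0 <= (x - a) / s.
  by rewrite divr_ge0 ?subr_ge0// ltW.
move: h1 h2; rewrite ler_pdivlMr// ltr_pdivrMr// => h1 h2.
by apply/andP; split; lra.
Qed.

Lemma cell_disj a s k l x : 0 < s -> x \in [set` cell a s k] ->
  x \in [set` cell a s l] -> k = l.
Proof.
move=> s0; rewrite !in_cell => /andP[k1 k2] /andP[l1 l2].
suff h m n : a + s * m%:R <= x -> x < a + s * n.+1%:R -> (m <= n)%N.
  by apply/eqP; rewrite eqn_leq !h.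
move=> h1 h2; rewrite -ltnS -(ltr_nat R) -(ltr_pM2l s0); lra.
Qed.

Lemma sum_cell_le1 a s M x : 0 < s -> \sum_(k < M) (\1_[set` cell a s k] x : R) <= 1.
Proof.
move=> s0.
have [[k kx]|nk] := pselect (exists k : 'I_M, x \in [set` cell a s k]).
  rewrite (bigD1 k)//= indicE kx big1 ?addr0// => j jk; rewrite indicE.
  have [jx|//] := boolP (_ \in _).
  by have /val_inj kj := cell_disj s0 jx kx; rewrite kj eqxx in jk.
rewrite big1// => k _; rewrite indicE; have [jx|//] := boolP (_ \in _).
by exfalso; apply: nk; exists k.
Qed.

Lemma fat_cell_dist a s r k x y : x \in [set` cell a s k] ->
  y \in [set` fat_cell a s r k] -> `|y - x| <= r + s.
Proof.
rewrite in_cell in_fat_cell -natr1 ler_norml => /andP[h1 h2] /andP[h3 h4].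
by apply/andP; split; lra.
Qed.

Lemma dist_fat_cell a s r k x y : x \in [set` cell a s k] ->
  `|y - x| <= r -> y \in [set` fat_cell a s r k].
Proof.
rewrite in_cell in_fat_cell -natr1 ler_norml => /andP[h1 h2] /andP[h3 h4].
by apply/andP; split; lra.
Qed.

Lemma fat_cell_dist2 a s r k x y : 0 <= s -> x \in [set` fat_cell a s r k] ->
  y \in [set` fat_cell a s r k] -> `|y - x| <= 2 * r + s.
Proof.
rewrite !in_fat_cell -natr1 ler_norml => s0 /andP[h1 h2] /andP[h3 h4].
by apply/andP; split; lra.
Qed.

End cells.

(** * Short returns, and sums of errors over cells *)

Definition near_return (R : realType) (T : R -> R) (g : nat) (r : R) : set R :=
  [set x | `|iter g T x - x| <= r].

Section cell_sums.
Context (R : realType) (P : probability (measurableTypeR R) R) (T : R -> R)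
  (C th H : R) (ms : mixing_system P T C th H).
Implicit Types (J : set (measurableTypeR R)).

Let mT := ms_meas ms.
Let mi := @measurable_itvR R.

Lemma measurable_near_return g r :
  measurable (near_return T g r : set (measurableTypeR R)).
Proof.
rewrite (_ : near_return _ _ _ = (fun x => `|iter g T x - x|) @^-1` `]-oo, r]); last first.
  by apply/seteqP; split => x /=; rewrite /near_return/= in_itv.
rewrite -[X in measurable X]setTI.
have m : measurable_fun setT (fun x : measurableTypeR R => `|iter g T x - x|).
  apply: measurableT_comp => //; apply: measurable_funB => //.
  exact: measurable_iter.
exact: (m measurableT _ (measurable_itv _)).
Qed.

(** Integration of the pointwise bound of the sum of indicators by [c] times the indicator of [B];
    overlap bounds for cells become measure estimates in this way. *)
Lemma sum_pr_le (I : seq nat) (A : nat -> set (measurableTypeR R)) B c :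
  (forall k, measurable (A k)) -> measurable B -> 0 <= c ->
  (forall k, A k `<=` B) -> (forall x, \sum_(k <- I) (\1_(A k) x : R) <= c) ->
  \sum_(k <- I) pr P (A k) <= c * pr P B.
Proof.
move=> mA mB c0 AB Ac; under eq_bigr do rewrite -ex_indic//.
rewrite -ex_sum; last by move=> k; exact: bm_indic.
rewrite -ex_indic// -exZ; last exact: bm_indic.
apply: le_ex.
- by apply: bm_sum => k; exact: bm_indic.
- by apply: bmM; [exact: bm_cst|exact: bm_indic].
- move=> x; rewrite [in leRHS]indicE; have [xB|xB] := boolP (x \in B); first by rewrite mulr1.
  rewrite mulr0 big1// => k _; rewrite indicE memNset// => /AB/mem_set.
  by rewrite (negbTE xB).
Qed.

Lemma pr_cell_le a s k : 0 <= s -> pr P [set` cell a s k] <= H * s.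
Proof.
move=> s0; apply: (@le_trans _ _ (pr P `[a + s * k%:R, a + s * k.+1%:R])).
  apply: le_pr; [exact: mi|exact: mi|].
  by move=> x /=; rewrite !in_itv/= => /andP[-> /ltW].
rewrite (le_trans (ms_dens ms _))// -?natr1; first by nra.
by rewrite ler_wpM2l ?(ms_H ms)//; lra.
Qed.

Lemma pr_fat_cell_le a s r k : 0 <= s <= r -> pr P [set` fat_cell a s r k] <= H * (3 * r).
Proof.
move=> /andP[s0 sr]; rewrite (le_trans (ms_dens ms _))// -?natr1; first by nra.
by rewrite ler_wpM2l ?(ms_H ms)//; lra.
Qed.

Lemma sum_pr_cell_le1 a s M : 0 < s -> \sum_(k < M) pr P [set` cell a s k] <= 1.
Proof.
move=> s0; rewrite -[leRHS](mul1r 1) -[X in _ <= 1 * X](prT P).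
rewrite -(big_mkord xpredT (fun k => pr P [set` cell a s k])) .
apply: sum_pr_le => // x; rewrite big_mkord; exact: sum_cell_le1.
Qed.

(** Once the cell of [x] is fixed, a target that moves with [x] can be replaced by the fixed set
    [A k], to which mixing applies. This is the basic estimate for an event that relates [x] to one
    later iterate. *)
Lemma cell_union_bound (B : set (measurableTypeR R)) a s M
    (A : nat -> set (measurableTypeR R)) j :
  0 < s -> measurable B -> (forall k, measurable (A k)) ->
  (forall x k, B x -> (k < M)%N -> x \in [set` cell a s k] -> A k (iter j T x)) ->
  pr P (B `&` `[a, a + s * M%:R[) <=
    \sum_(k < M) (pr P [set` cell a s k] + C * th ^+ j) * pr P (A k).
Proof.
move=> s0 mB mA BA.
pose D k := [set` cell a s k] `&` iter j T @^-1` (A k).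
have mD k : measurable (D k : set (measurableTypeR R)).
  by apply: measurableI; [exact: mi|exact: (measurable_pre ms)].
apply: (@le_trans _ _ (pr P (\big[setU/set0]_(k < M) D k))).
  apply: le_pr.
  - by apply: measurableI => //; exact: mi.
  - exact: bigsetU_measurable.
  - move=> x [Bx /=]; rewrite in_itv/= => /(cell_cover s0)[k kM xk].
    by rewrite -bigcup_mkord; exists k => //; split; [exact: set_mem|exact: BA kM xk].
apply: le_trans (pr_bigcup_ord _ _ mD) _.
by apply: ler_sum => k _; exact: (mixing_sets ms).
Qed.

(** Only finitely many cells are summed at a time; bounds that are uniform over bounded windows pass
    to the whole line by continuity from below. *)
Lemma le_pr_exhaust (B : set (measurableTypeR R)) s c : 0 < s -> measurable B ->
  (forall a M, pr P (B `&` `[a, a + s * M%:R[) <= c) -> pr P B <= c.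
Proof.
move=> s0 mB Bc.
pose D n : set (measurableTypeR R) :=
  B `&` `[- (s * n%:R), - (s * n%:R) + s * (n + n)%:R[.
have mD n : measurable (D n) by apply: measurableI => //; exact: mi.
have UD : \bigcup_n D n = B.
  apply/seteqP; split => [x [n _ [] //]|x Bx].
  exists (Num.truncn (`|x| / s)).+1 => //; split => //=; rewrite in_itv/=.
  have : `|x| / s < (Num.truncn (`|x| / s)).+1%:R by rewrite truncnS_gt.
  rewrite ltr_pdivrMr// natrD => h.
  have := ler_norm x; have := ler_norm (- x); rewrite normrN => h1 h2.
  by apply/andP; split; nra.
have : (P \o D) n @[n --> \oo] --> P B.
  rewrite -UD; apply: nondecreasing_cvg_mu => //; first by rewrite UD.
  move=> m n mn; apply/subsetPset => x [Bx]; rewrite /= !in_itv/= => /andP[h1 h2].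
  move: mn; rewrite -(ler_nat R) => mn.
  by split => //=; rewrite in_itv/=; move: h2; rewrite !natrD => h2; apply/andP; split; nra.
move=> cv; rewrite -lee_fin -pr_EFin//; move/cvg_lim : (cv) => <- //.
apply: lime_le; first by apply/cvg_ex; exists (P B).
by apply: nearW => n /=; rewrite pr_EFin// lee_fin Bc.
Qed.

(** Cells of length [r] are used, for which the overlap bound [4 r / s] is 4. The estimate is of use
    for late times only: for fixed [g] it does not vanish with [r]. *)
Lemma pr_near_return_le g r : 0 < r ->
  pr P (near_return T g r) <= 4 * (H * r + C * th ^+ g).
Proof.
move=> r0; apply: (le_pr_exhaust r0) => [|a M]; first exact: measurable_near_return.
apply: le_trans (cell_union_bound (A := fun k => [set` fat_cell a r r k])
  _ _ _ (fun x k Bx _ xk => set_mem (dist_fat_cell xk Bx))) _ => //.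
  exact: measurable_near_return.
apply: (@le_trans _ _ ((H * r + C * th ^+ g) * \sum_(k < M) pr P [set` fat_cell a r r k])).
  rewrite mulr_sumr; apply: ler_sum => k _; rewrite ler_wpM2r ?pr_ge0// lerD2r.
  by apply: pr_cell_le; rewrite ltW.
rewrite mulrC ler_wpM2r//.
  by rewrite addr_ge0 ?mulr_ge0// ?(ms_H ms) ?(ms_C ms) ?(ms_th0 ms)// ltW.
rewrite -(big_mkord xpredT (fun k => pr P [set` fat_cell a r r k])).
rewrite (_ : 4 = 4 * pr P setT); last by rewrite prT mulr1.
apply: sum_pr_le => // x; rewrite big_mkord.
apply: le_trans (fat_cell_multiplicity _ _ _ _) _; first by rewrite r0 lexx.
by rewrite -mulrA divff ?mulr1// gt_eqF.
Qed.

Lemma sum_Cth_le M q : \sum_(g <- iota M q) C * th ^+ g <= C * th ^+ M / (1 - th).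
Proof.
have /andP[t0 t1] := ms_th ms.
elim: q M => [|q IH] M /=.
  by rewrite big_nil divr_ge0// ?(ms_Cth0 ms)// subr_ge0 ltW.
rewrite big_cons; apply: le_trans (lerD (lexx _) (IH _)) _.
rewrite -subr_ge0 exprS (_ : _ - _ = 0)//.
by field; rewrite subr_eq0 gt_eqF.
Qed.

Lemma sum_Cth_small e : 0 < e -> exists M, forall M' q, (M <= M')%N ->
  \sum_(g <- iota M' q) C * th ^+ g <= e.
Proof.
move=> e0; have /andP[t0 t1] := ms_th ms.
have : (fun n => C * th ^+ n / (1 - th)) @ \oo --> C * 0 / (1 - th).
  apply: cvgMl; apply: cvgMr; apply: cvg_expr; by rewrite ger0_norm// ltW.
rewrite mulr0 mul0r => /cvgrPdist_le /(_ e e0) [M _ hM].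
exists M => M' q MM'; apply: le_trans (sum_Cth_le _ _) _.
by have := hM M' MM'; rewrite sub0r normrN; apply: le_trans; rewrite ler_norm.
Qed.

Lemma Cth_small e : 0 < e -> exists M, forall g, (M <= g)%N -> C * th ^+ g <= e.
Proof.
move=> /sum_Cth_small[M hM]; exists M => g Mg.
by have := hM g 1%N Mg; rewrite /= big_seq1.
Qed.

(** A periodic point also returns exactly at all multiples of its period. At a large multiple the
    mixing term of [pr_near_return_le] is negligible, and then the radius can be taken small. *)
Lemma pr_periodic p : (0 < p)%N -> pr P [set x | iter p T x = x] = 0.
Proof.
move=> p0; set B : set (measurableTypeR R) := [set x | _].
have BE : B = near_return T p 0.
  by apply/seteqP; split => x; rewrite /B /near_return/= normr_le0 subr_eq0 => /eqP.
have mB : measurable B by rewrite BE; exact: measurable_near_return.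
have Bsub j r : 0 < r -> B `<=` near_return T (p * j) r.
  move=> r0 x Bx; rewrite /near_return/= (_ : iter _ _ _ = x) ?subrr ?normr0 ?ltW//.
  by rewrite mulnC iterM; elim: j => //= j ->.
apply/eqP; rewrite eq_le pr_ge0 andbT; apply/ler_addgt0Pl => e e0; rewrite addr0.
have e8 : 0 < e / 8 by rewrite divr_gt0.
have [M hM] := Cth_small e8.
pose r := e / 8 / (H + 1).
have H0 := ms_H ms.
have r0 : 0 < r by rewrite divr_gt0// ltr_wpDl.
have Hr : H * r <= e / 8.
  by rewrite /r mulrA ler_pdivrMr ?ltr_wpDl//; nra.
apply: le_trans (le_pr P mB (measurable_near_return (p * M) r) (Bsub M r r0)) _.
apply: le_trans (pr_near_return_le _ r0) _.
by have := hM (p * M)%N (leq_pmull _ p0); lra.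
Qed.

(** Total error over [M] cells at time [n] with gap [q]. Short returns enter once through the
    localization to a cell and [n] more times through the recursion, whence the factor
    [1 + 4 n H r]; likewise mixing enters once per cell and [n] times with total weight 1, whence
    [M + n]. *)
Definition tot_err q n M r :=
  (1 + 4 * n%:R * H * r) * \sum_(g <- iota 1 q) pr P (near_return T g (3 * r))
  + (M%:R + n%:R) * (C * th ^+ q) + 3 * H * q%:R * r + 9 * H ^+ 2 * n%:R * q%:R * r ^+ 2.

(** Any intervals inside the fat cells are allowed, so that thin and fat cells are treated at once.
    Short returns from the recursion are overlapped up to [4 r / s] times, but carry the weight
    [P(cell) <= H s], which cancels the [s]: this part of the error does not depend on the mesh. *)
Lemma sum_local_pgf a s r M n q (J : nat -> interval R) (z : R) :
  0 < s <= r -> 0 <= z <= 1 ->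
  (forall k, [set` J k] `<=` [set` fat_cell a s r k]) ->
  \sum_(k < M) `|ex P (fun x => \1_[set` cell a s k] x * z ^+ visits T [set` J k] n x)
    - pr P [set` cell a s k] * (1 - (1 - z) * pr P [set` J k]) ^+ n|
  <= tot_err q n M r.
Proof.
move=> /andP[s0 sr] z01 Jfat; have r0 : 0 < r by rewrite (lt_le_trans s0).
have H0 := ms_H ms.
(* The radius [3 r] comes from two points of one fat cell, which are at distance at most
   [2 r + s]. *)
set E := \sum_(g <- iota 1 q) pr P (near_return T g (3 * r)).
set p := fun k => pr P [set` cell a s k].
set u := fun k => pr P [set` J k].
have p0 k : 0 <= p k by exact: pr_ge0.
have u0 k : 0 <= u k by exact: pr_ge0.
have uH k : u k <= H * (3 * r).
  apply: le_trans (le_pr P _ _ (Jfat k)) _; [exact: mi|exact: mi|].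
  by apply: pr_fat_cell_le; rewrite ltW.
have pH k : p k <= H * s by apply: pr_cell_le; rewrite ltW.
have sp : \sum_(k < M) p k <= 1 by exact: sum_pr_cell_le1.
have mJ k : measurable ([set` J k] : set (measurableTypeR R)) by exact: mi.
pose e1 k := \sum_(g <- iota 1 q) pr P ([set` cell a s k] `&` iter g T @^-1` [set` J k]).
pose e2 k := \sum_(g <- iota 1 q) pr P ([set` J k] `&` iter g T @^-1` [set` J k]).
have E1 : \sum_(k < M) e1 k <= E.
  rewrite exchange_big/= ler_sum// => g _.
  rewrite -[leRHS]mul1r -(big_mkord xpredT (fun k => pr P ([set` cell a s k] `&` iter g T @^-1` [set` J k]))).
  apply: sum_pr_le => //.
  - by move=> k; apply: measurableI; [exact: mi|exact: (measurable_pre ms)].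
  - exact: measurable_near_return.
  - move=> k x [/mem_set xk /Jfat/mem_set yk]; rewrite /near_return/=.
    by apply: le_trans (fat_cell_dist xk yk) _; lra.
  - move=> x; apply: le_trans _ (sum_cell_le1 a M x s0); rewrite big_mkord.
    apply: ler_sum => k _; rewrite !indicE in_setI ler_nat.
    by case: (x \in [set` cell a s k]); case: (_ \in _).
have E2 : \sum_(k < M) e2 k <= 4 * r / s * E.
  rewrite exchange_big/= mulr_sumr ler_sum// => g _.
  rewrite -(big_mkord xpredT (fun k => pr P ([set` J k] `&` iter g T @^-1` [set` J k]))).
  apply: sum_pr_le => //.
  - by move=> k; apply: measurableI; [exact: mi|exact: (measurable_pre ms)].
  - exact: measurable_near_return.
  - by rewrite divr_ge0 ?mulr_ge0// ltW.
  - move=> k x [/Jfat/mem_set xk /Jfat/mem_set yk]; rewrite /near_return/=.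
    by apply: le_trans (fat_cell_dist2 (ltW s0) xk yk) _; lra.
  - move=> x; apply: le_trans _ (fat_cell_multiplicity a x M _); last by rewrite s0 sr.
    rewrite big_mkord; apply: ler_sum => k _; rewrite !indicE in_setI ler_nat.
    have [xk|//] := boolP (x \in [set` J k]).
    by rewrite (mem_set (Jfat k x (set_mem xk))); case: (_ \in _).
have c0 : 0 <= C * th ^+ q by exact: (ms_Cth0 ms).
set c := C * th ^+ q in c0 *; have cE : C * th ^+ q = c by [].
have key k : `|ex P (fun x => \1_[set` cell a s k] x * z ^+ visits T [set` J k] n x)
    - p k * (1 - (1 - z) * u k) ^+ n|
  <= e1 k + c + 3 * H * q%:R * r * p k + n%:R * H * s * e2 k
     + n%:R * c * p k + 9 * H ^+ 2 * n%:R * q%:R * r ^+ 2 * p k.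
  apply: le_trans (local_visits_pgf ms (cell a s k) (J k) n q z01) _.
  rewrite -/(e1 k) -/c -/(p k) -/(u k) /rec_err -/(e2 k) -/c.
  have e20 : 0 <= e2 k by apply: sumr_ge0 => g _; exact: pr_ge0.
  have qpu : q%:R * p k * u k <= 3 * H * q%:R * r * p k.
    rewrite (_ : 3 * H * q%:R * r * p k = q%:R * p k * (H * (3 * r))); last by ring.
    by rewrite ler_wpM2l// mulr_ge0.
  have pe : p k * (n%:R * e2 k) <= n%:R * H * s * e2 k.
    rewrite (_ : n%:R * H * s * e2 k = (H * s) * (n%:R * e2 k)); last by ring.
    by rewrite ler_wpM2r// mulr_ge0.
  have pu : p k * (n%:R * (q%:R * u k ^+ 2)) <= 9 * H ^+ 2 * n%:R * q%:R * r ^+ 2 * p k.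
    rewrite (_ : 9 * H ^+ 2 * n%:R * q%:R * r ^+ 2 * p k =
      p k * (n%:R * (q%:R * (H * (3 * r)) ^+ 2))); last by ring.
    by rewrite !ler_wpM2l// lerXn2r// ?nnegrE// mulr_ge0// mulr_ge0// ltW.
  rewrite (_ : p k * (n%:R * (e2 k + c + q%:R * u k ^+ 2)) =
    p k * (n%:R * e2 k) + n%:R * c * p k + p k * (n%:R * (q%:R * u k ^+ 2))); last by ring.
  by move: qpu pe pu; set A1 := q%:R * _ * _; lra.
apply: le_trans; first by apply: ler_sum => k _; exact: key.
rewrite /tot_err cE; clearbody c.
rewrite !big_split/= -!mulr_sumr sumr_const card_ord -[c *+ M]mulr_natl.
have h1 : 3 * H * q%:R * r * \sum_(k < M) p k <= 3 * H * q%:R * r.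
  by rewrite ler_piMr// !mulr_ge0// ltW.
have h2 : n%:R * c * \sum_(k < M) p k <= n%:R * c by rewrite ler_piMr// mulr_ge0.
have h3 : 9 * H ^+ 2 * n%:R * q%:R * r ^+ 2 * \sum_(k < M) p k <=
    9 * H ^+ 2 * n%:R * q%:R * r ^+ 2.
  by rewrite ler_piMr// !mulr_ge0// ?exprn_ge0// ltW.
have h4 : n%:R * H * s * \sum_(k < M) e2 k <= 4 * n%:R * H * r * E.
  apply: (@le_trans _ _ (n%:R * H * s * (4 * r / s * E))).
    by rewrite ler_wpM2l// !mulr_ge0// ltW.
  rewrite le_eqVlt; apply/orP; left; apply/eqP; field; exact: lt0r_neq0.
by rewrite -/E; lra.
Qed.

End cell_sums.

(** * First return maps and excursions *)

Lemma le_pr_bigcup d (T : measurableType d) (R : realType) (P : probability T R)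
    (A : nat -> set T) c : (forall n, measurable (A n)) -> nondecreasing_seq A ->
  (forall n, pr P (A n) <= c) -> pr P (\bigcup_n A n) <= c.
Proof.
move=> mA ndA Ac.
have mU : measurable (\bigcup_n A n) by exact: bigcupT_measurable.
have cv : (P \o A) n @[n --> \oo] --> P (\bigcup_n A n) by exact: nondecreasing_cvg_mu.
rewrite -lee_fin -pr_EFin//; move/cvg_lim : (cv) => <- //.
apply: lime_le; first by apply/cvg_ex; exists (P (\bigcup_n A n)).
by apply: nearW => n /=; rewrite pr_EFin// lee_fin Ac.
Qed.

(** [A n] lies in the tail union from [n] on, whose measure decreases to that of the limit superior.
    Almost sure facts become convergence in probability. *)
Lemma pr_limsup0 d (T : measurableType d) (R : realType) (P : probability T R)
    (A : nat -> set T) : (forall n, measurable (A n)) ->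
  pr P (lim_sup_set A) = 0 -> (pr P (A n)) @[n --> \oo] --> (0 : R).
Proof.
move=> mA A0; apply/cvgrPdist_le => e e0.
have mL : measurable (lim_sup_set A).
  by apply: bigcap_measurable => // n _; apply: bigcup_measurable => k _.
have : (P \o (fun n => \bigcup_(k >= n) A k)) n @[n --> \oo] --> 0%:E.
  rewrite -A0 -pr_EFin//; apply: lim_sup_set_cvg => //.
  apply: le_lt_trans (probability_le1 _ _) _; last exact: ltry.
  by apply: bigcup_measurable.
move=> /fine_cvgP[_ /cvgrPdist_le/(_ e e0)]; apply: filterS => n /=.
rewrite !sub0r !normrN !ger0_norm ?fine_ge0//; apply: le_trans.
apply: le_pr => //; first by apply: bigcup_measurable.
by move=> x Ax; exists n => /=.
Qed.

Section first_return.
Context (R : realType) (f : R -> R) (Y : set R).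
Let F := first_return_map f Y.

Lemma first_return_mapE t y : (forall i, (0 < i <= t)%N -> ~ Y (iter i f y)) ->
  Y (iter t.+1 f y) -> F y = iter t.+1 f y.
Proof.
move=> nY Yt; rewrite /F /first_return_map /first_return_time.
case: pselect => [h|]; last by move=> nh; exfalso; apply: nh; exists t.+1; apply/asboolP; split.
congr iter; case: ex_minnP => m /asboolP[m0 Ym] mmin.
apply/eqP; rewrite eqn_leq mmin/=; last exact/asboolP.
rewrite ltnNge; apply/negP => mt; by apply: (nY m _ Ym); rewrite m0.
Qed.

Lemma first_return_map_in y : Y y -> Y (F y).
Proof.
move=> Yy; rewrite /F /first_return_map /first_return_time.
by case: pselect => // h; case: ex_minnP => m /asboolP[].
Qed.

Lemma iter_first_return_in m y : Y y -> Y (iter m F y).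
Proof. by move=> Yy; elim: m => //= m; exact: first_return_map_in. Qed.

(** At time [n] the orbit is [t] steps into the excursion that follows its last visit to [Y], and
    that visit is the point of the induced orbit whose index is the number of visits so far. *)
Lemma orbit_decomposition n x : Y x ->
  exists2 t, iter n f x = iter t f (iter (visits f Y n x) F x) &
    forall i, (0 < i <= t)%N -> ~ Y (iter i f (iter (visits f Y n x) F x)).
Proof.
move=> Yx; elim: n => [|n [t E nY]].
  by exists 0%N => // i; rewrite leqn0 => /andP[/lt0n_neq0/negbTE ->].
rewrite visitsSr; have [Yn|Yn] := boolP (iter n.+1 f x \in Y).
  exists 0%N => [|i]; last by rewrite leqn0 => /andP[/lt0n_neq0/negbTE ->].
  rewrite addn1 /= (@first_return_mapE t)//; first by rewrite iterS -E.
  by rewrite iterS -E -iterS; exact: set_mem.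
rewrite addn0; exists t.+1 => [|i /andP[i0]]; first by rewrite !iterS E.
rewrite leq_eqVlt => /predU1P[->|it]; last by apply: nY; rewrite i0.
by rewrite iterS -E -iterS; move/negP: Yn; rewrite inE.
Qed.

Lemma orbit_in n x : Y x -> Y (iter n f x) ->
  iter n f x = iter (visits f Y n x) F x.
Proof.
move=> Yx; have [[|t] -> nY //] := orbit_decomposition n Yx.
by move=> /nY; rewrite ltnS leqnn => /(_ isT).
Qed.

Lemma visits_first_return B n x : Y x ->
  visits f (Y `&` B) n x = visits F B (visits f Y n x) x.
Proof.
move=> Yx; elim: n => [//|n IH]; rewrite !(visitsSr f) IH in_setI.
have [Yn|Yn] := boolP (iter n.+1 f x \in Y); last by rewrite !addn0.
rewrite addn1 visitsSr andTb; congr (_ + nat_of_bool (_ \in B))%N.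
by rewrite (orbit_in Yx (set_mem Yn)) visitsSr Yn addn1.
Qed.

(** The time [t = 0] is allowed, so points of [Y] lying in [J] belong to it, and no return to [Y]
    after the passage through [J] is required. *)
Definition excursion (J : set R) : set R :=
  [set y | Y y /\ exists2 t, (forall i, (0 < i <= t)%N -> ~ Y (iter i f y)) &
                             J (iter t f y)].

End first_return.

Section preserving_map.
Context (R : realType) (P : probability (measurableTypeR R) R) (f : R -> R)
  (mf : measurable_fun setT (f : measurableTypeR R -> measurableTypeR R))
  (pf : forall A : set (measurableTypeR R), measurable A -> P (f @^-1` A) = P A).
Implicit Types (A Y J : set (measurableTypeR R)).

Let mpre := measurable_iter_preimage mf.

(** Excursions that are in [J] after exactly [t] steps are pulled back by [n - t] steps, which
    preserves their measure and moves the passage through [J] to the common time [n]. The pullbacks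
    lie in the preimage of [J] and are disjoint, as [n - t] is then the last visit to [Y] up to time
    [n]. *)
Lemma excursion_bound Y J : measurable Y -> measurable J ->
  measurable (excursion f Y J : set (measurableTypeR R)) /\
  pr P (excursion f Y J) <= pr P J.
Proof.
move=> mY mJ.
pose W t : set (measurableTypeR R) := Y `&`
  (\bigcap_(i in [set i | (0 < i <= t)%N]) (iter i f @^-1` (~` Y))) `&` iter t f @^-1` J.
have mW t : measurable (W t).
  apply: measurableI; last exact: mpre.
  apply: measurableI => //; apply: bigcap_measurableType => i _.
  by apply: mpre; exact: measurableC.
have EW : excursion f Y J = \bigcup_n \big[setU/set0]_(t < n) W t.
  apply/seteqP; split => [y [Yy [t nY Jt]]|y [n _]].
    exists t.+1 => //; rewrite -bigcup_mkord; exists t => //=.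
  by rewrite -bigcup_mkord => -[t _ [[Yy nY] Jt]]; split => //; exists t => // i it; exact: nY.
have mB n : measurable (\big[setU/set0]_(t < n) W t) by exact: bigsetU_measurable.
split; first by rewrite EW; exact: bigcupT_measurable.
rewrite EW; apply: le_pr_bigcup => //.
  by move=> m n mn; apply/subsetPset; exact: subset_bigsetU.
move=> n; apply: le_trans (pr_bigcup_ord _ _ mW) _.
rewrite -(pr_iter mf pf n mJ).
under eq_bigr => t _ do rewrite -(pr_iter mf pf (n - t) (mW t)).
pose V k := if (k < n)%N then iter (n - k) f @^-1` W k else set0.
rewrite (eq_bigr (fun k : 'I_n => pr P (V k))); last by move=> k _; rewrite /V ltn_ord.
rewrite -(big_mkord xpredT (fun k => pr P (V k))) -[leRHS]mul1r.
have WI k : (k < n)%N -> iter (n - k) f @^-1` W k `<=` iter n f @^-1` J.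
  by move=> kn x [_] /=; rewrite /preimage/= -iterD subnKC// ltnW.
apply: sum_pr_le => //.
- by move=> k; rewrite /V; case: ifPn => // _; exact: mpre.
- exact: mpre.
- by move=> k; rewrite /V; case: ifPn => [kn|_ y []]; exact: WI.
move=> x; rewrite big_mkord.
have [[k kx]|nk] := pselect (exists k : 'I_n, V k x); last first.
  by rewrite big1// => k _; rewrite indicE memNset// => Vk; apply: nk; exists k.
rewrite (bigD1 k)//= indicE (mem_set kx) big1 ?addr0// => j jk.
rewrite indicE memNset// => jx.
(* The start [n - a] of the shorter excursion would be a time strictly inside the longer one, which
   avoids [Y]. *)
have key (a b : 'I_n) : V a x -> V b x -> (a < b)%N -> False.
  rewrite /V !ltn_ord => -[[Ya _] _] [[_ /(_ (b - a)%N)]] /=.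
  rewrite subn_gt0 leq_subr andbT => + _ ab => /(_ ab).
  rewrite /preimage/= -iterD; apply.
  rewrite (_ : (b - a + (n - b))%N = (n - a)%N)//.
  by rewrite addnC addnBA ?subnK// ltnW.
have [jk'|kj'|/val_inj jk'] := ltngtP j k.
- exact: key jx kx jk'.
- exact: key kx jx kj'.
- by rewrite jk' eqxx in jk.
Qed.

End preserving_map.

(** * Birkhoff's theorem for visit frequencies *)

Lemma sum_iota_const (R : realType) m K (c : R) : \sum_(j <- iota m K) c = K%:R * c.
Proof. by rewrite big_const_seq count_predT size_iota iter_addr_0 mulr_natl. Qed.

Section visit_frequency.
Context (R : realType) (P : probability (measurableTypeR R) R) (f : R -> R)
  (mf : measurable_fun setT (f : measurableTypeR R -> measurableTypeR R))
  (pf : forall A : set (measurableTypeR R), measurable A -> P (f @^-1` A) = P A)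
  (ef : forall A : set (measurableTypeR R), measurable A -> f @^-1` A = A ->
    pr P A = 0 \/ pr P A = 1).
Implicit Types (A : set (measurableTypeR R)).

Definition often A (b : R) : set R :=
  [set x | forall N, exists2 n, (N <= n)%N & b * n%:R <= (visits f A n x)%:R].

Lemma measurable_visits A n : measurable A ->
  measurable_fun setT (fun x : measurableTypeR R => (visits f A n x)%:R : R).
Proof.
move=> mA; under eq_fun do rewrite visits_sum.
apply: measurable_sum => g.
exact: (bm_comp (measurable_iter mf g) (bm_indic R mA)).1.
Qed.

Lemma measurable_visits_ge A n (c : R) : measurable A ->
  measurable ([set x | c <= (visits f A n x)%:R] : set (measurableTypeR R)).
Proof.
move=> mA; rewrite (_ : [set _ | _] = (fun x => (visits f A n x)%:R) @^-1` `[c, +oo[).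
  by rewrite -[X in measurable X]setTI; apply: measurable_visits => //; exact: measurable_itv.
by apply/seteqP; split => x /=; rewrite in_itv/= andbT.
Qed.

Lemma measurable_often A b : measurable A -> measurable (often A b : set (measurableTypeR R)).
Proof.
move=> mA; rewrite (_ : often A b =
  \bigcap_N \bigcup_(n in [set n | (N <= n)%N]) [set x | b * n%:R <= (visits f A n x)%:R]).
  apply: bigcap_measurableType => N _; apply: bigcup_measurable => n _.
  exact: measurable_visits_ge.
apply/seteqP; split => [x h N _|x h N].
  by have [n Nn h'] := h N; exists n.
by have [n /= Nn h'] := h N Logic.I; exists n.
Qed.

(** The limit superior of the visit frequency is at least [a]. A shift changes the counts by at most
    one, which the room left below [a] absorbs; the set is thus exactly invariant, as ergodicity
    requires. *)
Let limfreq A (a : R) : set R := [set x | forall b, b < a -> often A b x].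

Lemma often_le A b b' x : b <= b' -> often A b' x -> often A b x.
Proof.
move=> bb h N; have [n Nn hn] := h N; exists n => //.
by apply: le_trans hn; rewrite ler_wpM2r.
Qed.

Let limfreqE A a : limfreq A a = \bigcap_k (often A (a - k.+1%:R^-1)).
Proof.
apply/seteqP; split => [x h k _|x h b ba]; first by apply: h; rewrite ltrBlDr ltrDl invr_gt0.
have ab0 : 0 < a - b by rewrite subr_gt0.
apply: often_le (h (Num.truncn (a - b)^-1) Logic.I).
have := truncnS_gt (a - b)^-1; set k := _.+1 => hk.
suff : k%:R^-1 <= a - b by lra.
by rewrite invf_ple ?posrE ?ltr0n// ltW.
Qed.

Let limfreq_invariant A a : f @^-1` limfreq A a = limfreq A a.
Proof.
apply/seteqP; split => x /= h b ba N.
- pose b' := (a + b) / 2.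
  have b'a : b' < a by rewrite /b'; lra.
  have bb' : b < b' by rewrite /b'; lra.
  have bb0 : 0 < b' - b by rewrite subr_gt0.
  have [n Nn hn] := h b' b'a (maxn N (Num.truncn (b / (b' - b))).+1).
  exists n.+1; first by rewrite (leq_trans (leq_maxl _ _) (leq_trans Nn _)).
  rewrite visitsS natrD; apply: (@le_trans _ _ (b' * n%:R)); last first.
    by rewrite (le_trans hn)// lerDr.
  have : b / (b' - b) < n%:R.
    apply: lt_le_trans (truncnS_gt _) _; rewrite ler_nat.
    by rewrite (leq_trans (leq_maxr _ _) Nn).
  by rewrite ltr_pdivrMr// -natr1 => ?; nra.
- pose b' := (a + b) / 2.
  have b'a : b' < a by rewrite /b'; lra.
  have bb' : b < b' by rewrite /b'; lra.
  have bb0 : 0 < b' - b by rewrite subr_gt0.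
  have [n Nn hn] := h b' b'a (maxn N (Num.truncn ((1 - b) / (b' - b))).+1).+1.
  case: n Nn hn => // n; rewrite ltnS visitsS => Nn hn.
  exists n; first by rewrite (leq_trans (leq_maxl _ _) Nn).
  have : (1 - b) / (b' - b) < n.+1%:R.
    apply: lt_le_trans (truncnS_gt _) _; rewrite ler_nat.
    by rewrite (leq_trans (leq_maxr _ _) (leq_trans Nn _)).
  have : ((f x \in A) : nat)%:R <= 1 :> R by case: (_ \in _).
  by move: hn; rewrite ltr_pdivrMr// natrD -natr1 => ? ? ?; nra.
Qed.

(* Katznelson-Weiss: cut the orbit into blocks of length at most M on which the
   visit frequency is at least b, and into single points of the small set of
   starting points of no such block. *)
Let block_count A (b : R) M (Bad : set R) K x : 0 <= b ->
  (forall y, ~ Bad y -> exists2 n, (0 < n <= M)%N & b * n%:R <= (visits f A n y)%:R) ->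
  b * (K%:R - M%:R) <= (visits f A K x)%:R
    + b * \sum_(j <- iota 0 K) \1_Bad (iter j f x).
Proof.
move=> b0 good; elim/ltn_ind: K x => K IH x.
have s0 L y : 0 <= \sum_(j <- iota 0 L) \1_Bad (iter j f y) :> R by exact: sumr_ge0.
have [KM|MK] := leqP K M.
  apply: (@le_trans _ _ 0); last by rewrite addr_ge0// mulr_ge0.
  by rewrite mulr_ge0_le0// subr_le0 ler_nat.
have [Bx|Bx] := pselect (Bad x).
  case: K IH MK => // K IH MK.
  have := IH K (ltnSn _) (f x); rewrite visitsS natrD.
  rewrite [iota 0 K.+1]/= big_cons indicE (mem_set Bx) /= (iotaDl 1 0) big_map.
  under [in X in _ -> X]eq_bigr do rewrite add1n iterSr.
  rewrite -[K.+1%:R]natr1; set S := \sum_(_ <- _) _ => h.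
  have : 0 <= ((f x \in A) : nat)%:R :> R by [].
  by rewrite mulr1n; lra.
have [n /andP[n0 nM] hn] := good x Bx.
have nK : (n <= K)%N by rewrite (leq_trans nM)// ltnW.
have Kn : (K - n < K)%N by rewrite ltn_subrL n0 (leq_trans n0 nK).
have := IH _ Kn (iter n f x).
have -> : visits f A K x = (visits f A n x + visits f A (K - n) (iter n f x))%N.
  by rewrite -visitsD subnKC.
have -> : \sum_(j <- iota 0 K) \1_Bad (iter j f x) = \sum_(j <- iota 0 n) \1_Bad (iter j f x)
    + \sum_(j <- iota 0 (K - n)) \1_Bad (iter j f (iter n f x)) :> R.
  rewrite -{1}(subnKC nK) iotaD big_cat/= add0n; congr (_ + _).
  rewrite -{1}[n]addn0 iotaDl big_map.
  by apply: eq_bigr => j _; rewrite addnC iterD.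
rewrite natrB// natrD mulrDr => h; have := mulr_ge0 b0 (s0 n x); lra.
Qed.

(** Otherwise the invariant set [limfreq A a] has measure 1. Taking expectations in [block_count]
    over time [K], with a frequency [b] strictly between [P(A)] and [a], and with few bad starting
    points, then gives a contradiction for large [K]. *)
Lemma frequency_le A a : measurable A -> pr P A < a -> pr P (often A a) = 0.
Proof.
move=> mA Aa.
have mL : measurable (limfreq A a : set (measurableTypeR R)).
  by rewrite limfreqE; apply: bigcap_measurableType => k _; exact: measurable_often.
apply/eqP; rewrite eq_le pr_ge0 andbT.
apply: (@le_trans _ _ (pr P (limfreq A a))).
  apply: le_pr => //; first exact: measurable_often.
  by move=> x h b ba; apply: often_le h; rewrite ltW.
have [->//|L1] := ef mL (limfreq_invariant A a).
exfalso.
pose b := (pr P A + a) / 2.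
have bA : pr P A < b by rewrite /b; lra.
have ba : b < a by rewrite /b; lra.
have b0 : 0 < b by apply: le_lt_trans bA; exact: pr_ge0.
pose G M : set (measurableTypeR R) :=
  \bigcup_(n in [set n | (0 < n <= M)%N]) [set y | b * n%:R <= (visits f A n y)%:R].
have mG M : measurable (G M).
  by apply: bigcup_measurable => n _; exact: measurable_visits_ge.
have GL : limfreq A a `<=` \bigcup_M G M.
  by move=> x /(_ b ba 1%N)[n n1 hn]; exists n => //; exists n => //=; rewrite n1 leqnn.
have ndG : nondecreasing_seq G.
  move=> m n mn; apply/subsetPset => x [k /= /andP[k0 km] hk]; exists k => //=.
  by rewrite k0 (leq_trans km).
(* With this value [b - P(A) = 2 b e]: bad points of measure at most [e] consume half of the
   surplus, and a growth of rate [b e] remains. *)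
pose e := (1 - pr P A / b) / 2.
have e0 : 0 < e by rewrite /e divr_gt0// subr_gt0 ltr_pdivrMr// mul1r.
have [M hM] : exists M, pr P (~` (G M)) <= e.
  apply: contrapT => nM.
  have : pr P (\bigcup_M G M) <= 1 - e.
    apply: le_pr_bigcup => // M; have := prC P (mG M).
    by case: (leP (pr P (~` G M)) e) => [h|]; [exfalso; apply: nM; exists M|lra].
  have : 1 <= pr P (\bigcup_M G M).
    by rewrite -L1; apply: le_pr => //; exact: bigcupT_measurable.
  lra.
have good y : ~ (~` G M) y -> exists2 n, (0 < n <= M)%N & b * n%:R <= (visits f A n y)%:R.
  by move=> /contrapT[n /= nM' hn]; exists n.
have key K : b * (K%:R - M%:R) <= K%:R * pr P A + b * (K%:R * e).
  have mGC : measurable (~` G M) by exact: measurableC.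
  have b1 j : bmeasurable (fun x : measurableTypeR R => \1_(~` G M) (iter j f x) : R).
    by apply: bm_comp (bm_indic _ mGC); exact: measurable_iter.
  have b2 j : bmeasurable (fun x : measurableTypeR R => \1_A (iter j f x) : R).
    by apply: bm_comp (bm_indic _ mA); exact: measurable_iter.
  have e1 B j : measurable B -> ex P (fun x => \1_B (iter j f x)) = pr P B.
    by move=> mB; rewrite -(ex_indic P mB) -(ex_iter mf pf j (bm_indic _ mB)).
  have bS s : bmeasurable (fun x : measurableTypeR R => \sum_(j <- s) \1_(~` G M) (iter j f x) : R).
    exact: bm_sum.
  have bV s : bmeasurable (fun x : measurableTypeR R => \sum_(j <- s) \1_A (iter j f x) : R).
    exact: bm_sum.
  rewrite -[leLHS](ex_cst P).
  apply: (@le_trans _ _ (ex P (fun x => (\sum_(j <- iota 1 K) \1_A (iter j f x)) +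
      b * \sum_(j <- iota 0 K) \1_(~` G M) (iter j f x)))).
    apply: le_ex => [||x]; first exact: bm_cst.
      by apply: bmD => //; apply: bmM => //; exact: bm_cst.
    by rewrite -visits_sum; apply: block_count => //; rewrite ltW.
  rewrite exD//; last by apply: bmM => //; exact: bm_cst.
  rewrite exZ// !ex_sum//; under eq_bigr do rewrite e1//.
  under [X in _ + b * X <= _]eq_bigr do rewrite e1//.
  rewrite !sum_iota_const.
  by rewrite lerD2l !ler_wpM2l// ltW.
have h : b - pr P A - b * e = b * e.
  by rewrite /e; field; rewrite gt_eqF.
have be0 : 0 < b * e by rewrite mulr_gt0.
have := truncnS_gt (M%:R / e); set K := _.+1; rewrite ltr_pdivrMr// => hK.
have := key K => {}key.
have : K%:R * (b - pr P A - b * e) <= b * M%:R by lra.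
by rewrite h; nra.
Qed.

Lemma visits_setC A n x : (visits f A n x + visits f (~` A) n x = n)%N.
Proof.
rewrite /visits -[RHS](size_iota 1) -(count_predC (fun j => iter j f x \in A)).
by congr addn; apply: eq_count => j /=; rewrite in_setC.
Qed.

Definition freq_dev A (d : R) n : set R :=
  [set x | d * n%:R <= `|(visits f A n x)%:R - pr P A * n%:R|].

Lemma measurable_freq_dev A d n : measurable A ->
  measurable (freq_dev A d n : set (measurableTypeR R)).
Proof.
move=> mA; rewrite (_ : freq_dev A d n =
  (fun x => `|(visits f A n x)%:R - pr P A * n%:R|) @^-1` `[d * n%:R, +oo[).
  rewrite -[X in measurable X]setTI.
  have m : measurable_fun setT (fun x : measurableTypeR R =>
      `|(visits f A n x)%:R - pr P A * n%:R|).
    by apply: measurableT_comp => //; apply: measurable_funB => //; exact: measurable_visits.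
  exact: (m measurableT _ (measurable_itv _)).
by apply/seteqP; split => x /=; rewrite /freq_dev/= in_itv/= andbT.
Qed.

(** Visits to [A] and to its complement add up to [n], so the upper bound of [frequency_le] for both
    sets is two-sided for [A]. *)
Lemma frequency_limsup A d : measurable A -> 0 < d ->
  pr P (lim_sup_set (freq_dev A d)) = 0.
Proof.
move=> mA d0.
have mD n := measurable_freq_dev d n mA.
have mL : measurable (lim_sup_set (freq_dev A d) : set (measurableTypeR R)).
  by apply: bigcap_measurableType => n _; apply: bigcup_measurable => k _.
have mAC : measurable (~` A) by exact: measurableC.
have h1 : pr P (often A (pr P A + d)) = 0.
  by apply: frequency_le => //; rewrite ltrDl.
have h2 : pr P (often (~` A) (1 - pr P A + d)) = 0.
  by apply: frequency_le => //; rewrite prC// ltrDl.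
apply/eqP; rewrite eq_le pr_ge0 andbT -[leRHS]addr0 -{1}h1 -h2.
apply: le_trans (prU _ _ _); [|exact: measurable_often..].
apply: le_pr => //; first by apply: measurableU; exact: measurable_often.
move=> x Lx; apply: contrapT => /not_orP[].
move=> /existsNP[N1 hN1] /existsNP[N2 hN2].
have [n /= Nn] := Lx (maxn N1 N2) Logic.I; rewrite /freq_dev/=.
have {}hN1 : (visits f A n x)%:R < (pr P A + d) * n%:R.
  rewrite ltNge; apply/negP => h; apply: hN1; exists n => //.
  exact: leq_trans (leq_maxl _ _) Nn.
have {}hN2 : (visits f (~` A) n x)%:R < (1 - pr P A + d) * n%:R.
  rewrite ltNge; apply/negP => h; apply: hN2; exists n => //.
  exact: leq_trans (leq_maxr _ _) Nn.
have /(congr1 (fun k => k%:R : R)) := visits_setC A n x; rewrite natrD => E.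
by rewrite leNgt => /negP; apply; rewrite ltr_norml; apply/andP; split; lra.
Qed.

End visit_frequency.

(** * Induced systems *)

(** The extension by the identity leaves both [X] and its complement invariant; as [X] has full
    measure, the total map preserves [mu] and inherits ergodicity. *)
Definition totalize (R : realType) (X : set R) (f : R -> R) (x : R) : R :=
  if x \in X then f x else x.

Section totalize.
Context (R : realType) (mu : probability (measurableTypeR R) R) (X : set R)
  (f : R -> R) (hmu : ergodic_acip X f mu).
Let g := totalize X f.

Let mX : measurable (X : set (measurableTypeR R)).
Proof. by case: hmu. Qed.

Lemma totalizeE x : X x -> g x = f x.
Proof. by move=> Xx; rewrite /g /totalize mem_set. Qed.

Lemma acip_in x : X x -> X (f x).
Proof. by case: hmu => _ h _ _ _; exact: h. Qed.

Lemma acip_iter_in n x : X x -> X (iter n f x).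
Proof. by move=> Xx; elim: n => //= n; exact: acip_in. Qed.

Lemma iter_totalize n x : X x -> iter n g x = iter n f x.
Proof.
by move=> Xx; elim: n => //= n ->; rewrite totalizeE//; exact: acip_iter_in.
Qed.

Lemma acip_full : mu X = 1%E.
Proof.
case: hmu => _ _ _ _ [rho [_ _ hrho]].
by rewrite hrho// setIid -{1}(setTI X) -hrho// probability_setT.
Qed.

Lemma pr_acipI A : measurable A -> pr mu (A `&` X) = pr mu A.
Proof.
move=> mA; rewrite (prDI mu mA mX).
suff -> : pr mu (A `\` X) = 0 by rewrite addr0.
apply/eqP; rewrite eq_le pr_ge0 andbT.
have <- : pr mu (~` X) = 0 by rewrite prC// /pr acip_full subrr.
by apply: le_pr; [exact: measurableD|exact: measurableC|by move=> x []].
Qed.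

Lemma measurable_totalize :
  measurable_fun setT (g : measurableTypeR R -> measurableTypeR R).
Proof.
have mf : measurable_fun (X : set (measurableTypeR R))
    (f : measurableTypeR R -> measurableTypeR R) by case: hmu.
move=> _ A mA; rewrite setTI.
have -> : g @^-1` A = (X `&` f @^-1` A) `|` (A `\` X).
  apply/seteqP; split => x; rewrite /preimage/= /g /totalize.
    by have [/set_mem|/negP] := boolP (x \in X); rewrite ?inE; [left|right].
  move=> [[Xx fx]|[Ax nXx]]; first by rewrite mem_set.
  by rewrite memNset.
by apply: measurableU; [exact: mf|exact: measurableD].
Qed.

Lemma totalize_preserving (A : set (measurableTypeR R)) :
  measurable A -> mu (g @^-1` A) = mu A.
Proof.
move=> mA.
have mgA : measurable (g @^-1` A : set (measurableTypeR R)).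
  by rewrite -[X in measurable X]setTI; exact: measurable_totalize.
have inv : invariant_measure X f mu by case: hmu => _ _ _ [].
rewrite pr_EFin// -pr_acipI// -pr_EFin; last exact: measurableI.
rewrite -[RHS]inv//; congr (mu _); apply/seteqP; split => x [] /=.
  by move=> gx Xx; split => //; move: gx; rewrite /preimage/= totalizeE.
by move=> Xx fx; split => //; rewrite /preimage/= totalizeE.
Qed.

Lemma totalize_ergodic (A : set (measurableTypeR R)) :
  measurable A -> g @^-1` A = A -> pr mu A = 0 \/ pr mu A = 1.
Proof.
move=> mA gA; have erg : ergodic X f mu by case: hmu => _ _ _ [].
have mAX : measurable (A `&` X) by exact: measurableI.
have AXX : A `&` X `<=` X by move=> x [].
have pre : X `&` f @^-1` (A `&` X) = A `&` X.
  apply/seteqP; split => x /= [].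
    by move=> Xx [Afx _]; split => //; rewrite -gA /preimage/= totalizeE.
  move=> Ax Xx; split => //; split; last exact: acip_in.
  by rewrite /preimage/= -totalizeE//; move: Ax; rewrite -{1}gA.
by rewrite -pr_acipI// /pr; have [->|->] := erg _ mAX AXX pre; [left|right].
Qed.

End totalize.

(** * From hyperbolic recurrence to mixing systems *)

Section indicator_bv.
Context (R : realType) (Y : set R).

Let variation (phi : R -> R) (s : seq R) :=
  \sum_(1 <= i < size s) `|phi s`_i - phi s`_i.-1|.

Let variation_cons2 phi x y s :
  variation phi [:: x, y & s] = `|phi y - phi x| + variation phi (y :: s).
Proof.
rewrite /variation /= big_nat_recl//; congr (_ + _).
by apply: eq_big_nat => -[].
Qed.

(** Along an increasing sequence the indicator of an interval jumps up at most once and then down at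
    most once. The induction distinguishes whether the first point is in the interval, in which case
    only one jump is left. *)
Lemma indic_itv_variation (i : interval R) s : sorted <%R s ->
  variation \1_[set` i] s <= 2.
Proof.
pose I := [set` i].
have v1 x : variation \1_I [:: x] = 0 by rewrite /variation big_geq.
have flat x s' : (forall y, y \in x :: s' -> y \notin I) -> variation \1_I (x :: s') = 0.
  elim: s' x => [//|y s' IH] x h; rewrite variation_cons2 IH; last first.
    by move=> w ws; apply: h; rewrite inE ws orbT.
  rewrite !indicE (negbTE (h x _)) ?mem_head// (negbTE (h y _)) ?subrr ?normr0 ?addr0//.
  by rewrite inE mem_head orbT.
suff key x s' : path <%R x s' ->
    variation \1_I (x :: s') <= if x \in I then 1 else 2.
  case: s => [|x s' /= /key]; first by rewrite /variation big_geq.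
  by case: ifP => // _ h; rewrite (le_trans h)//; lra.
elim: s' x => [|y s' IH] x /=; first by rewrite v1; case: ifP.
move=> /andP[xy ys]; rewrite variation_cons2 !indicE.
have := IH y ys.
have [xI|xI] := boolP (x \in I); have [yI|yI] := boolP (y \in I) => h; rewrite /=.
- by rewrite subrr normr0 add0r.
- rewrite flat ?addr0 ?sub0r ?normrN ?normr1// => w; rewrite inE => /predU1P[->//|ws].
  apply/negP => wI; move/negP: yI; apply.
  have yw : y < w by move/(order_path_min lt_trans)/allP: ys; apply.
  move: xI wI; rewrite !inE /I /= => xI wI.
  by apply: (@interval_is_interval _ i x w) => //; rewrite (ltW xy) (ltW yw).
- by rewrite subr0 normr1; lra.
- by rewrite subrr normr0 add0r.
Qed.

Lemma BV_norm_indic_itv (i : interval R) : (BV_norm Y \1_[set` i] <= 3%:E)%E.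
Proof.
rewrite (_ : 3%:E = (2%:E + 1%:E)%E); last by rewrite -EFinD; congr EFin; lra.
apply: leeD.
  apply: ub_ereal_sup => _ [s [ss _] <-]; rewrite lee_fin; exact: indic_itv_variation.
apply: ub_ereal_sup => _ [x _ <-]; rewrite lee_fin indicE.
by case: (_ \in _); rewrite /= ?normr1 ?normr0.
Qed.

Lemma in_BV_bounded (h : R -> R) : in_BV Y h ->
  exists2 K, 0 <= K & forall x, Y x -> `|h x| <= K.
Proof.
rewrite /in_BV /BV_norm => bv.
have v0 : (0 <= var Y h)%E.
  apply: ereal_sup_ubound; exists [::]; first by split => // x.
  by rewrite big_geq.
have sy : (ereal_sup [set `|h x|%:E | x in Y] < +oo)%E.
  by apply: le_lt_trans bv; rewrite leeDr.
have [K hK] : exists K : R, forall x, Y x -> `|h x| <= K.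
  move: sy; case E : (ereal_sup _) => [K| |]// _.
    exists K => x Yx; rewrite -lee_fin -E; apply: ereal_sup_ubound; by exists x.
  exists 0 => x Yx; have : (`|h x|%:E <= -oo)%E by rewrite -E; apply: ereal_sup_ubound; exists x.
  by rewrite leeNy_eq.
by exists `|K| => // x Yx; rewrite (le_trans (hK x Yx))// ler_norm.
Qed.

End indicator_bv.

Section hyperbolic.
Context (R : realType) (Y : set R) (F : R -> R) (nu : probability (measurableTypeR R) R)
  (hyp : hyperbolic_recurrent Y F nu).
Let T := totalize Y F.

Let acip : ergodic_acip Y F nu.
Proof. by case: hyp. Qed.

Let mY : measurable (Y : set (measurableTypeR R)).
Proof. by case: acip. Qed.

Lemma integral_full (g : R -> R) :
  bmeasurable (g : measurableTypeR R -> R) -> (forall x, 0 <= g x) ->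
  (\int[nu]_(x in Y) (g x)%:E)%E = (ex nu g)%:E.
Proof.
move=> bg g0; rewrite -ex_EFin// -(setCK Y) -setTD.
symmetry; apply: ge0_negligible_integral => //.
- exact: measurableC.
- by apply/measurable_EFinP; case: bg.
- by move=> x _; rewrite lee_fin.
- by rewrite -[LHS]/(nu (~` Y)) probability_setC// (acip_full acip) subee.
Qed.

(** The 3 is the bound on the norm of the indicator of an interval, variation 2 plus supremum 1; the
    rate is [expR (- c0)], and [H] is the supremum bound of the version of the density in BV. *)
Lemma hyperbolic_mixing_system :
  exists C th H, mixing_system nu T C th H.
Proof.
case: hyp => _ [h [mh h0 hh] hBV] [C0 [c0 [C00 c00 mix]]] _.
have [H H0 hH] := in_BV_bounded hBV.
exists (3 * C0), (expR (- c0)), H; split => //.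
- exact: (measurable_totalize acip).
- exact: (totalize_preserving acip).
- by rewrite mulr_ge0// ltW.
- by rewrite expR_gt0/= -[ltRHS]expR0 ltr_expR oppr_lt0.
- move=> a b ab; rewrite -lee_fin -pr_EFin; last exact: measurable_itv.
  rewrite hh; last exact: measurable_itv.
  apply: (@le_trans _ _ (\int[lebesgue_measure]_(x in `[a, b] `&` Y) (cst H%:E x))%E).
    apply: ge0_le_integral => //.
    + by apply: measurableI => //; exact: measurable_itv.
    + by move=> x [_ Yx]; rewrite lee_fin h0.
    + apply/measurable_EFinP; exact: measurable_funS mh.
    + by move=> x [_ Yx]; rewrite lee_fin (le_trans _ (hH x Yx))// ler_norm.
  rewrite integral_cst; last by apply: measurableI => //; exact: measurable_itv.
  rewrite EFinM lee_wpmul2l ?lee_fin//.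
  apply: (@le_trans _ _ (lebesgue_measure `[a, b]%classic)).
    by rewrite le_measure// inE//; apply: measurableI => //; exact: measurable_itv.
  by rewrite lebesgue_measure_itv/= lte_fin; case: ifPn => // _; rewrite lee_fin subr_ge0.
- move=> i g j mg g01.
  have bg : bmeasurable g by exact: bm_itv mg g01.
  have g0 x : 0 <= g x by have /andP[] := g01 x.
  have bI : bmeasurable (\1_[set` i] : measurableTypeR R -> R).
    by apply: bm_indic; exact: measurable_itv.
  have mT := measurable_totalize acip.
  have bIg : bmeasurable (fun x : measurableTypeR R => \1_[set` i] x * g (iter j T x)).
    by apply: bmM => //; apply: bm_comp => //; exact: measurable_iter.
  have BV : in_BV Y \1_[set` i] by rewrite /in_BV (le_lt_trans (BV_norm_indic_itv _ _))// ltry.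
  have ig : nu.-integrable (Y : set (measurableTypeR R)) (EFin \o g).
    by apply: integrableS (bm_integrable nu bg).
  have := mix _ _ j BV ig.
  have -> : (\int[nu]_(x in Y) (\1_[set` i] x * g (iter j F x))%:E)%E =
      (ex nu (fun x => \1_[set` i] x * g (iter j T x)))%:E.
    rewrite -integral_full//; last by move=> x; rewrite mulr_ge0.
    by apply: eq_integral => x /set_mem Yx; rewrite (iter_totalize acip).
  have -> : (\int[nu]_(x in Y) `|g x|%:E)%E = (\int[nu]_(x in Y) (g x)%:E)%E.
    by apply: eq_integral => x _; rewrite ger0_norm.
  rewrite !integral_full//.
  rewrite ex_indic; last exact: measurable_itv.
  rewrite -EFinM -EFinB/= => hm.
  rewrite -lee_fin; apply: le_trans hm _.
  apply: (@le_trans _ _ ((C0 * expR (- (c0 * j%:R)))%:E * 3%:E * (ex nu g)%:E)%E).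
    rewrite lee_wpmul2r ?lee_fin ?ex_ge0// lee_wpmul2l ?BV_norm_indic_itv//.
    by rewrite lee_fin mulr_ge0 ?expR_ge0// ltW.
  rewrite -!EFinM lee_fin -expRM_natr mulNr ler_wpM2r ?ex_ge0//.
  by rewrite mulrAC (mulrC C0).
Qed.

(** (A2) is used for the single radius [n ^ (- 1/2)], which eventually exceeds all the radii of size
    1 / n up to powers of log n that matter later; short returns only decrease with the radius. *)
Lemma hyperbolic_short_return : exists b C, [/\ 0 < b, 0 < C &
  forall n j, (0 < n)%N -> (0 < j)%N -> j%:R <= (ln (n%:R : R)) ^+ 2 ->
    pr nu (near_return T j (n%:R `^ (- (1 / 2)))) <= C * n%:R `^ (- b)].
Proof.
case: hyp => _ _ _ sr.
have pl : power_like (fun n => n%:R `^ (- (1 / 2)) : R) (1 / 2).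
  exists 2 => [|n n0]; first lra.
  by rewrite divff; [lra|rewrite gt_eqF// powR_gt0// ltr0n].
have [|b [C [/andP[b0 b1] C0 h]]] := sr _ _ _ pl; first lra.
exists (b / 2), C; split => [||n j n0 j0 jn]; [lra|by []|].
have mN : measurable (near_return T j (n%:R `^ (- (1 / 2))) : set (measurableTypeR R)).
  have [? [? [? ms]]] := hyperbolic_mixing_system.
  exact: measurable_near_return ms _ _.
rewrite -(pr_acipI acip mN) -lee_fin -pr_EFin; last exact: measurableI.
have -> : near_return T j (n%:R `^ (- (1 / 2))) `&` Y =
    short_return Y F j (n%:R `^ (- (1 / 2))).
  apply/seteqP; split => x; rewrite /near_return /short_return/= distrC.
    by move=> [h1 Yx]; split => //; rewrite -(iter_totalize acip).
  by move=> [Yx h1]; split => //; rewrite (iter_totalize acip).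
apply: le_trans (h n j n0 j0 jn) _.
by rewrite lee_fin -powRrM (_ : - (1 / 2) * b = - (b / 2))//; field.
Qed.

End hyperbolic.

(** The interface between a total map [f] and its first return map. [T] is total as well, so it
    agrees with the first return map only on [Y]; [P] is the conditional measure, and (A2) survives
    as [ind_short]. *)
Record induced (R : realType) (mu : probability (measurableTypeR R) R) (f : R -> R)
    (Y : set R) (P : probability (measurableTypeR R) R) (T : R -> R) (C th H : R) :
    Prop := Induced {
  ind_mY : measurable (Y : set (measurableTypeR R));
  ind_pos : 0 < pr mu Y;
  ind_P : forall A : set (measurableTypeR R), measurable A ->
    pr P A = pr mu (A `&` Y) / pr mu Y;
  ind_ms : mixing_system P T C th H;
  ind_T : forall n x, Y x -> iter n T x = iter n (first_return_map f Y) x;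
  ind_short : exists b K, [/\ 0 < b, 0 < K &
    forall n j, (0 < n)%N -> (0 < j)%N -> j%:R <= (ln (n%:R : R)) ^+ 2 ->
      pr P (near_return T j (n%:R `^ (- (1 / 2)))) <= K * n%:R `^ (- b)] }.

Lemma first_return_map_totalize (R : realType) (mu : probability (measurableTypeR R) R)
    (X : set R) (f : R -> R) (Y : set R) (x : R) : ergodic_acip X f mu -> X x ->
  first_return_map (totalize X f) Y x = first_return_map f Y x.
Proof.
move=> hmu Xx; have E n := iter_totalize hmu n Xx.
rewrite /first_return_map E; congr iter; rewrite /first_return_time.
case: pselect => [h|nh]; case: pselect => [h'|nh'] //.
- case: ex_minnP => m /asboolP[m0 Ym] mmin; case: ex_minnP => k /asboolP[k0 Yk] kmin.
  apply/eqP; rewrite eqn_leq mmin ?kmin//; apply/asboolP; first by rewrite -E.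
  by rewrite E.
- by exfalso; have [n /asboolP[n0 Yn]] := h; apply: nh'; exists n; apply/asboolP; rewrite -E.
- by exfalso; have [n /asboolP[n0 Yn]] := h'; apply: nh; exists n; apply/asboolP; rewrite E.
Qed.

Lemma induced_exists (R : realType) (mu : probability (measurableTypeR R) R)
    (X : set R) (f : R -> R) (e : R) : ergodic_acip X f mu ->
  asymptotically_hyperbolic X f mu -> 0 < e ->
  exists Y P T C th H, [/\ induced mu (totalize X f) Y P T C th H,
    pr mu (~` Y) <= e & Y `<=` X].
Proof.
move=> hmu hyp e0; have [U [UX Uc Ue]] := hyp e e0.
set Y := X `\` _ => -[Y0 [mY hY]].
set P : probability (measurableTypeR R) R := mnormalize _ _ in hY.
have Ypos : 0 < pr mu Y by rewrite -lte_fin -pr_EFin.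
have PE (A : set (measurableTypeR R)) : measurable A ->
    pr P A = pr mu (A `&` Y) / pr mu Y.
  move=> mA; have rT : mrestr mu mY [set: measurableTypeR R] = mu Y by rewrite /mrestr setTI.
  rewrite /P /pr /= /mnormalize /= rT.
  have muY : mu Y \is a fin_num by rewrite fin_num_measure.
  rewrite gt_eqF//= lt_eqF/=; last by rewrite ltey_eq muY.
  by rewrite fineM// fin_num_measure//; exact: measurableI.
have [C [th [H ms]]] := hyperbolic_mixing_system hY.
have hYac : ergodic_acip Y (first_return_map f Y) P by case: hY.
have YX : Y `<=` X by move=> x [].
exists Y, P, (totalize Y (first_return_map f Y)), C, th, H; split => //.
  split => //; last exact: (hyperbolic_short_return hY).
  move=> n x Yx; rewrite (iter_totalize hYac)//; elim: n => //= n <-.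
  by rewrite (first_return_map_totalize _ hmu)//; apply: YX; exact: (acip_iter_in hYac).
rewrite -lee_fin -pr_EFin; last exact: measurableC.
(* Connected pieces of the line are intervals, which makes the removed set measurable. *)
have mU : measurable (\bigcup_i U i : set (measurableTypeR R)).
  apply: bigcupT_measurable => i; apply: is_interval_measurable.
  by rewrite -connected_intervalP.
apply: le_trans Ue; have mX : measurable (X : set (measurableTypeR R)) by case: hmu.
have mCX : measurable (~` X : set (measurableTypeR R)) by exact: measurableC.
have CX0 : mu (~` X) = 0%E by rewrite probability_setC// (acip_full hmu) subee.
apply: (@le_trans _ _ (mu ((\bigcup_i U i) `|` ~` X))).
  rewrite le_measure// ?inE//; [exact: measurableC|exact: measurableU|].
  move=> x nYx; have [Xx|] := pselect (X x); last by right.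
  by left; apply: contrapT => nU; exact: nYx.
by rewrite (le_trans (measureU2 _ _ _))//= CX0 adde0.
Qed.

(** * Closest returns and averaged ball measures *)

Section closest_return.
Context (R : realType) (f : R -> R).

Lemma lt_closest_return n (r x : R) : (0 < n)%N ->
  (forall k, (0 < k <= n)%N -> r < `|iter k f x - x|) -> r < closest_return f n x.
Proof.
move=> n0 h; rewrite /closest_return big_seq.
apply: (big_ind (fun u => r < u)) => [|u v ru rv|k].
- exact: (h 1%N).
- by rewrite lt_min ru.
- by rewrite mem_index_iota ltnS => hk; exact: h.
Qed.

Lemma closest_return_le n k (x : R) : (0 < k <= n)%N ->
  closest_return f n x <= `|iter k f x - x|.
Proof.
move=> kn; have : k \in index_iota 1 n.+1 by rewrite mem_index_iota ltnS.
rewrite /closest_return; elim: (index_iota _ _) => // j s IH.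
by rewrite inE big_cons ge_min => /predU1P[->|/IH ->]; rewrite ?lexx ?orbT.
Qed.

Lemma measurable_closest_return n :
  measurable_fun setT (f : measurableTypeR R -> measurableTypeR R) ->
  measurable_fun setT (closest_return f n : measurableTypeR R -> R).
Proof.
move=> mf; have m k : measurable_fun setT (fun x : measurableTypeR R => `|iter k f x - x|).
  by apply: measurableT_comp => //; apply: measurable_funB => //; exact: measurable_iter.
rewrite /closest_return; elim: (index_iota _ _) => [|k s IH].
  under eq_fun do rewrite big_nil; exact: (m 1%N).
under eq_fun do rewrite big_cons; exact: measurable_minr.
Qed.

End closest_return.

Lemma measurable_near_infty d (T : measurableType d) (A : nat -> set T) :
  (forall n, measurable (A n)) -> measurable [set x | \forall n \near \oo, A n x].
Proof.
move=> mA; rewrite (_ : [set x | _] = \bigcup_N \bigcap_(n in [set n | (N <= n)%N]) A n).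
  by apply: bigcupT_measurable => N; apply: bigcap_measurableType => n _.
apply/seteqP; split => x [N _ hN]; first by exists N.
by exists N => // n Nn; exact: hN.
Qed.

Lemma pr_borel_cantelli d (T : measurableType d) (R : realType) (P : probability T R)
    (A : nat -> set T) (B : R) : (forall n, measurable (A n)) ->
  (forall N, \sum_(0 <= n < N) pr P (A n) <= B) -> pr P (lim_sup_set A) = 0.
Proof.
move=> mA hB; rewrite /pr lim_sup_set_cvg0//.
apply: (@le_lt_trans _ _ B%:E); last exact: ltry.
apply: lime_le; first exact: is_cvg_nneseries.
apply: nearW => N; rewrite (eq_bigr (fun n => (pr P (A n))%:E)); last first.
  by move=> n _; exact: pr_EFin.
by rewrite sumEFin lee_fin.
Qed.

Section ball_measure.
Context (R : realType) (mu : probability (measurableTypeR R) R).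

Lemma measurable_ball_measureI (B : set (measurableTypeR R)) r : measurable B ->
  measurable_fun setT (fun x : measurableTypeR R => mu (ball (x : R) r `&` B)).
Proof.
move=> mB; pose A : set (measurableTypeR R * measurableTypeR R) := [set xy | `|xy.1 - xy.2| < r].
have mA : measurable A.
  rewrite (_ : A = (fun xy => `|xy.1 - xy.2|) @^-1` `]-oo, r[); last first.
    by apply/seteqP; split => x /=; rewrite /A/= in_itv.
  rewrite -[X in measurable X]setTI.
  have m : measurable_fun setT (fun xy : measurableTypeR R * measurableTypeR R => `|xy.1 - xy.2|).
    apply: measurableT_comp => //; apply: measurable_funB; [exact: measurable_fst|exact: measurable_snd].
  exact: (m measurableT _ (measurable_itv _)).
have mAB : measurable (A `&` (setT `*` B)) by apply: measurableI => //; exact: measurableX.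
have := measurable_fun_xsection mu mAB; apply: eq_measurable_fun => x _ /=.
congr (mu _); apply/seteqP; split => y; rewrite /xsection/= inE; first by move=> [? []].
by move=> [].
Qed.

Lemma measurable_ball_measure r :
  measurable_fun setT (fun x : measurableTypeR R => mu (ball (x : R) r)).
Proof.
have := measurable_ball_measureI r measurableT.
by under eq_fun do rewrite setIT.
Qed.

(** The correlation integral of [mu]: the product measure of the pairs of points at distance less
    than [r]. *)
Definition ball_avg r : R := fine (\int[mu]_x mu (ball (x : R) r))%E.

Lemma ball_avg_EFin r : (\int[mu]_x mu (ball (x : R) r))%E = (ball_avg r)%:E.
Proof.
have m := measurable_ball_measure r.
rewrite /ball_avg fineK// ge0_fin_numE; last exact: integral_ge0.
apply: (@le_lt_trans _ _ (\int[mu]_x (cst 1 x))%E); last first.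
  by rewrite integral_cst// mul1e (le_lt_trans (probability_le1 _ _))// ltry.
apply: ge0_le_integral => //.
by move=> x _; apply: probability_le1; exact: measurable_ball.
Qed.

Lemma ball_avg_full X r : measurable (X : set (measurableTypeR R)) -> mu X = 1%E ->
  (\int[mu]_(x in X) mu (ball (x : R) r))%E = (ball_avg r)%:E.
Proof.
move=> mX muX; rewrite -ball_avg_EFin -(setCK X) -setTD.
symmetry; apply: ge0_negligible_integral => //.
- exact: measurableC.
- exact: measurable_ball_measure.
- by rewrite -[LHS]/(mu (~` X)) probability_setC// muX subee.
Qed.

(** The square sum is the mean measure of the cell that contains [x], and a half-open cell of length
    [r] containing [x] lies in the open ball of radius [r]. *)
Lemma sum_sq_cells_le a r L : 0 < r ->
  \sum_(k < L) pr mu [set` cell a r k] ^+ 2 <= ball_avg r.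
Proof.
move=> r0; set p := fun k => pr mu [set` cell a r k].
have mc k : measurable ([set` cell a r k] : set (measurableTypeR R)) by exact: measurable_itv.
have bm k : bmeasurable (fun x : measurableTypeR R => p k * \1_[set` cell a r k] x : R).
  by apply: bmM; [exact: bm_cst|exact: bm_indic].
have -> : \sum_(k < L) pr mu [set` cell a r k] ^+ 2 =
    ex mu (fun x => \sum_(k <- index_enum 'I_L) p k * \1_[set` cell a r k] x).
  rewrite ex_sum//; apply: eq_bigr => k _; rewrite exZ; last exact: bm_indic.
  by rewrite ex_indic// expr2.
rewrite -lee_fin -ball_avg_EFin -ex_EFin; last by apply: bm_sum => k.
apply: ge0_le_integral => //.
- move=> x _; rewrite lee_fin; apply: sumr_ge0 => k _.
  by rewrite mulr_ge0// pr_ge0.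
- by apply/measurable_EFinP; apply: (bm_sum _ _ (fun k : 'I_L => bm k)).1.
- exact: measurable_ball_measure.
move=> x _; have mb : measurable (ball (x : R) r : set (measurableTypeR R)) by exact: measurable_ball.
rewrite pr_EFin// lee_fin.
have [[k kx]|nk] := pselect (exists k : 'I_L, x \in [set` cell a r k]); last first.
  rewrite big1 ?pr_ge0// => k _; rewrite indicE [_ \in _](_ : _ = false) ?mulr0//.
  by apply/negP => kx; apply: nk; exists k.
rewrite (bigD1 k)//= indicE kx mulr1 big1 ?addr0.
  apply: le_pr => // y /mem_set; rewrite in_cell -natr1 /ball/= => /andP[h1 h2].
  move: kx; rewrite in_cell -natr1 => /andP[h3 h4].
  by rewrite ltr_norml; apply/andP; split; lra.
move=> j jk; rewrite indicE; have [jx|_] := boolP (x \in [set` cell a r j]); last by rewrite mulr0.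
by have /val_inj jk' := cell_disj r0 jx kx; rewrite jk' eqxx in jk.
Qed.

Lemma le_ball_avg r s : r <= s -> ball_avg r <= ball_avg s.
Proof.
move=> rs; rewrite -lee_fin -!ball_avg_EFin; apply: ge0_le_integral => //.
- exact: measurable_ball_measure.
- exact: measurable_ball_measure.
move=> x _; rewrite le_measure// ?inE; [exact: measurable_ball..|].
exact: le_ball.
Qed.

(** If it vanished, so would the square sums over cells; all cells would be null, against total mass
    1. *)
Lemma ball_avg_gt0 r : 0 < r -> 0 < ball_avg r.
Proof.
move=> r0; rewrite ltNge; apply/negP => h.
suff : pr mu setT <= 0 by rewrite prT; lra.
apply: (le_pr_exhaust r0) => // a M.
have mc k : measurable ([set` cell a r k] : set (measurableTypeR R)) by exact: measurable_itv.
apply: (@le_trans _ _ (pr mu (\big[setU/set0]_(k < M) [set` cell a r k]))).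
  apply: le_pr; [by rewrite setTI; exact: measurable_itv|exact: bigsetU_measurable|].
  rewrite -(bigcup_mkord M (fun k => [set` cell a r k])) => x [_].
  rewrite [X in X -> _]/= in_itv => /(cell_cover r0)[k kM xk].
  by exists k => //; exact: set_mem.
apply: le_trans (pr_bigcup_ord _ _ mc) _.
rewrite big1// => k _; apply/eqP; rewrite -sqrf_eq0 eq_le sqr_ge0 andbT.
apply: le_trans h; apply: le_trans (sum_sq_cells_le a M r0).
by rewrite (bigD1 k)//= lerDl sumr_ge0// => j _; exact: sqr_ge0.
Qed.

End ball_measure.

(** * Lower bounds for the closest return *)

Lemma pr_bigcup_null d (T : measurableType d) (R : realType) (P : probability T R)
    (A : nat -> set T) : (forall n, measurable (A n)) ->
  (forall n, pr P (A n) = 0) -> pr P (\bigcup_n A n) = 0.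
Proof.
move=> mA A0; suff /negligibleP h : P.-negligible (\bigcup_n A n).
  by rewrite /pr h//; exact: bigcupT_measurable.
apply: negligible_bigcup => n; apply/negligibleP => //.
have h : P (A n) = 0%E by rewrite pr_EFin// A0.
exact: h.
Qed.

Lemma measurable_close (R : realType) (h1 h2 : R -> R) (r : R) :
  measurable_fun setT (h1 : measurableTypeR R -> measurableTypeR R) ->
  measurable_fun setT (h2 : measurableTypeR R -> measurableTypeR R) ->
  measurable ([set x | `|h1 x - h2 x| <= r] : set (measurableTypeR R)).
Proof.
move=> m1 m2; rewrite (_ : [set _ | _] = (fun x => `|h1 x - h2 x|) @^-1` `]-oo, r]); last first.
  by apply/seteqP; split => x /=; rewrite in_itv/=.
rewrite -[X in measurable X]setTI.
have m : measurable_fun setT (fun x : measurableTypeR R => `|h1 x - h2 x|).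
  by apply: measurableT_comp => //; exact: measurable_funB.
exact: (m measurableT _ (measurable_itv _)).
Qed.

Section induced_facts.
Context (R : realType) (mu : probability (measurableTypeR R) R) (f : R -> R)
  (mf : measurable_fun setT (f : measurableTypeR R -> measurableTypeR R))
  (pf : forall A : set (measurableTypeR R), measurable A -> mu (f @^-1` A) = mu A)
  (ef : forall A : set (measurableTypeR R), measurable A -> f @^-1` A = A ->
    pr mu A = 0 \/ pr mu A = 1)
  (Y : set R) (P : probability (measurableTypeR R) R) (T : R -> R) (C th H : R)
  (ind : induced mu f Y P T C th H).
Implicit Types (A : set (measurableTypeR R)).

Let F := first_return_map f Y.
Let y0 := pr mu Y.
Let mY := ind_mY ind.
Let ypos := ind_pos ind.
Let ms := ind_ms ind.
Let mT := ms_meas ms.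
Let mi := @measurable_itvR R.

Lemma pr_induced_le A : measurable A -> pr P A <= pr mu A / y0.
Proof.
move=> mA; rewrite (ind_P ind)// ler_pM2r ?invr_gt0//.
by apply: le_pr => [||x []//]; first exact: measurableI.
Qed.

Lemma pr_induced_null A : measurable A -> pr P A = 0 -> pr mu (A `&` Y) = 0.
Proof.
move=> mA; rewrite (ind_P ind)// => /eqP.
by rewrite mulf_eq0 invr_eq0 (gt_eqF ypos) orbF => /eqP.
Qed.

Lemma orbit_T n x : Y x -> exists2 t, iter n f x = iter t f (iter (visits f Y n x) T x) &
  forall i, (0 < i <= t)%N -> ~ Y (iter i f (iter (visits f Y n x) T x)).
Proof. by move=> Yx; rewrite (ind_T ind)//; exact: orbit_decomposition. Qed.

Lemma orbit_in_T n x : Y x -> Y (iter n f x) -> iter n f x = iter (visits f Y n x) T x.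
Proof. by move=> Yx Yn; rewrite (ind_T ind)//; exact: orbit_in. Qed.

(** A periodic point of [f] in [Y] is back in [Y] after its period, hence periodic for [T], and such
    points are null by mixing. *)
Lemma periodic_null : pr mu (Y `&` \bigcup_p [set x | iter p.+1 f x = x]) = 0.
Proof.
pose A : set (measurableTypeR R) := \bigcup_p [set x | iter p.+1 T x = x].
have m1 p : measurable ([set x | iter p.+1 T x = x] : set (measurableTypeR R)).
  rewrite (_ : [set _ | _] = near_return T p.+1 0); first exact: (measurable_near_return ms).
  by apply/seteqP; split => x; rewrite /near_return/= normr_le0 subr_eq0 => /eqP.
have m2 p : measurable ([set x | iter p.+1 f x = x] : set (measurableTypeR R)).
  rewrite (_ : [set _ | _] = [set x | `|iter p.+1 f x - x| <= 0]).
    by apply: measurable_close; [exact: measurable_iter|exact: measurable_id].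
  by apply/seteqP; split => x; rewrite /= normr_le0 subr_eq0 => /eqP.
have mA : measurable A by exact: bigcupT_measurable.
have A0 : pr P A = 0.
  by apply: pr_bigcup_null => // p; exact: (pr_periodic ms).
apply/eqP; rewrite eq_le pr_ge0 andbT -(pr_induced_null mA A0); apply: le_pr.
- by apply: measurableI => //; exact: bigcupT_measurable.
- exact: measurableI.
move=> x [Yx [p _ /= fx]]; split => //.
have Yp : Y (iter p.+1 f x) by rewrite iterS fx.
have := orbit_in_T Yx Yp; rewrite {1}iterS fx visitsSr mem_set// addn1 => E.
by exists (visits f Y p x).
Qed.

Lemma few_visits_null : pr mu (lim_sup_set (freq_dev mu f Y (y0 / 2))) = 0.
Proof. by apply: (frequency_limsup mf pf ef) => //; rewrite divr_gt0. Qed.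

Lemma visits_unbounded x N : ~ lim_sup_set (freq_dev mu f Y (y0 / 2)) x ->
  exists K, forall n, (K <= n)%N -> (N <= visits f Y n x)%N.
Proof.
move=> /existsNP[M /not_implyP[_ hM]].
exists (maxn M (Num.truncn (N%:R / (y0 / 2))).+1) => n; rewrite geq_max => /andP[Mn Kn].
have : ~ freq_dev mu f Y (y0 / 2) n x by move=> h; apply: hM; exists n.
rewrite /freq_dev/= => /negP; rewrite -ltNge ltr_norml => /andP[h _].
rewrite -(ler_nat R); apply: (@le_trans _ _ (y0 / 2 * n%:R)).
  have : N%:R / (y0 / 2) < n%:R.
    by apply: lt_le_trans (truncnS_gt _) _; rewrite ler_nat.
  by rewrite ltr_pdivrMr ?divr_gt0// mulrC => /ltW.
by rewrite -/y0 in h; lra.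
Qed.

(** The orbit comes within [r] of its start during the excursion that follows the visit number [m]
    to [Y], at any depth [t]; the index is induced time, in which mixing is available. *)
Definition late_return m r : set R := Y `&` \bigcup_t
  ((iter m T @^-1` \bigcap_(i in [set i | (0 < i <= t)%N]) (iter i f @^-1` (~` Y)))
   `&` [set x | `|iter t f (iter m T x) - x| <= r]).

Lemma measurable_late_return m r :
  measurable (late_return m r : set (measurableTypeR R)).
Proof.
apply: measurableI => //; apply: bigcupT_measurable => t; apply: measurableI.
  apply: (measurable_iter_preimage mT); apply: bigcap_measurableType => i _.
  by apply: (measurable_iter_preimage mf); exact: measurableC.
apply: measurable_close; last exact: measurable_id.
by apply: (measurableT_comp (measurable_iter mf t)); exact: measurable_iter.
Qed.

(** The points within [r] of a cell of length [r] lie in that cell and its two neighbours, and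
    reaching these three from [Y] costs no more than their [mu]-measure. The resulting products of
    measures of adjacent cells are bounded by squares, which sum to at most [ball_avg]. *)
Lemma late_return_le m r : 0 < r ->
  pr P (late_return m r) <= 3 / y0 ^+ 2 * ball_avg mu r + 3 * C / y0 * th ^+ m.
Proof.
move=> r0; apply: (le_pr_exhaust r0); first exact: measurable_late_return.
(* Moving the origin by one cell gives the left neighbour the index [k] instead of [k - 1]. *)
move=> a M; pose a' := a - r.
have mc k : measurable ([set` cell a' r k] : set (measurableTypeR R)) by exact: mi.
pose p k := pr mu [set` cell a' r k].
have p0 k : 0 <= p k by exact: pr_ge0.
pose J k : set (measurableTypeR R) :=
  [set` cell a' r k] `|` [set` cell a' r k.+1] `|` [set` cell a' r k.+2].
have mJ k : measurable (J k) by apply: measurableU => //; exact: measurableU.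
have mE k := (excursion_bound mf pf mY (mJ k)).1.
have shift k : cell a r k = cell a' r k.+1.
  by rewrite /cell /a' -(natr1 k.+1) -(natr1 k); congr (Interval (BLeft _) (BLeft _)); ring.
apply: le_trans (cell_union_bound ms (A := fun k => excursion f Y (J k)) r0 _ mE _) _.
- exact: measurable_late_return.
- move=> x k [Yx [t _ [nY /= xt]]] kM; rewrite in_cell => /andP[x1 x2]; split.
    by rewrite (ind_T ind)//; exact: iter_first_return_in.
  exists t; first by move=> i hi; exact: nY.
  move: xt; rewrite ler_norml => /andP[z1 z2]; set z := iter t f _ in z1 z2 *.
  have zk n : (z \in [set` cell a' r n]) -> [set` cell a' r n] z by exact: set_mem.
  rewrite -(natr1 k) in x2.
  have [h1|h1] := ltP z (a + r * k%:R).
    by left; left; apply: zk; rewrite in_cell /a' -natr1; apply/andP; split; lra.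
  have [h2|h2] := ltP z (a + r * k%:R + r).
    by left; right; apply: zk; rewrite in_cell /a' -(natr1 k.+1) -(natr1 k); apply/andP; split; lra.
  right; apply: zk; rewrite in_cell /a' -(natr1 k.+2) -(natr1 k.+1) -(natr1 k).
  by apply/andP; split; lra.
have Pc k : pr P [set` cell a r k] <= p k.+1 / y0.
  by rewrite shift; exact: pr_induced_le.
have PE k : pr P (excursion f Y (J k)) <= (p k + p k.+1 + p k.+2) / y0.
  apply: le_trans (pr_induced_le (mE k)) _; rewrite ler_pM2r ?invr_gt0//.
  apply: le_trans (excursion_bound mf pf mY (mJ k)).2 _.
  apply: le_trans (prU _ _ _) _ => //; first exact: measurableU.
  by rewrite lerD2r; exact: prU.
have c0 : 0 <= C * th ^+ m by exact: (ms_Cth0 ms).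
set c := C * th ^+ m in c0 *.
have yn0 : y0 != 0 by rewrite gt_eqF.
(* Products of neighbours are split by [2 u v <= u ^+ 2 + v ^+ 2]; the weights of the squares,
   [(1 + 1 + 1 + 3) / 2], yield the constant 3. *)
have key k : (pr P [set` cell a r k] + c) * pr P (excursion f Y (J k)) <=
    (p k ^+ 2 + p k.+1 ^+ 2 + p k.+2 ^+ 2 + p k.+1 ^+ 2 *+ 3) / 2 / y0 ^+ 2
    + c / y0 * (p k + p k.+1 + p k.+2).
  apply: (@le_trans _ _ ((p k.+1 / y0 + c) * ((p k + p k.+1 + p k.+2) / y0))).
    by rewrite ler_pM ?addr_ge0 ?pr_ge0// lerD2r.
  rewrite (_ : _ * _ = p k.+1 * (p k + p k.+1 + p k.+2) / y0 ^+ 2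
    + c / y0 * (p k + p k.+1 + p k.+2)); last by field.
  rewrite lerD2r ler_pM2r ?invr_gt0 ?exprn_gt0//.
  have := sqr_ge0 (p k - p k.+1); have := sqr_ge0 (p k.+2 - p k.+1).
  by rewrite !expr2; lra.
apply: le_trans; first by apply: ler_sum => k _; exact: key.
have psq L : \sum_(k < L) p k ^+ 2 <= ball_avg mu r by exact: sum_sq_cells_le.
have p1 L : \sum_(k < L) p k <= 1 by exact: sum_pr_cell_le1.
have q1 : \sum_(k < M) p k.+1 ^+ 2 <= ball_avg mu r.
  by apply: le_trans (psq M.+1); rewrite big_ord_recl/= lerDr sqr_ge0.
have q2 : \sum_(k < M) p k.+2 ^+ 2 <= ball_avg mu r.
  by apply: le_trans (psq M.+2); rewrite !big_ord_recl/= addrA lerDr addr_ge0// sqr_ge0.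
have r1 : \sum_(k < M) p k.+1 <= 1.
  by apply: le_trans (p1 M.+1); rewrite big_ord_recl/= lerDr.
have r2 : \sum_(k < M) p k.+2 <= 1.
  by apply: le_trans (p1 M.+2); rewrite !big_ord_recl/= addrA lerDr addr_ge0.
rewrite big_split/= -mulr_sumr -!mulr_suml !big_split/=.
have i0 : 0 < (y0 ^+ 2)^-1 by rewrite invr_gt0 exprn_gt0.
have cy : 0 <= c / y0 by rewrite divr_ge0// ltW.
apply: lerD.
  rewrite (_ : 3 / y0 ^+ 2 * _ = 3 * ball_avg mu r / y0 ^+ 2); last by ring.
  rewrite ler_pM2r//; have := psq M; lra.
rewrite (_ : 3 * C / y0 * _ = c / y0 * 3); last by rewrite /c; ring.
by rewrite ler_wpM2l//; have := p1 M; lra.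
Qed.

End induced_facts.

Lemma index_iota1 N : index_iota 1 N.+1 = iota 1 N.
Proof. by rewrite /index_iota subn1. Qed.

Section closest_return_lower.
Context (R : realType) (mu : probability (measurableTypeR R) R) (f : R -> R)
  (mf : measurable_fun setT (f : measurableTypeR R -> measurableTypeR R))
  (pf : forall A : set (measurableTypeR R), measurable A -> mu (f @^-1` A) = mu A)
  (ef : forall A : set (measurableTypeR R), measurable A -> f @^-1` A = A ->
    pr mu A = 0 \/ pr mu A = 1)
  (r : nat -> R) (rdec : forall m n : nat, (0 < m <= n)%N -> r n <= r m)
  (B : R) (rB : forall N, \sum_(1 <= n < N) ball_avg mu (r n) <= B).

Let good : set (measurableTypeR R) := [set x | \forall n \near \oo, r n < closest_return f n x].

(** Radii that stay above [e] would make every term of the series at least [ball_avg mu e], which is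
    positive. *)
Lemma radius_small e : 0 < e -> exists2 n, (0 < n)%N & r n < e.
Proof.
move=> e0; apply: contrapT => nr.
have re n : (0 < n)%N -> e <= r n.
  by move=> n0; rewrite leNgt; apply/negP => h; apply: nr; exists n.
have b0 := ball_avg_gt0 mu e0.
have key N : N%:R * ball_avg mu e <= B.
  apply: le_trans (rB N.+1); rewrite -(sum_iota_const 1) index_iota1.
  rewrite [leLHS]big_seq [leRHS]big_seq.
  apply: ler_sum => n; rewrite mem_iota => /andP[n0 _]; apply: le_ball_avg.
  exact: re.
have := truncnS_gt (B / ball_avg mu e); rewrite ltr_pdivrMr// => h.
by have := lt_le_trans h (key _); rewrite ltxx.
Qed.

Lemma measurable_good : measurable good.
Proof.
apply: (@measurable_near_infty _ _ (fun n => [set x | r n < closest_return f n x])) => n.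
rewrite (_ : [set _ | _] = closest_return f n @^-1` `]r n, +oo[); last first.
  by apply/seteqP; split => x /=; rewrite in_itv/= andbT.
rewrite -[X in measurable X]setTI.
exact: (measurable_closest_return n mf measurableT (measurable_itv _)).
Qed.

(** Borel-Cantelli is applied in induced time, to the radius [r m] at the visit number [m]. Since
    [m <= k] and the radii decrease, this covers the smaller radius [r k] at the real time [k]. *)
Lemma closest_return_lower_induced Y P T C th H : induced mu f Y P T C th H ->
  pr mu (Y `\` good) = 0.
Proof.
move=> ind.
have mY := ind_mY ind; have ms := ind_ms ind; have ypos := ind_pos ind.
have mper p : measurable ([set x | iter p.+1 f x = x] : set (measurableTypeR R)).
  rewrite (_ : [set _ | _] = [set x | `|iter p.+1 f x - x| <= 0]).
    by apply: measurable_close; [exact: measurable_iter|exact: measurable_id].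
  by apply/seteqP; split => x; rewrite /= normr_le0 subr_eq0 => /eqP.
pose Per : set (measurableTypeR R) := \bigcup_p [set x | iter p.+1 f x = x].
have mPer : measurable Per by exact: bigcupT_measurable.
have Per0 : pr mu (Y `&` Per) = 0 by exact: (periodic_null mf ind).
have mYg : measurable (Y `\` good : set (measurableTypeR R)).
  by apply: measurableD => //; exact: measurable_good.
have cl0 x n (rn : r n <= 0) : ~ Per x -> (0 < n)%N -> r n < closest_return f n x.
  move=> nP n0; apply: lt_closest_return => // k /andP[k0 kn].
  apply: le_lt_trans rn _; rewrite normr_gt0 subr_eq0; apply/eqP => E.
  by apply: nP; exists k.-1 => //=; rewrite -iterS prednK.
(* After a nonpositive radius all radii are nonpositive, and only an exact return could violate the
   claim. *)
have [[n0 n00 rn0]|rpos] := pselect (exists2 n, (0 < n)%N & r n <= 0).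
  apply/eqP; rewrite eq_le pr_ge0 andbT -Per0; apply: le_pr => //; first exact: measurableI.
  move=> x [Yx ng]; split => //; apply: contrapT => nP; apply: ng.
  exists n0 => // n /= nn; apply: cl0 => //; last exact: leq_trans n00 nn.
  by apply: le_trans rn0; apply: rdec; rewrite n00.
have {}rpos n : (0 < n)%N -> 0 < r n.
  by move=> n0; rewrite ltNge; apply/negP => h; apply: rpos; exists n.
pose L n : set (measurableTypeR R) := late_return f Y T n.+1 (r n.+1).
have mL n : measurable (L n) by exact: (measurable_late_return mf ind).
have L0 : pr P (lim_sup_set L) = 0.
  pose y0 := pr mu Y.
  apply: (@pr_borel_cantelli _ _ _ _ _
    (3 / y0 ^+ 2 * B + 3 * C / y0 * (th / (1 - th)))) => // N.
  have /andP[t0 t1] := ms_th ms; have C0 := ms_C ms.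
  apply: (@le_trans _ _ (\sum_(0 <= n < N) (3 / y0 ^+ 2 * ball_avg mu (r n.+1)
      + 3 * C / y0 * th ^+ n.+1))).
    by apply: ler_sum => n _; apply: (late_return_le mf pf ind); exact: rpos.
  rewrite big_split/= -!mulr_sumr; apply: lerD.
    apply: ler_wpM2l; first by rewrite divr_ge0 ?exprn_ge0// ltW.
    by apply: le_trans (rB N.+1); rewrite big_add1.
  have := sum_Cth_le ms 1 N; rewrite -mulr_sumr expr1 => hC.
  rewrite (_ : 3 * C / y0 * (th / (1 - th)) = 3 / y0 * (C * th / (1 - th))); last by ring.
  rewrite (_ : 3 * C / y0 * _ = 3 / y0 * (C * \sum_(i <- iota 1 N) th ^+ i)).
    by rewrite ler_wpM2l// divr_ge0// ltW.
  have -> : \sum_(0 <= i < N) th ^+ i.+1 = \sum_(i <- iota 1 N) th ^+ i.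
    by rewrite -index_iota1 big_add1.
  by ring.
have mlimL : measurable (lim_sup_set L).
  by apply: bigcap_measurableType => n _; apply: bigcup_measurable => k _.
have L0' := pr_induced_null ind mlimL L0.
have V0 := few_visits_null mf pf ef ind.
set V := lim_sup_set (freq_dev _ _ _ _) in V0.
have mV : measurable V.
  apply: bigcap_measurableType => n _; apply: bigcup_measurable => k _.
  exact: (measurable_freq_dev mu mf (pr mu Y / 2) k mY).
apply/eqP; rewrite eq_le pr_ge0 andbT.
rewrite (_ : 0 = pr mu (lim_sup_set L `&` Y) + (pr mu (Y `&` Per) + pr mu V)); last first.
  by rewrite L0' Per0 V0 !addr0.
have mYP : measurable (Y `&` Per) by exact: measurableI.
have mLY : measurable (lim_sup_set L `&` Y) by exact: measurableI.
apply: (@le_trans _ _ (pr mu (lim_sup_set L `&` Y) + pr mu (Y `&` Per `|` V))); last first.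
  by rewrite lerD2l; exact: prU.
apply: le_trans (prU _ _ _) => //; last exact: measurableU.
apply: le_pr => //; first by apply: measurableU => //; exact: measurableU.
move=> x [Yx ng]; apply: contrapT => /not_orP[nL /not_orP[nP nV]]; apply: ng.
have {}nP : ~ Per x by move=> h; apply: nP.
have {nL} [N hN] : exists N, forall m, (N <= m)%N -> ~ L m x.
  apply: contrapT => h; apply: nL; split => // N _.
  by apply: contrapT => h'; apply: h; exists N => m Nm Lm; apply: h'; exists m.
have [K hK] := visits_unbounded ind N.+1 nV.
have far k : (K <= k)%N -> r k < `|iter k f x - x|.
  move=> Kk; rewrite ltNge; apply/negP => close.
  have := hK k Kk; set m := visits f Y k x => Nm.
  have mk : (m <= k)%N by rewrite /m -[leqRHS](visits_setC f Y k x) leq_addr.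
  have [t E nY] := orbit_T ind k Yx; rewrite -/m in E nY.
  case: m => [//|m] in Nm mk E nY *; apply: (hN m) => //.
  split => //; exists t => //; split; first by move=> i /= hi; exact: nY.
  rewrite /= -E (le_trans close)//; apply: rdec; by rewrite mk.
(* The finitely many early distances are positive because [x] is not periodic, while the radii drop
   below any positive number. *)
have [d d0 hd] : exists2 d, 0 < d & forall k, (0 < k < K)%N -> d <= `|iter k f x - x|.
  exists (\big[Num.min/1]_(k <- iota 1 K) `|iter k f x - x|).
    rewrite big_seq; apply: (big_ind (fun u => 0 < u)) => [//|u v u0 v0|k].
      by rewrite lt_min u0.
    rewrite mem_iota => /andP[k0 _]; rewrite normr_gt0 subr_eq0; apply/eqP => E.
    by apply: nP; exists k.-1 => //=; rewrite -iterS prednK.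
  move=> k /andP[k0 kK]; have : k \in iota 1 K by rewrite mem_iota k0 add1n ltnS ltnW.
  elim: (iota 1 K) => // j s IH.
  by rewrite inE big_cons ge_min => /predU1P[->|/IH ->]; rewrite ?lexx ?orbT.
have [n1 n10 rn1] := radius_small d0.
exists (maxn n1 K).+1 => // n /= Kn.
have n1n : (n1 <= n)%N by rewrite (leq_trans _ Kn)// (leq_trans (leq_maxl _ K)).
apply: lt_closest_return; first exact: leq_trans n10 n1n.
move=> k /andP[k0 kn]; have [Kk|kK] := leqP K k.
  by apply: le_lt_trans (far k Kk); apply: rdec; rewrite k0.
apply: lt_le_trans (hd k _); last by rewrite k0.
by apply: le_lt_trans rn1; apply: rdec; rewrite n10.
Qed.

End closest_return_lower.

(** * From induced sets to the whole space *)

Section assembly.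
Context (R : realType) (X : set R) (f : R -> R) (mu : probability (measurableTypeR R) R)
  (hmu : ergodic_acip X f mu) (hhyp : asymptotically_hyperbolic X f mu).
Let g := totalize X f.

Lemma closest_return_totalize n x : X x -> closest_return g n x = closest_return f n x.
Proof.
move=> Xx; rewrite /closest_return.
have -> : g x = f x by exact: totalizeE.
by under eq_bigr do rewrite (iter_totalize hmu _ Xx).
Qed.

Lemma return_count_totalize n r x : X x -> return_count g n r x = return_count f n r x.
Proof.
by move=> Xx; apply: eq_count => j; rewrite (iter_totalize hmu _ Xx).
Qed.

Lemma almost_all_of_induced (G : set (measurableTypeR R)) : measurable G ->
  (forall Y P T C th H, induced mu g Y P T C th H -> Y `<=` X -> pr mu (Y `\` G) = 0) ->
  mu G = 1%E.
Proof.
move=> mG h; have mGC : measurable (~` G) by exact: measurableC.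
have : pr mu (~` G) = 0.
  apply/eqP; rewrite eq_le pr_ge0 andbT; apply/ler_addgt0Pl => e e0; rewrite addr0.
  have [Y [P [T [C [th [H [ind Ye YX]]]]]]] := induced_exists hmu hhyp e0.
  have mY : measurable (Y : set (measurableTypeR R)) by exact: ind_mY ind.
  apply: le_trans Ye; rewrite -[leRHS]addr0 -(h _ _ _ _ _ _ ind YX).
  have mYC : measurable (~` Y : set (measurableTypeR R)) by exact: measurableC.
  have mYG : measurable (Y `\` G) by exact: measurableD.
  apply: le_trans (prU _ mYC mYG); apply: le_pr => //; first exact: measurableU.
  by move=> x nG; have [Yx|] := pselect (Y x); [right|left].
by rewrite prC// => /eqP; rewrite subr_eq0 => /eqP G1; rewrite pr_EFin// -G1.
Qed.

Lemma closest_return_lower (r : nat -> R) :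
  (forall m n : nat, (0 < m <= n)%N -> r n <= r m) ->
  (\sum_(1 <= n <oo) \int[mu]_(x in X) mu (ball (x : R) (r n)) < +oo)%E ->
  mu [set x | X x /\ \forall n \near \oo, r n < closest_return f n x] = 1%E.
Proof.
move=> rdec rsum.
have mX : measurable (X : set (measurableTypeR R)) by case: hmu.
have mg := measurable_totalize hmu.
have S0 n : (0 <= \int[mu]_(x in X) mu (ball (x : R) (r n)))%E by exact: integral_ge0.
have [B hB] : exists B, forall N, \sum_(1 <= n < N) ball_avg mu (r n) <= B.
  exists (fine (\sum_(1 <= n <oo) \int[mu]_(x in X) mu (ball (x : R) (r n))))%E => N.
  rewrite -lee_fin fineK; last first.
    by rewrite ge0_fin_numE//; exact: nneseries_ge0.
  rewrite -sumEFin; under eq_bigr do rewrite -(ball_avg_full _ mX (acip_full hmu)).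
  exact: nneseries_lim_ge.
set G : set (measurableTypeR R) := [set x | _].
have GE : G = X `&` [set x | \forall n \near \oo, r n < closest_return g n x].
  by apply/seteqP; split => x [Xx [N _ hN]]; split => //; exists N => // n Nn;
    have := hN n Nn; rewrite /= closest_return_totalize.
have mG : measurable G by rewrite GE; apply: measurableI => //; exact: measurable_good.
apply: almost_all_of_induced => // Y P T C th H ind YX.
rewrite -(closest_return_lower_induced mg (totalize_preserving hmu)
  (totalize_ergodic hmu) rdec hB ind).
by congr (pr mu _); apply/seteqP; split => x [Yx nG]; split => // h; apply: nG;
  move: h; rewrite GE => //; [split => //; exact: YX|case].
Qed.

End assembly.

(** * Lebesgue density points *)

Section density.
Context (R : realType) (mu : probability (measurableTypeR R) R) (X : set R)
  (rho : R -> R) (mX : measurable (X : set (measurableTypeR R)))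
  (hrho : is_density X mu rho).
Local Notation leb := lebesgue_measure.

Lemma density_null (N : set (measurableTypeR R)) : measurable N -> leb N = 0%E ->
  pr mu N = 0.
Proof.
case: hrho => mrho rho0 murho mN N0; rewrite /pr murho//.
rewrite null_set_integral//.
- exact: measurableI.
- by apply/measurable_EFinP; apply: measurable_funS mrho.
- by apply/eqP; rewrite eq_le measure_ge0 andbT -[leRHS]N0 le_measure// inE//; exact: measurableI.
Qed.

Let restr (A : set R) := rho \_ (A `&` X).

Lemma measurable_density_restr (A : set (measurableTypeR R)) : measurable A ->
  measurable_fun setT (restr A : measurableTypeR R -> R).
Proof.
case: hrho => mrho _ _ mA; apply/(measurable_restrictT _ _).1; first exact: measurableI.
exact: measurable_funS mrho.
Qed.

Lemma integral_density_restr (A B : set (measurableTypeR R)) : measurable A -> measurable B ->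
  (\int[leb]_(x in B) (restr A x)%:E)%E = (pr mu (B `&` A))%:E.
Proof.
case: hrho => mrho rho0 murho mA mB.
rewrite -pr_EFin ?murho//; [|exact: measurableI..].
rewrite -setIA [RHS]integral_mkcondr; apply: eq_integral => x _.
by rewrite /restr !patchE; case: ifPn.
Qed.

Lemma density_restr_ge0 A x : 0 <= restr A x.
Proof.
case: hrho => _ rho0 _; rewrite /restr patchE; case: ifPn => // /set_mem[_ Xx].
exact: rho0.
Qed.

Lemma integrable_density_restr (A : set (measurableTypeR R)) : measurable A ->
  leb.-integrable setT (EFin \o restr A).
Proof.
move=> mA; apply/integrableP; split; first by apply/measurable_EFinP; exact: measurable_density_restr.
under eq_integral do rewrite /= ger0_norm ?density_restr_ge0//.
by rewrite integral_density_restr// ltry.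
Qed.

(** Lebesgue differentiation of the density restricted to [A], which still equals [rho x] at points
    of [A] in [X]. With [A] a set of returns it gives the local mass in that set, and with [A] the
    whole line the total local mass; the difference is negligible against [r]. *)
Lemma density_points (A : set (measurableTypeR R)) : measurable A ->
  exists N : set (measurableTypeR R), [/\ measurable N, pr mu N = 0 &
    forall x e, A x -> X x -> ~ N x -> 0 < e -> exists2 d, 0 < d &
      forall r, 0 < r < d -> `|pr mu (ball (x : R) r `&` A) - 2 * r * rho x| <= e * r].
Proof.
move=> mA; have iA := integrable_density_restr mA.
have lA : locally_integrable setT (restr A).
  by apply: open_integrable_locally => //; exact: openT.
have [N [mN N0 sN]] := lebesgue_differentiation lA.
exists N; split => //; first exact: density_null.
move=> x e Ax Xx Nx e0.
have : lebesgue_pt (restr A) x by apply: contrapT => h; apply: Nx; exact: sN.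
have e2 : 0 < e / 2 by rewrite divr_gt0.
move=> /fine_cvgP[] fin /cvgrPdist_le/(_ _ e2) close.
have [d /= d0 hd] := filterI fin close; exists d => // r /andP[r0 rd].
have [] : davg (restr A) x r \is a fin_num /\ `|0 - fine (davg (restr A) x r)| <= e / 2.
  by apply: hd => //=; rewrite sub0r normrN gtr0_norm.
have mb : measurable (ball (x : R) r : set (measurableTypeR R)) by exact: measurable_ball.
have rx : restr A x = rho x by rewrite /restr patchE mem_set.
rewrite sub0r normrN => dfin; rewrite ger0_norm ?fine_ge0 ?davg_ge0// => dle.
have {dfin dle} : (davg (restr A) x r <= (e / 2)%:E)%E by rewrite -(fineK dfin) lee_fin.
rewrite /davg /iavg (lebesgue_measure_ball _ (ltW r0)) => dle.
have {dle} : (\int[leb]_(y in ball x r) `|(restr A y - restr A x)%:E| <= (e * r)%:E)%E.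
  move: dle; rewrite inver mulrn_eq0/= gt_eqF//.
  rewrite muleC lee_pdivrMr ?mulrn_wgt0// -EFinM (_ : e / 2 * _ = e * r)//.
  by rewrite -mulr_natr; field.
move=> dle; rewrite -lee_fin; apply: le_trans dle.
have icst : leb.-integrable (ball x r) (EFin \o (fun=> restr A x)).
  apply/integrableP; split; first exact/measurable_EFinP/measurable_cst.
  rewrite /= integral_cst// -[X in (_ * X)%E]/(leb (ball x r)).
  by rewrite (lebesgue_measure_ball _ (ltW r0)) -EFinM ltry.
have ib : leb.-integrable (ball x r) (EFin \o restr A) by exact: integrableS iA.
have ic : (\int[leb]_(y in ball x r) (restr A x)%:E)%E = (rho x * (r *+ 2))%:E.
  transitivity ((restr A x)%:E * leb (ball x r))%E; first exact: integral_cst.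
  by rewrite (lebesgue_measure_ball _ (ltW r0)) rx.
apply: (@le_trans _ _ `|\int[leb]_(y in ball x r) (restr A y - restr A x)%:E|%E).
  rewrite integralB_EFin// integral_density_restr// ic.
  rewrite -EFinB /= lee_fin (_ : rho x * _ = 2 * r * rho x)//.
  by rewrite -mulr_natr; ring.
apply: le_abse_integral => //.
by apply/measurable_EFinP; apply: measurable_funB => //; apply: measurable_funTS; exact: measurable_density_restr.
Qed.

(** [rho], extended by 0, and the Radon-Nikodym derivative have the same integral over every
    measurable set, hence agree almost everywhere; the change of variables known for the latter
    carries over. *)
Lemma density_integral (g : measurableTypeR R -> R) : bmeasurable g ->
  (\int[leb]_(x in X) (rho x * g x)%:E)%E = (ex mu g)%:E.
Proof.
move=> bg; have mT : measurable (setT : set (measurableTypeR R)) by [].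
have mu_leb : mu `<< leb.
  apply/null_content_dominatesP => N mN N0.
  by rewrite pr_EFin// density_null.
have mr := measurable_density_restr mT.
have ir := integrable_density_restr mT.
rewrite -ex_EFin// -(Radon_Nikodym_change_of_variables mu_leb mT (bm_integrable mu bg)).
transitivity (\int[leb]_x ((g x)%:E * (restr setT x)%:E))%E.
  rewrite integral_mkcond; apply: eq_integral => x _.
  rewrite /restr setTI !patchE; case: ifPn => _; last by rewrite mule0.
  by rewrite -EFinM mulrC.
have mg : measurable_fun setT (EFin \o g) by apply/measurable_EFinP; case: bg.
have iRN := Radon_Nikodym_integrable (nu := charge_of_finite_measure mu) mu_leb.
have mRN := measurable_int _ iRN.
apply: ae_eq_integral => //.
- by apply: emeasurable_funM => //; exact/measurable_EFinP.
- exact: emeasurable_funM.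
apply: ae_eqe_mul2l; apply: integral_ae_eq => //.
move=> E _ mE; rewrite -Radon_Nikodym_integral// integral_density_restr// setIT.
by rewrite -pr_EFin.
Qed.

End density.

(** * Upper bounds for the closest return *)

Section poly_geometric.
Context (R : realType).
Implicit Types (x : R).

Lemma geometric_sum_le x N : 0 < x < 1 -> \sum_(0 <= k < N) x ^+ k <= (1 - x)^-1.
Proof.
move=> /andP[x0 x1]; have y0 : 0 < 1 - x by rewrite subr_gt0.
suff -> : \sum_(0 <= k < N) x ^+ k = (1 - x ^+ N) / (1 - x).
  by rewrite ler_pdivrMr// mulVf ?gt_eqF// lerBlDr lerDl exprn_ge0// ltW.
elim: N => [|N IH]; first by rewrite big_geq// expr0 subrr mul0r.
by rewrite big_nat_recr//= IH exprS; field; rewrite gt_eqF.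
Qed.

(** With [x = y * y], one factor [y ^+ k] pays for one power of [k + 1], since [(k + 1) y ^+ k] is
    at most the geometric sum up to [k]; the other factor is left to the induction hypothesis. *)
Lemma poly_geo_bounded p x : 0 < x < 1 ->
  exists2 B, 0 <= B & forall k, k.+1%:R ^+ p * x ^+ k <= B.
Proof.
elim: p x => [|p IH] x x01; have /andP[x0 x1] := x01.
  by exists 1 => // k; rewrite expr0 mul1r exprn_ile1// ltW.
pose y := Num.sqrt x.
have y0 : 0 < y by rewrite sqrtr_gt0.
have y1 : y < 1 by rewrite -sqrtr1 ltr_sqrt.
have yy : x = y * y by rewrite -expr2 sqr_sqrtr// ltW.
have y01 : 0 < y < 1 by rewrite y0.
have [B B0 hB] := IH y y01.
exists (B * (1 - y)^-1); first by rewrite mulr_ge0// invr_ge0 subr_ge0 ltW.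
move=> k; rewrite yy exprMn exprSr.
rewrite (_ : _ * _ = (k.+1%:R ^+ p * y ^+ k) * (k.+1%:R * y ^+ k)); last by ring.
have yk n : 0 <= y ^+ n by rewrite exprn_ge0// ltW.
apply: ler_pM => //; [by rewrite mulr_ge0// exprn_ge0|by rewrite mulr_ge0|].
apply: le_trans (geometric_sum_le k.+1 y01).
have -> : k.+1%:R * y ^+ k = \sum_(0 <= i < k.+1) y ^+ k.
  by rewrite sumr_const_nat subn0 mulr_natl.
rewrite [leLHS]big_nat_cond [leRHS]big_nat_cond; apply: ler_sum => i /andP[/andP[_ ik] _].
by rewrite ler_wiXn2l// ltW.
Qed.

Lemma poly_geo_summable p x : 0 < x < 1 ->
  exists2 B, 0 <= B & forall N, \sum_(0 <= k < N) k.+1%:R ^+ p * x ^+ k <= B.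
Proof.
move=> /andP[x0 x1]; pose y := Num.sqrt x.
have y0 : 0 < y by rewrite sqrtr_gt0.
have y1 : y < 1 by rewrite -sqrtr1 ltr_sqrt.
have yy : x = y * y by rewrite -expr2 sqr_sqrtr// ltW.
have y01 : 0 < y < 1 by rewrite y0.
have [B B0 hB] := poly_geo_bounded p y01.
exists (B * (1 - y)^-1); first by rewrite mulr_ge0// invr_ge0 subr_ge0 ltW.
move=> N; apply: (@le_trans _ _ (B * \sum_(0 <= k < N) y ^+ k)); last first.
  by rewrite ler_wpM2l// geometric_sum_le.
rewrite mulr_sumr; apply: ler_sum => k _; rewrite yy exprMn mulrA.
by rewrite ler_wpM2r// exprn_ge0// ltW.
Qed.

Lemma poly_geo_small p x e : 0 < x < 1 -> 0 < e ->
  exists k0, forall k, (k0 <= k)%N -> k.+1%:R ^+ p * x ^+ k <= e.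
Proof.
move=> x01 e0; have /andP[x0 _] := x01; have [B B0 hB] := poly_geo_bounded p.+1 x01.
exists (Num.truncn (B / e)) => k kk.
have := hB k; have := truncnS_gt (B / e); rewrite ltr_pdivrMr// exprSr => h1 h2.
have k1 : (Num.truncn (B / e)).+1%:R <= k.+1%:R :> R by rewrite ler_nat.
have kp : 0 < k.+1%:R :> R by rewrite ltr0n.
rewrite -(ler_pM2r kp); apply: (@le_trans _ _ B); first by move: h2; rewrite mulrAC.
by apply: le_trans (ltW h1) _; rewrite mulrC ler_wpM2l// ltW.
Qed.

End poly_geometric.

Section visits_facts.
Context (R : realType).
Implicit Types (f T : R -> R) (B : set R).

Lemma visits_eq0P f B n x : reflect (forall j, (0 < j <= n)%N -> ~ B (iter j f x))
  (visits f B n x == 0%N).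
Proof.
rewrite /visits -leqn0 leqNgt -has_count; apply: (iffP hasPn) => h j.
  by move=> /andP[j0 jn] Bj; have := h j; rewrite mem_iota j0 add1n ltnS jn mem_set// => /(_ isT).
by rewrite mem_iota add1n ltnS => /h Bj; apply/negP => /set_mem.
Qed.

Lemma visits_mono f B m n x : (m <= n)%N -> (visits f B m x <= visits f B n x)%N.
Proof. by move=> mn; rewrite -(subnKC mn) visitsD leq_addr. Qed.

Lemma eq_visits f T B n x : (forall j, iter j f x = iter j T x) ->
  visits f B n x = visits T B n x.
Proof. by move=> E; apply: eq_count => j; rewrite E. Qed.

End visits_facts.

Section induced_expectation.
Context (R : realType) (mu : probability (measurableTypeR R) R) (f : R -> R)
  (Y : set R) (P : probability (measurableTypeR R) R) (T : R -> R) (C th H : R)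
  (ind : induced mu f Y P T C th H).

Let y0 := pr mu Y.
Let mY := ind_mY ind.
Let ypos := ind_pos ind.

Lemma pr_induced_setC : pr P (~` Y) = 0.
Proof.
rewrite (ind_P ind); last exact: measurableC.
by rewrite setICl pr0 mul0r.
Qed.

Lemma pr_inducedI (A : set (measurableTypeR R)) : measurable A -> pr P (A `&` Y) = pr P A.
Proof.
by move=> mA; rewrite !(ind_P ind)//; [rewrite -setIA setIid|exact: measurableI].
Qed.

Lemma ex_induced_le (g : measurableTypeR R -> R) : bmeasurable g -> (forall x, 0 <= g x) ->
  ex P g <= ex mu g / y0.
Proof.
move=> bg g0.
have i0 : 0 <= y0^-1 by rewrite invr_ge0 ltW.
have mg : measurable_fun setT (EFin \o g) by apply/measurable_EFinP; case: bg.
have E : (\int[mscale (NngNum i0) mu]_x (g x)%:E = (y0^-1)%:E * \int[mu]_x (g x)%:E)%E.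
  by rewrite (ge0_integral_mscale mu measurableT (NngNum i0) mg)// => x _; rewrite lee_fin.
rewrite -lee_fin mulrC EFinM -!ex_EFin// -E.
apply: ge0_le_measure_integral => //.
move=> S mS; rewrite /= /mscale /= !pr_EFin// -EFinM lee_fin (ind_P ind)// mulrC.
by rewrite ler_wpM2l//; apply: le_pr => //; exact: measurableI.
Qed.

(** The upper bound of [ex_induced_le], applied to [g] and to [K - g] with [K] a bound of [g], gives
    both inequalities. *)
Lemma ex_induced (g : measurableTypeR R -> R) : bmeasurable g -> (forall x, 0 <= g x) ->
  ex P g = ex mu (fun x => \1_Y x * g x) / y0.
Proof.
move=> bg g0.
have b1 : bmeasurable (\1_Y : measurableTypeR R -> R) by exact: bm_indic.
have key (h : measurableTypeR R -> R) : bmeasurable h -> (forall x, 0 <= h x) ->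
    ex P h <= ex mu (fun x => \1_Y x * h x) / y0.
  move=> bh h0; apply: le_trans; last first.
    by apply: ex_induced_le => [|x]; [exact: bmM|rewrite mulr_ge0].
  have b2 : bmeasurable (\1_(~` Y) : measurableTypeR R -> R).
    by apply: bm_indic; exact: measurableC.
  have [K hK] := bh.2.
  apply: (@le_trans _ _ (ex P (fun x => \1_Y x * h x) + K * ex P (\1_(~` Y)))).
    rewrite -exZ// -exD//; [|exact: bmM|by apply: bmM => //; exact: bm_cst].
    apply: le_ex => //; first by apply: bmD; apply: bmM => //; exact: bm_cst.
    move=> x; rewrite !indicE in_setC; case: (x \in Y) => /=.
      by rewrite mul1r mulr0 addr0.
    by rewrite mul0r add0r mulr1 (le_trans (ler_norm _) (hK x)).
  by rewrite ex_indic ?pr_induced_setC ?mulr0 ?addr0//; exact: measurableC.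
apply/eqP; rewrite eq_le key//=.
have [K hK] := bg.2.
have bK : bmeasurable (fun x => K - g x) by apply: bmB => //; exact: bm_cst.
have := key _ bK (fun x => _); rewrite exB//; last exact: bm_cst.
have -> : ex mu (fun x => \1_Y x * (K - g x)) = K * y0 - ex mu (fun x => \1_Y x * g x).
  rewrite -[X in K * X](ex_indic mu mY) -exZ// -exB//; [|by apply: bmM => //; exact: bm_cst|exact: bmM].
  by apply: eq_ex => x; ring.
rewrite ex_cst mulrBl mulfK ?gt_eqF// => h.
have {h} := h (fun x => _); rewrite lerD2l lerN2; apply => x.
by rewrite subr_ge0 (le_trans (ler_norm _) (hK x)).
Qed.

End induced_expectation.

Definition thin_cell (R : realType) (a s r : R) (k : nat) : interval R :=
  `[a + s * k.+1%:R - r, a + s * k%:R + r].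

Section thin_cells.
Context (R : realType).
Implicit Types (a s r x y : R).

Lemma in_thin_cell a s r k x :
  (x \in [set` thin_cell a s r k]) = (a + s * k.+1%:R - r <= x <= a + s * k%:R + r).
Proof. by rewrite mem_setE in_itv. Qed.

Lemma thin_sub_fat a s r k : 0 <= s ->
  [set` thin_cell a s r k] `<=` [set` fat_cell a s r k].
Proof.
move=> s0 x /mem_set; rewrite in_thin_cell => /andP[h1 h2]; apply: set_mem.
rewrite in_fat_cell; move: h1 h2; rewrite -natr1 => h1 h2.
by apply/andP; split; lra.
Qed.

Lemma thin_dist a s r k x y : x \in [set` cell a s k] ->
  y \in [set` thin_cell a s r k] -> `|y - x| <= r.
Proof.
rewrite in_cell in_thin_cell -natr1 ler_norml => /andP[h1 h2] /andP[h3 h4].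
by apply/andP; split; lra.
Qed.

Lemma ball_thin a s r k x : x \in [set` cell a s k] ->
  ball x (r - s) `<=` [set` thin_cell a s r k].
Proof.
rewrite in_cell -natr1 => /andP[h1 h2] y xy; have : `|x - y| < r - s by move: xy; rewrite /ball/=.
rewrite ltr_norml => /andP[h3 h4]; apply: set_mem; rewrite in_thin_cell -natr1.
by apply/andP; split; lra.
Qed.

End thin_cells.

(** * Points that miss their thin cell *)

Section miss.
Context (R : realType) (P : probability (measurableTypeR R) R) (T : R -> R)
  (C th H : R) (ms : mixing_system P T C th H).
Let mT := ms_meas ms.
Let mi := @measurable_itvR R.

Definition meets (G : set R) a s i : bool := `[< exists2 x, x \in [set` cell a s i] & G x >].

(** Only cells that meet [G] are kept: a point of [G] in the cell provides the lower bound on the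
    measure of the thin cell. *)
Definition miss_set (G : set R) a s r M m : set R :=
  \big[setU/set0]_(i < M | meets G a s i)
    ([set` cell a s i] `&` [set x | visits T [set` thin_cell a s r i] m x == 0%N]).

Let measurable_miss_cell a s r m (i : nat) : measurable ([set` cell a s i] `&`
  [set x | visits T [set` thin_cell a s r i] m x == 0%N] : set (measurableTypeR R)).
Proof.
apply: measurableI; first exact: mi.
rewrite (_ : [set _ | _] = ~` [set x | 1 <= (visits T [set` thin_cell a s r i] m x)%:R :> R]).
  by apply: measurableC; apply: measurable_visits_ge => //; exact: mi.
apply/seteqP; split => x /=; rewrite -[1]/(1%:R) ler_nat lt0n; first by move=> ->.
by move/negP; rewrite negbK.
Qed.

Lemma measurable_miss_set G a s r M m :
  measurable (miss_set G a s r M m : set (measurableTypeR R)).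
Proof. by apply: bigsetU_measurable => i _; exact: measurable_miss_cell. Qed.

(** [0 ^+ n] is the indicator of [n = 0], so this is the generating function estimate at [z = 0]. *)
Lemma miss_set_le G a s r M m q : 0 < s <= r ->
  pr P (miss_set G a s r M m) <= tot_err P T C th H q m M r +
    \sum_(i < M | meets G a s i)
      pr P [set` cell a s i] * (1 - pr P [set` thin_cell a s r i]) ^+ m.
Proof.
move=> sr; have s0 : 0 <= s by have /andP[/ltW] := sr.
pose W i := [set` cell a s i] `&` [set x | visits T [set` thin_cell a s r i] m x == 0%N].
pose V i := if meets G a s i then W i else set0.
have mV i : measurable (V i : set (measurableTypeR R)).
  by rewrite /V; case: ifP => _ //; exact: measurable_miss_cell.
have -> : miss_set G a s r M m = \big[setU/set0]_(i < M) V i.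
  by rewrite /miss_set big_mkcond.
apply: le_trans (pr_bigcup_ord _ _ mV) _.
have zz : 0 <= (0 : R) <= 1 by rewrite lexx ler01.
have hD := sum_local_pgf ms (a := a) M m q sr zz (fun k => @thin_sub_fat _ a s r k s0).
have -> : \sum_(i < M | meets G a s i)
      pr P [set` cell a s i] * (1 - pr P [set` thin_cell a s r i]) ^+ m =
   \sum_(i < M) if meets G a s i then
      pr P [set` cell a s i] * (1 - pr P [set` thin_cell a s r i]) ^+ m else 0.
  by rewrite big_mkcond.
apply: le_trans (lerD hD (lexx _)); rewrite -big_split/=; apply: ler_sum => i _.
rewrite /V; case: ifP => _; last by rewrite pr0 addr0 normr_ge0.
rewrite -lerBlDr; apply: le_trans (ler_norm _); rewrite subr0 mul1r lerD2r.
rewrite -ex_indic; last exact: measurable_miss_cell.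
rewrite le_eqVlt; apply/orP; left; apply/eqP; apply: eq_ex => x.
rewrite indicI /=; congr (_ * _).
have [E|E] := eqVneq (visits T [set` thin_cell a s r i] m x) 0%N.
  by rewrite E expr0 indicE mem_set//=; apply/eqP.
by rewrite expr0n (negbTE E) indicE memNset//=; apply/negP.
Qed.

End miss.

Lemma expR_pow_le (R : realType) (u : R) m : 0 <= u <= 1 -> (1 - u) ^+ m <= expR (- (m%:R * u)).
Proof.
move=> /andP[u0 u1]; rewrite -mulNr mulrC mulrN -mulNr expRM_natr.
rewrite lerXn2r ?nnegrE ?subr_ge0 ?expR_ge0//.
exact: expR_ge1Dx.
Qed.

Lemma le_expr (R : realType) (a b : R) k : 0 <= a -> a <= b -> a ^+ k <= b ^+ k.
Proof. by move=> a0 ab; rewrite lerXn2r// nnegrE// (le_trans a0). Qed.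

(** * Error terms along a geometric sequence of times *)

Section scales.
Context (R : realType) (mu : probability (measurableTypeR R) R) (f : R -> R)
  (mf : measurable_fun setT (f : measurableTypeR R -> measurableTypeR R))
  (pf : forall A : set (measurableTypeR R), measurable A -> mu (f @^-1` A) = mu A)
  (ef : forall A : set (measurableTypeR R), measurable A -> f @^-1` A = A ->
    pr mu A = 0 \/ pr mu A = 1)
  (Y : set R) (P : probability (measurableTypeR R) R) (T : R -> R) (C th H : R)
  (ind : induced mu f Y P T C th H).
(** The common frame of both alternatives of (2): [n k] is of order [lam ^+ k], and [n k * r k] is
    bounded below and above by powers of [k + 1]. The lower bound limits the number of cells. *)
Context (lam : R) (lam1 : 1 < lam) (n : nat -> nat) (r : nat -> R) (A : R) (p k0 : nat)
  (A0 : 0 < A)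
  (hn : forall k, (k0 <= k)%N -> lam ^+ k <= (n k)%:R <= 2 * lam ^+ k)
  (hr : forall k, (k0 <= k)%N ->
    A^-1 <= (n k)%:R * r k * k.+1%:R ^+ p /\ (n k)%:R * r k <= A * k.+1%:R ^+ p).

Let ms := ind_ms ind.
Let lam0 : 0 < lam. Proof. exact: lt_trans ltr01 lam1. Qed.
Let l0 k : 0 < lam ^+ k. Proof. by rewrite exprn_gt0. Qed.
Let l1 k : 1 <= lam ^+ k. Proof. by rewrite exprn_ege1// ltW. Qed.
Let t1 k : 1 <= k.+1%:R :> R. Proof. by rewrite ler1n. Qed.
Let tp k q : 1 <= k.+1%:R ^+ q :> R. Proof. by rewrite exprn_ege1. Qed.

Lemma scale_n_gt0 k : (k0 <= k)%N -> 0 < (n k)%:R :> R.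
Proof. by move=> /hn/andP[+ _]; exact: lt_le_trans. Qed.

Lemma scale_r_gt0 k : (k0 <= k)%N -> 0 < r k.
Proof.
move=> kk; have [h _] := hr kk; have n0 := scale_n_gt0 kk.
have : 0 < (n k)%:R * r k * k.+1%:R ^+ p by apply: lt_le_trans h; rewrite invr_gt0.
by rewrite pmulr_lgt0 ?exprn_gt0// pmulr_rgt0.
Qed.

Lemma scale_r_le k : (k0 <= k)%N -> r k <= A * k.+1%:R ^+ p / lam ^+ k.
Proof.
move=> kk; rewrite ler_pdivlMr//; have [_ h] := hr kk; apply: le_trans h.
rewrite mulrC ler_wpM2r ?(ltW (scale_r_gt0 kk))//.
by have /andP[] := hn kk.
Qed.

Lemma scale_r_inv k : (k0 <= k)%N -> (r k)^-1 <= 2 * A * k.+1%:R ^+ p * lam ^+ k.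
Proof.
move=> kk; have r0 := scale_r_gt0 kk; have [h _] := hr kk.
rewrite -[_^-1]mul1r ler_pdivrMr//; move: h; rewrite -[A^-1]mul1r ler_pdivrMr// => h.
apply: le_trans h _; rewrite [leRHS](_ : _ = 2 * lam ^+ k * (r k * k.+1%:R ^+ p * A)); last by ring.
rewrite [leLHS](_ : _ = (n k)%:R * (r k * k.+1%:R ^+ p * A)); last by ring.
rewrite ler_wpM2r//; last by have /andP[] := hn kk.
by rewrite !mulr_ge0// ltW.
Qed.

Let linv k : (lam ^+ k)^-1 = lam^-1 ^+ k. Proof. by rewrite exprVn. Qed.
Let lamV : 0 < lam^-1 < 1. Proof. by rewrite invr_gt0 lam0 invf_lt1. Qed.

Lemma scale_r_small e : 0 < e -> exists2 k1, (k0 <= k1)%N &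
  forall k, (k1 <= k)%N -> r k <= e.
Proof.
move=> e0; have [k1 hk1] := poly_geo_small p lamV (divr_gt0 e0 A0).
exists (maxn k0 k1); first exact: leq_maxl.
move=> k; rewrite geq_max => /andP[kk k1k].
apply: le_trans (scale_r_le kk) _; rewrite linv -mulrA mulrC -ler_pdivlMr//.
exact: hk1.
Qed.

Lemma scale_n_large (e : R) : exists k1, forall k, (k1 <= k)%N -> e <= (n k)%:R.
Proof.
have ee : 0 < (`|e| + 1)^-1 by rewrite invr_gt0 ltr_wpDl.
have [k1 hk1] := poly_geo_small 0 lamV ee.
exists (maxn k0 k1) => k; rewrite geq_max => /andP[kk k1k].
have /andP[h _] := hn kk; apply: le_trans h.
have := hk1 k k1k; rewrite expr0 mul1r -linv lef_pV2 ?posrE// ?ltr_wpDl// => h.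
by have := ler_norm e; lra.
Qed.

(** The gap is [L * k.+1], a large multiple of log n. It is long enough for the mixing error to beat
    the number of cells, of order 1 / r, and eventually below [(ln n) ^+ 2], which keeps the short
    returns within the range of (A2). The third condition bounds [M] by the number of cells of
    length [d * r k] needed to cover an interval of length [2 W]. *)
Lemma tot_err_scales (W d : R) : 0 <= W -> 0 < d ->
  exists q : nat -> nat, exists c y k1, [/\ 0 <= c, 0 < y < 1, (k0 <= k1)%N &
    forall k M m, (k1 <= k)%N -> (m <= n k)%N -> M%:R <= 2 * W / (d * r k) + 1 ->
      tot_err P T C th H (q k) m M (r k) <= c * (k.+1%:R ^+ (2 * p).+1 * y ^+ k)].
Proof.
move=> W0 d0; have /andP[th0 th1] := ms_th ms; have C0 := ms_C ms; have H0 := ms_H ms.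
have [b [K [b0 K0 short]]] := ind_short ind.
(* With [l = lam ^+ k] this makes the mixing error at most of order [1 / (l * l)]: one factor pays
   for the cells, the other one is the decay that is kept. *)
have [L hL] : exists L, th ^+ L <= lam ^- 2.
  have : (fun L => th ^+ L) @ \oo --> (0 : R) by apply: cvg_expr; rewrite ger0_norm// ltW.
  have e0 : 0 < lam ^- 2 by rewrite invr_gt0 exprn_gt0.
  move=> /cvgrPdist_le/(_ _ e0)[L _ hL]; exists L.
  by have := hL L (leqnn _); rewrite sub0r normrN => /(le_trans (ler_norm _)).
pose x := (lam `^ b)^-1.
have lb1 : 1 < lam `^ b.
  by rewrite /powR gt_eqF// -[ltLHS]expR0 ltr_expR mulr_gt0// ln_gt0.
have x01 : 0 < x < 1.
  by rewrite /x invr_gt0 (lt_trans ltr01 lb1)/= invf_lt1// (lt_trans ltr01).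
(* [x] is the rate that (A2) yields along the scales, and [lam^-1] that of the three other terms of
   [tot_err]. *)
pose y := Num.max x lam^-1.
have y0 : 0 < y by rewrite lt_max; case/andP: x01 => ->.
have y1 : y < 1 by rewrite gt_max; case/andP: x01 => _ ->; case/andP: lamV.
have xy k : x ^+ k <= y ^+ k.
  by apply: le_expr; [case/andP: x01 => /ltW|rewrite le_max lexx].
have ly k : (lam ^+ k)^-1 <= y ^+ k.
  by rewrite linv; apply: le_expr; [case/andP: lamV => /ltW|rewrite le_max lexx orbT].
pose v := ln lam; have v0 : 0 < v by rewrite ln_gt0.
have [k1 hk1] : exists k1, forall k, (k1 <= k)%N -> (L * k.+1)%:R <= (k%:R * v) ^+ 2.
  exists (Num.truncn (2 * L%:R / v ^+ 2)).+1 => k kk.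
  have : 2 * L%:R / v ^+ 2 < k%:R.
    by apply: lt_le_trans (truncnS_gt _) _; rewrite ler_nat.
  rewrite ltr_pdivrMr ?exprn_gt0// => h.
  have k1 : 1 <= k%:R :> R by rewrite ler1n (leq_trans _ kk).
  have L0 : 0 <= L%:R :> R by [].
  rewrite natrM -natr1 exprMn expr2.
  apply: (@le_trans _ _ (k%:R * (2 * L%:R))); first by nra.
  by rewrite -mulrA ler_wpM2l// ltW.
(* This gives [3 * r k <= n ^ (- 1/2)], the radius for which short returns are controlled. *)
have [k2 hk2] : exists k2, forall k, (k2 <= k)%N -> 9 * A ^+ 2 * (k.+1%:R ^+ (2 * p) * lam^-1 ^+ k) <= 1.
  have a0 : 0 < (9 * A ^+ 2)^-1 by rewrite invr_gt0 mulr_gt0// exprn_gt0.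
  have [k2 hk2] := poly_geo_small (2 * p) lamV a0.
  exists k2 => k kk; have := hk2 k kk; rewrite -[(9 * A ^+ 2)^-1]mul1r ler_pdivlMr ?mulr_gt0 ?exprn_gt0//.
  by rewrite mulrC.
pose c := (1 + 4 * H * A) * (L%:R * K) + (4 * W * A / d + 3) * C + 3 * H * L%:R * A
  + 9 * H ^+ 2 * L%:R * A ^+ 2.
exists (fun k => (L * k.+1)%N), c, y, (maxn k0 (maxn k1 k2)); split.
- have [A0' K0' d0'] : [/\ 0 <= A, 0 <= K & 0 <= d] by split; exact: ltW.
  have HA : 0 <= 4 * H * A by rewrite !mulr_ge0.
  have WA : 0 <= 4 * W * A / d by rewrite divr_ge0// !mulr_ge0.
  rewrite /c; apply: addr_ge0; first apply: addr_ge0; first apply: addr_ge0.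
  + by rewrite mulr_ge0 ?addr_ge0// mulr_ge0.
  + by rewrite mulr_ge0// addr_ge0.
  + by rewrite !mulr_ge0.
  + by rewrite !mulr_ge0// exprn_ge0.
- by rewrite y0.
- exact: leq_maxl.
move=> k M m; rewrite !geq_max => /andP[kk /andP[k1k k2k]] mn hM.
have r0 := scale_r_gt0 kk; have n0 := scale_n_gt0 kk.
have /andP[nl nu] := hn kk; have [hr1 hr2] := hr kk.
have rle := scale_r_le kk.
set t := k.+1%:R : R in hr1 hr2 rle *; set l := lam ^+ k in nl nu rle *.
have l_gt0 : 0 < l by exact: l0.
have l_ge1 : 1 <= l by exact: l1.
have t_ge1 : 1 <= t by exact: t1.
have t_ge0 : 0 <= t by rewrite (le_trans ler01).
have tq j : (j <= (2 * p).+1)%N -> t ^+ j <= t ^+ (2 * p).+1.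
  by move=> h; rewrite ler_weXn2l.
set tt := t ^+ (2 * p).+1.
have tt0 : 0 <= tt by rewrite exprn_ge0.
have yk0 : 0 <= y ^+ k by rewrite exprn_ge0// ltW.
have q_le : (L * k.+1)%:R <= (ln ((n k)%:R : R)) ^+ 2.
  apply: le_trans (hk1 k k1k) _; apply: le_expr; first by rewrite mulr_ge0// ltW.
  by rewrite mulr_natl -lnXn// ler_ln ?posrE.
have r3 : 3 * r k <= (n k)%:R `^ (- (1 / 2)).
  set w := _ `^ _; have w0 : 0 < w by rewrite powR_gt0.
  have ww : w * w = (n k)%:R^-1.
    rewrite -powRD; last by apply/implyP => _; rewrite gt_eqF.
    rewrite (_ : - (1 / 2) + - (1 / 2) = -1); last by field.
    by rewrite powR_inv1// ltW.
  have : (3 * r k) ^+ 2 <= w ^+ 2.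
    rewrite [leRHS]expr2 ww -[leRHS]mul1r ler_pdivlMr//.
    apply: le_trans (hk2 k k2k); rewrite -linv -/l -/t.
    rewrite [leLHS](_ : _ = 9 * ((n k)%:R * r k) * r k); last by ring.
    apply: (@le_trans _ _ (9 * (A * t ^+ p) * (A * t ^+ p / l))).
      apply: ler_pM => //; [by rewrite !mulr_ge0// ltW|exact: ltW|].
      by rewrite ler_wpM2l.
    rewrite le_eqVlt; apply/orP; left; apply/eqP; rewrite mul2n -addnn exprD; ring.
  by rewrite ler_pXn2r// ?nnegrE ?mulr_ge0// ltW.
have near g : g \in iota 1 (L * k.+1) -> pr P (near_return T g (3 * r k)) <= K * x ^+ k.
  rewrite mem_iota add1n ltnS => /andP[g0 gq].
  apply: (@le_trans _ _ (pr P (near_return T g ((n k)%:R `^ (- (1 / 2)))))).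
    apply: le_pr; [exact: (measurable_near_return ms)..|].
    by move=> z; rewrite /near_return/= => /le_trans; exact.
  have nk0 : (0 < n k)%N by rewrite -(ltr0n R).
  apply: le_trans (short _ _ nk0 g0 _) _.
    by apply: le_trans q_le; rewrite ler_nat.
  apply: ler_wpM2l; first exact: ltW.
  rewrite powRN /x exprVn lef_pV2; [|by rewrite posrE powR_gt0|by rewrite posrE exprn_gt0// powR_gt0].
  rewrite -powR_mulrn ?powR_ge0// -powRrM mulrC powRrM powR_mulrn ?(ltW lam0)//.
  by apply: ge0_ler_powR => //; rewrite ?nnegrE ltW.
have T1 : (1 + 4 * m%:R * H * r k) * \sum_(g <- iota 1 (L * k.+1)) pr P (near_return T g (3 * r k))
    <= (1 + 4 * H * A) * (L%:R * K) * (tt * y ^+ k).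
  have mr : m%:R * r k <= A * t ^+ p.
    by apply: le_trans hr2; rewrite ler_wpM2r ?ler_nat// ltW.
  apply: (@le_trans _ _ ((1 + 4 * H * A) * t ^+ p * ((L%:R * t) * (K * x ^+ k)))).
    apply: ler_pM.
    - by rewrite addr_ge0// !mulr_ge0// ltW.
    - by apply: sumr_ge0 => g _; exact: pr_ge0.
    - rewrite (_ : 4 * m%:R * H * r k = 4 * H * (m%:R * r k)); last by ring.
      apply: (@le_trans _ _ (t ^+ p + 4 * H * (A * t ^+ p))).
        by rewrite lerD ?tp// ler_wpM2l// mulr_ge0.
      by rewrite le_eqVlt; apply/orP; left; apply/eqP; ring.
    - have -> : L%:R * t * (K * x ^+ k) = \sum_(g <- iota 1 (L * k.+1)) K * x ^+ k.
        by rewrite sum_iota_const natrM.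
      by rewrite big_seq [leRHS]big_seq; apply: ler_sum => g; exact: near.
  rewrite (_ : _ * _ = (1 + 4 * H * A) * (L%:R * K) * (t ^+ p.+1 * x ^+ k)); last first.
    by rewrite exprS; ring.
  apply: ler_wpM2l; first by rewrite mulr_ge0 ?addr_ge0 ?mulr_ge0// ltW.
  apply: ler_pM => //; [exact: exprn_ge0| |by apply: tq; rewrite ltnS mul2n -addnn leq_addr].
  by rewrite exprn_ge0// ltW//; case/andP: x01.
have thq : th ^+ (L * k.+1) <= (l * l)^-1.
  rewrite exprM; apply: (@le_trans _ _ ((lam ^- 2) ^+ k.+1)).
    by apply: le_expr => //; rewrite exprn_ge0// ltW.
  rewrite exprVn lef_pV2 ?posrE ?mulr_gt0 ?exprn_gt0//.
  by rewrite -exprM -exprD ler_weXn2l ?ltW// addnn mul2n leq_double.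
have T2 : (M%:R + m%:R) * (C * th ^+ (L * k.+1)) <= (4 * W * A / d + 3) * C * (tt * y ^+ k).
  have hMm : M%:R + m%:R <= (4 * W * A / d + 3) * (t ^+ p * l).
    have rinv := scale_r_inv kk; rewrite -/t -/l in rinv.
    have h1 : 2 * W / (d * r k) <= (4 * W * A / d) * (t ^+ p * l).
      rewrite (_ : 2 * W / (d * r k) = 2 * W / d * (r k)^-1); last first.
        by field; rewrite !gt_eqF.
      rewrite (_ : _ * (t ^+ p * l) = 2 * W / d * (2 * A * t ^+ p * l)); last by ring.
      by rewrite ler_wpM2l// divr_ge0 ?mulr_ge0// ltW.
    have h2 : 1 + m%:R <= 3 * (t ^+ p * l).
      have : l <= t ^+ p * l by rewrite ler_peMl ?tp// ltW.
      have : m%:R <= (n k)%:R :> R by rewrite ler_nat.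
      by lra.
    by rewrite mulrDl; lra.
  have c0 : 0 <= C * th ^+ (L * k.+1) by exact: (ms_Cth0 ms).
  apply: (@le_trans _ _ ((4 * W * A / d + 3) * (t ^+ p * l) * (C * (l * l)^-1))).
    by apply: ler_pM => //; rewrite ler_wpM2l.
  rewrite (_ : _ * _ = (4 * W * A / d + 3) * C * (t ^+ p * l^-1)); last first.
    by field; rewrite !gt_eqF.
  apply: ler_wpM2l.
    by rewrite mulr_ge0// addr_ge0// divr_ge0 ?mulr_ge0// ltW.
  apply: ler_pM => //; [exact: exprn_ge0|by rewrite invr_ge0 ltW| |exact: ly].
  by apply: tq; rewrite leqW// mul2n -addnn leq_addr.
have T3 : 3 * H * (L * k.+1)%:R * r k <= 3 * H * L%:R * A * (tt * y ^+ k).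
  apply: (@le_trans _ _ (3 * H * (L%:R * t) * (A * t ^+ p / l))).
    by rewrite natrM ler_wpM2l// !mulr_ge0.
  rewrite (_ : _ * _ = 3 * H * L%:R * A * (t ^+ p.+1 * l^-1)); last by rewrite exprS; ring.
  apply: ler_wpM2l; first by rewrite !mulr_ge0// ltW.
  apply: ler_pM => //; [exact: exprn_ge0|by rewrite invr_ge0 ltW| |exact: ly].
  by apply: tq; rewrite ltnS mul2n -addnn leq_addr.
have T4 : 9 * H ^+ 2 * m%:R * (L * k.+1)%:R * r k ^+ 2 <= 9 * H ^+ 2 * L%:R * A ^+ 2 * (tt * y ^+ k).
  apply: (@le_trans _ _ (9 * H ^+ 2 * (L%:R * t) * ((A * t ^+ p) * (A * t ^+ p / l)))).
    rewrite [leLHS](_ : _ = 9 * H ^+ 2 * (L * k.+1)%:R * ((m%:R * r k) * r k)); last by ring.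
    rewrite natrM ler_wpM2l ?mulr_ge0 ?exprn_ge0//.
    apply: ler_pM => //; [by rewrite mulr_ge0// ltW|exact: ltW|].
    by apply: le_trans hr2; rewrite ler_wpM2r ?ler_nat// ltW.
  rewrite [leLHS](_ : _ = 9 * H ^+ 2 * L%:R * A ^+ 2 * (tt * l^-1)); last first.
    have -> : tt = t * (t ^+ p * t ^+ p) by rewrite /tt exprS mul2n -addnn exprD.
    ring.
  apply: ler_wpM2l; first by rewrite !mulr_ge0 ?exprn_ge0// ltW.
  by rewrite ler_wpM2l//; exact: ly.
rewrite /tot_err /c !mulrDl.
move: T1 T2 T3 T4; rewrite !mulrDl; lra.
Qed.

End scales.

Lemma pr_borel_cantelli_from d (T : measurableType d) (R : realType) (P : probability T R)
    (A : nat -> set T) (u : nat -> R) (B : R) k0 K0 : (forall n, measurable (A n)) ->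
  (k0 <= K0)%N -> (forall n, (k0 <= n)%N -> 0 <= u n) ->
  (forall n, (K0 <= n)%N -> pr P (A n) <= u n) ->
  (forall N, \sum_(k0 <= n < N) u n <= B) -> pr P (lim_sup_set A) = 0.
Proof.
move=> mA kK u0 Au uB.
pose A' n := if (K0 <= n)%N then A n else set0.
have mA' n : measurable (A' n) by rewrite /A'; case: ifP.
have -> : lim_sup_set A = lim_sup_set A'.
  apply/seteqP; split => x Lx N _.
    have [n /= nN An] := Lx (maxn N K0) Logic.I; exists n.
      exact: leq_trans (leq_maxl _ _) nN.
    by rewrite /A' (leq_trans (leq_maxr _ _) nN).
  by have [n /= nN] := Lx N Logic.I; rewrite /A'; case: ifP => // _ An; exists n.
apply: (pr_borel_cantelli mA' (B := B)) => N; apply: le_trans (uB N).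
elim: N => [|N IH]; first by rewrite !big_geq.
rewrite big_nat_recr//=; have [kN|Nk] := leqP k0 N.
  rewrite big_nat_recr//= lerD// /A'; case: ifP => [/Au//|_].
  by rewrite pr0 u0.
rewrite [leRHS]big_geq//; rewrite [in leRHS]big_geq// in IH; last exact: ltnW.
by rewrite /A' leqNgt (leq_trans Nk kK)/= pr0 addr0.
Qed.

(** * Close returns along the scales *)

Section upper_scales.
Context (R : realType) (mu : probability (measurableTypeR R) R) (f : R -> R)
  (mf : measurable_fun setT (f : measurableTypeR R -> measurableTypeR R))
  (pf : forall A : set (measurableTypeR R), measurable A -> mu (f @^-1` A) = mu A)
  (ef : forall A : set (measurableTypeR R), measurable A -> f @^-1` A = A ->
    pr mu A = 0 \/ pr mu A = 1)
  (X : set R) (rho : R -> R) (mX : measurable (X : set (measurableTypeR R)))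
  (hrho : is_density X mu rho)
  (Y : set R) (P : probability (measurableTypeR R) R) (T : R -> R) (C th H : R)
  (ind : induced mu f Y P T C th H) (YX : Y `<=` X).
Context (lam : R) (lam1 : 1 < lam) (n : nat -> nat) (r : nat -> R) (A : R) (p k0 : nat)
  (A0 : 0 < A)
  (hn : forall k, (k0 <= k)%N -> lam ^+ k <= (n k)%:R <= 2 * lam ^+ k)
  (hr : forall k, (k0 <= k)%N ->
    A^-1 <= (n k)%:R * r k * k.+1%:R ^+ p /\ (n k)%:R * r k <= A * k.+1%:R ^+ p).
(** [low] is the infimum of the density in one alternative of (2) and the density itself in the
    other. [osc] bounds by 1 the change of the exponent when the representative point of a cell is
    changed. The cube counts three losses of a factor [1 - d]: in the number of visits to [Y], in
    the radius of a ball inside the thin cell, and in the density estimate. *)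
Context (low : R -> R) (mlow : measurable_fun setT (low : measurableTypeR R -> R))
  (low0 : forall x, 0 <= low x) (lowrho : forall x, X x -> low x <= rho x)
  (d : R) (d01 : 0 < d < 1)
  (osc : forall k, (k0 <= k)%N -> forall x y, X x -> X y -> `|x - y| <= r k ->
    2 * ((n k)%:R * r k) * (low y - low x) <= 1)
  (B : R) (lowB : forall N, \sum_(k0 <= k < N)
     ex mu (fun x => expR (- (2 * (1 - d) ^+ 3 * ((n k)%:R * r k) * low x))) <= B).

Let ms := ind_ms ind.
Let mT := ms_meas ms.
Let mY := ind_mY ind.
Let y0 := pr mu Y.
Let ypos : 0 < y0 := ind_pos ind.
Let mi := @measurable_itvR R.
Let d0 : 0 < d. Proof. by case/andP: d01. Qed.
Let d1 : 0 < 1 - d. Proof. by rewrite subr_gt0; case/andP: d01. Qed.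
Let r0 := scale_r_gt0 lam1 A0 hn hr.
Let n0 := scale_n_gt0 lam1 hn.
Let y1 : y0 <= 1. Proof. exact: pr_le1. Qed.

Let kap k := 2 * (1 - d) ^+ 3 * ((n k)%:R * r k).

Let kap0 k : (k0 <= k)%N -> 0 <= kap k.
Proof.
by move=> kk; rewrite /kap !mulr_ge0 ?exprn_ge0// ltW// ?r0// n0.
Qed.

Let kap_le k : (k0 <= k)%N -> kap k <= 2 * ((n k)%:R * r k).
Proof.
move=> kk; rewrite /kap -mulrA; apply: ler_wpM2l => //; rewrite ler_piMl//.
  by rewrite mulr_ge0// ltW// r0.
by apply: exprn_ile1; [exact: ltW|rewrite lerBlDr lerDl ltW].
Qed.

Let bm_exp k : (k0 <= k)%N ->
  bmeasurable (fun x : measurableTypeR R => expR (- (kap k * low x))).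
Proof.
move=> kk; apply: (@bm_itv _ _ _ _ 0 1) => [|x].
  apply: (measurableT_comp (@measurable_expR R)).
  by apply: (@measurable_funN _ _ _ _ (fun x => kap k * low x)); apply: measurable_funM.
by rewrite expR_ge0/= -[leRHS]expR0 ler_expR oppr_le0 mulr_ge0// kap0.
Qed.

Definition far_orbit k : set R := [set x | forall j, (0 < j <= n k)%N -> r k < `|iter j f x - x|].

Lemma measurable_far_orbit k : measurable (far_orbit k : set (measurableTypeR R)).
Proof.
rewrite (_ : far_orbit k = \bigcap_(j in [set j | (0 < j <= n k)%N])
    ~` [set x | `|iter j f x - x| <= r k]).
  apply: bigcap_measurableType => j _; apply: measurableC; apply: measurable_close.
    exact: measurable_iter.
  exact: measurable_id.
apply/seteqP; split => x h j hj; first by apply/negP; rewrite -ltNge; exact: h.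
by rewrite ltNge; apply/negP; exact: (h j hj).
Qed.

(** The density estimate is made uniform by fixing the index [N] from which it holds. Almost every
    point of [Y] lies in some [G N], and Borel-Cantelli is applied for each [N] separately. *)
Let G N : set R := [set x | [/\ Y x, - N%:R <= x < N%:R & forall k, (N <= k)%N ->
  2 * (1 - d) ^+ 2 * r k * low x <= pr mu (ball x ((1 - d) * r k) `&` Y)]].

Let cells N k := (Num.truncn (2 * N%:R / (d * r k))).+1.
Let m k := Num.truncn ((1 - d) * y0 * (n k)%:R).

Let m_le k : (m k <= n k)%N.
Proof.
rewrite -(ler_nat R); apply: (@le_trans _ _ ((1 - d) * y0 * (n k)%:R)).
  by rewrite truncn_le !mulr_ge0// ltW.
by rewrite ler_piMl// mulr_ile1 ?(ltW d1) ?(ltW ypos)// lerBlDr lerDl ltW.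
Qed.

Let m_ge k : (1 - d) * y0 * (n k)%:R - 1 <= (m k)%:R.
Proof.
have := truncnS_gt ((1 - d) * y0 * (n k)%:R); rewrite -/(m k) -natr1 => h; lra.
Qed.

Let E N k := miss_set T (G N) (- N%:R) (d * r k) (r k) (cells N k) (m k).

(** One unit of the exponent in [expR 2] comes from rounding in [m k], the other one from [osc]. The
    bound is written as an expectation over the cell, so that the sum over cells becomes the
    expectation in [lowB]. *)
Let cell_bound N k i : (k0 <= k)%N -> (N <= k)%N -> meets (G N) (- N%:R) (d * r k) i ->
  pr P [set` cell (- N%:R) (d * r k) i] *
    (1 - pr P [set` thin_cell (- N%:R) (d * r k) (r k) i]) ^+ m k <=
  ex P (fun x => \1_[set` cell (- N%:R) (d * r k) i] x * (expR 2 * expR (- (kap k * low x)))).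
Proof.
move=> kk Nk /asboolP[x xi [Yx _ Gx]].
set c := [set` cell _ _ _]; set u := pr P [set` thin_cell _ _ _ _].
have mc : measurable (c : set (measurableTypeR R)) by exact: mi.
have mb : measurable (ball (x : R) ((1 - d) * r k) : set (measurableTypeR R)) by exact: measurable_ball.
have u01 : 0 <= u <= 1 by rewrite pr_ge0/= pr_le1//; exact: mi.
have rk := r0 kk.
have uge : 2 * (1 - d) ^+ 2 * r k * low x / y0 <= u.
  apply: (@le_trans _ _ (pr P (ball x ((1 - d) * r k)))).
    by rewrite (ind_P ind)// ler_pM2r ?invr_gt0// Gx.
  by apply: le_pr => //; rewrite mulrBl mul1r; exact: ball_thin.
have ub : (1 - u) ^+ m k <= expR (1 - kap k * low x).
  apply: le_trans (expR_pow_le _ u01) _; rewrite ler_expR.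
  have h1 : (1 - d) * y0 * (n k)%:R * u - 1 <= (m k)%:R * u.
    have := m_ge k; case/andP: u01 => u00 u11 h.
    apply: (@le_trans _ _ (((1 - d) * y0 * (n k)%:R - 1) * u)); last by rewrite ler_wpM2r.
    rewrite [leRHS](_ : _ = (1 - d) * y0 * (n k)%:R * u - u); last by ring.
    by rewrite lerD2l lerN2.
  have h2 : kap k * low x <= (1 - d) * y0 * (n k)%:R * u.
    apply: (@le_trans _ _ ((1 - d) * y0 * (n k)%:R * (2 * (1 - d) ^+ 2 * r k * low x / y0))).
      rewrite le_eqVlt; apply/orP; left; apply/eqP; rewrite /kap; field.
      by rewrite gt_eqF.
    by rewrite ler_wpM2l// !mulr_ge0// ltW.
  lra.
have pt z : c z -> Y z -> expR (1 - kap k * low x) <= expR 2 * expR (- (kap k * low z)).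
  move=> cz Yz; rewrite -expRD ler_expR.
  have xz : `|x - z| <= r k.
    move: xi (mem_set cz); rewrite !in_cell -natr1 => /andP[a1 a2] /andP[a3 a4].
    have dr : d * r k <= r k by rewrite ler_piMl// ltW//; case/andP: d01.
    by rewrite ler_norml; apply/andP; split; lra.
  have := osc kk (YX Yx) (YX Yz) xz => h.
  have : kap k * (low z - low x) <= 1.
    have [lz|lz] := leP (low z - low x) 0.
      by rewrite (le_trans (mulr_ge0_le0 (kap0 kk) lz)).
    by apply: le_trans h; rewrite ler_wpM2r ?kap_le// ltW.
  by lra.
rewrite -(pr_inducedI ind mc) -ex_indic; last exact: measurableI.
have mcY : measurable (c `&` Y : set (measurableTypeR R)) by exact: measurableI.
apply: (@le_trans _ _ (ex P (fun z => expR (1 - kap k * low x) * \1_(c `&` Y) z))).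
  by rewrite exZ ?(mulrC _ (ex _ _)); [rewrite ler_wpM2l// ex_ge0|exact: bm_indic].
apply: le_ex => [||z].
- by apply: bmM; [exact: bm_cst|exact: bm_indic].
- apply: bmM; first exact: bm_indic.
  by apply: bmM; [exact: bm_cst|exact: bm_exp].
rewrite indicI /=; rewrite !indicE.
have [zc|_] := boolP (z \in c); last by rewrite !mul0r mulr0.
have [zY|_] := boolP (z \in Y); last by rewrite mulr0 mulr0 mul1r mulr_ge0// expR_ge0.
by rewrite !mulr1 mul1r pt//; exact: set_mem.
Qed.

Let E_null N : pr P (lim_sup_set (E N)) = 0.
Proof.
have [q [c [y [k1 [c0 y01 k01 hq]]]]] := tot_err_scales ind lam1 A0 hn hr (ler0n R N) d0.
have [B1 B10 hB1] := poly_geo_summable (2 * p).+1 y01.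
have /andP[yy0 yy1] := y01.
apply: (@pr_borel_cantelli_from _ _ _ _ _
  (fun k => c * (k.+1%:R ^+ (2 * p).+1 * y ^+ k) +
    expR 2 / y0 * ex mu (fun x => expR (- (kap k * low x))))
  (c * B1 + expR 2 / y0 * B) k0 (maxn N k1)).
- by move=> k; exact: (measurable_miss_set ms).
- by rewrite (leq_trans k01)// leq_maxr.
- move=> k kk; apply: addr_ge0.
    by rewrite !mulr_ge0// exprn_ge0// ltW.
  apply: mulr_ge0; first by rewrite divr_ge0 ?expR_ge0// ltW.
  by apply: ex_ge0 => x; exact: expR_ge0.
- move=> k; rewrite geq_max => /andP[Nk k1k]; have kk := leq_trans k01 k1k.
  have rk := r0 kk.
  have sr : 0 < d * r k <= r k.
    by rewrite mulr_gt0//= ler_piMl// ltW//; case/andP: d01.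
  apply: le_trans (miss_set_le ms _ _ _ _ (q k) sr) _; apply: lerD.
    apply: hq => //; rewrite /cells -natr1 lerD2r truncn_le.
    by apply: divr_ge0; rewrite mulr_ge0 ?(ltW d0) ?(ltW rk).
  apply: (@le_trans _ _ (\sum_(i < cells N k) ex P (fun x =>
      \1_[set` cell (- N%:R) (d * r k) i] x * (expR 2 * expR (- (kap k * low x)))))).
    rewrite big_mkcond; apply: ler_sum => i _; case: ifP => [Si|_].
      exact: cell_bound.
    by apply: ex_ge0 => x; rewrite !mulr_ge0 ?expR_ge0.
  have b1 : bmeasurable (fun x : measurableTypeR R => expR 2 * expR (- (kap k * low x))).
    by apply: bmM; [exact: bm_cst|exact: bm_exp].
  rewrite -(@ex_sum _ _ _ P _ (index_enum 'I_(cells N k)) xpredT (fun i x =>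
    \1_[set` cell (- N%:R) (d * r k) i] x * (expR 2 * expR (- (kap k * low x))))); last first.
    by move=> i; apply: bmM => //; apply: bm_indic; exact: mi.
  apply: (@le_trans _ _ (ex P (fun x => expR 2 * expR (- (kap k * low x))))).
    apply: le_ex => //.
      by apply: bm_sum => i; apply: bmM => //; apply: bm_indic; exact: mi.
    move=> x; rewrite -mulr_suml ler_piMl ?mulr_ge0 ?expR_ge0//.
    by apply: sum_cell_le1; case/andP: sr.
  apply: le_trans (ex_induced_le ind b1 _) _; first by move=> x; rewrite mulr_ge0 ?expR_ge0.
  rewrite (exZ _ _ (bm_exp kk)); set ee := ex _ _.
  by rewrite le_eqVlt (_ : expR 2 * ee / _ = expR 2 / y0 * ee) ?eqxx// mulrAC.
- move=> N'; rewrite big_split/= -!mulr_sumr; apply: lerD.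
    apply: ler_wpM2l => //; apply: le_trans (hB1 N').
    have [kN|Nk] := leqP k0 N'; last first.
      rewrite big_geq ?(ltnW Nk)//; apply: sumr_ge0 => i _.
      by rewrite mulr_ge0 ?exprn_ge0 ?(ltW yy0).
    rewrite (big_cat_nat (leq0n k0) kN)/= lerDr; apply: sumr_ge0 => i _.
    by rewrite mulr_ge0 ?exprn_ge0 ?(ltW yy0).
  by apply: ler_wpM2l => //; rewrite divr_ge0 ?expR_ge0 ?(ltW ypos).
Qed.

(** If the orbit stays farther than [r k] up to time [n k], then the induced orbit misses the thin
    cell of [x] during its first [m k] steps, because the frequency theorem grants at least [m k]
    visits to [Y] for large [k]. *)
Lemma upper_scales : pr mu (Y `&` lim_sup_set far_orbit) = 0.
Proof.
have [N0 [mN0 N00 leb]] := density_points mX hrho mY.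
have e1 : 0 < d * y0 by rewrite mulr_gt0.
pose V := lim_sup_set (freq_dev mu f Y (d * y0)).
have V0 : pr mu V = 0 by exact: (frequency_limsup mf pf ef).
have mV : measurable (V : set (measurableTypeR R)).
  apply: bigcap_measurableType => k _; apply: bigcup_measurable => j _.
  exact: (measurable_freq_dev mu mf).
pose U : set (measurableTypeR R) := \bigcup_N lim_sup_set (E N).
have mLE N : measurable (lim_sup_set (E N) : set (measurableTypeR R)).
  apply: bigcap_measurableType => k _; apply: bigcup_measurable => j _.
  exact: (measurable_miss_set ms).
have mU : measurable U by exact: bigcupT_measurable.
have U0 : pr mu (U `&` Y) = 0.
  by apply: (pr_induced_null ind mU); apply: pr_bigcup_null.
have mL : measurable (lim_sup_set far_orbit : set (measurableTypeR R)).
  apply: bigcap_measurableType => k _; apply: bigcup_measurable => j _.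
  exact: measurable_far_orbit.
have mUY : measurable (U `&` Y) by exact: measurableI.
apply/eqP; rewrite eq_le pr_ge0 andbT.
have -> : 0 = pr mu N0 + (pr mu V + pr mu (U `&` Y)) by rewrite N00 V0 U0 !addr0.
apply: (@le_trans _ _ (pr mu N0 + pr mu (V `|` (U `&` Y)))); last by rewrite lerD2l prU.
apply: le_trans (prU _ mN0 _); last exact: measurableU.
apply: le_pr; [exact: measurableI|by apply: measurableU => //; exact: measurableU|].
move=> x [Yx Lx]; apply: contrapT => /not_orP[nN0 /not_orP[nV nU]].
apply: nU; split => //.
have Xx := YX Yx.
have [kr kr0 hkr] : exists2 k1, (k0 <= k1)%N & forall k, (k1 <= k)%N ->
    2 * (1 - d) ^+ 2 * r k * low x <= pr mu (ball x ((1 - d) * r k) `&` Y).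
  (* Where the density vanishes so does [low], and nothing is to be shown. *)
  have [rx|rx] := leP (rho x) 0.
    exists k0 => // k kk; have -> : low x = 0.
      by apply/eqP; rewrite eq_le low0 andbT (le_trans (lowrho Xx)).
    by rewrite mulr0 pr_ge0.
  (* The tolerance is a fraction [d] of the main term [2 w rho x], whence one of the factors
     [1 - d]. *)
  have e0 : 0 < 2 * d * rho x by rewrite !mulr_gt0.
  have [dd dd0 hdd] := leb x _ Yx Xx nN0 e0.
  have dd2 : 0 < dd / 2 by rewrite divr_gt0.
  have [k1 k01 hk1] := scale_r_small lam1 A0 hn hr dd2.
  exists k1 => // k kk; have rk := r0 (leq_trans k01 kk).
  set w := (1 - d) * r k.
  have w0 : 0 < w by rewrite mulr_gt0.
  have wr : w <= r k by rewrite /w ler_piMl ?(ltW rk)// lerBlDr lerDl ltW.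
  have := hdd w; rewrite w0/= => /(_ _).
  have -> : w < dd by have := hk1 k kk; lra.
  move=> /(_ isT); rewrite ler_norml => /andP[h _].
  have : 2 * (1 - d) * w * low x <= 2 * (1 - d) * w * rho x.
    by rewrite ler_wpM2l ?lowrho// !mulr_ge0// ltW.
  rewrite (_ : 2 * (1 - d) ^+ 2 * r k * low x = 2 * (1 - d) * w * low x); last by rewrite /w; ring.
  by lra.
pose N := maxn kr (Num.truncn `|x|).+1.
have GNx : G N x.
  split => //.
    have h1 : `|x| < N%:R.
      by apply: lt_le_trans (truncnS_gt _) _; rewrite ler_nat leq_maxr.
    have := ler_norm x; have := ler_norm (- x); rewrite normrN => h2 h3.
    by apply/andP; split; lra.
  by move=> k Nk; apply: hkr; rewrite (leq_trans _ Nk)// leq_maxl.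
exists N => // K _.
have {nV} [M hM] : exists M, forall j, (M <= j)%N -> ~ freq_dev mu f Y (d * y0) j x.
  apply: contrapT => h; apply: nV => M _.
  by apply: contrapT => h'; apply: h; exists M => j Mj Fj; apply: h'; exists j.
have [kn hkn] := scale_n_large lam1 hn M%:R.
have [k /= Kk far] := Lx (maxn K (maxn k0 kn)) Logic.I.
move: Kk; rewrite !geq_max => /and3P[Kk kk knk]; exists k => //.
have rk := r0 kk.
have vis : (m k <= visits f Y (n k) x)%N.
  have := hkn k knk; rewrite ler_nat => /hM; rewrite /freq_dev/= => /negP; rewrite -ltNge.
  rewrite ltr_norml => /andP[h _]; rewrite -(ler_nat R).
  apply: (@le_trans _ _ ((1 - d) * y0 * (n k)%:R)).
    by rewrite truncn_le !mulr_ge0// ltW.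
  by move: h; rewrite -/y0; lra.
have dr0 : 0 < d * r k by rewrite mulr_gt0.
have [i iM xi] : exists2 i, (i < cells N k)%N & x \in [set` cell (- N%:R) (d * r k) i].
  apply: cell_cover => //; case: GNx => _ /andP[-> xN] _ /=.
  apply: (lt_le_trans xN); have := truncnS_gt (2 * N%:R / (d * r k)).
  by rewrite ltr_pdivrMr// -/(cells N k) => h; lra.
pose F i := if meets (G N) (- N%:R) (d * r k) i then [set` cell (- N%:R) (d * r k) i] `&`
  [set x | visits T [set` thin_cell (- N%:R) (d * r k) (r k) i] (m k) x == 0%N] else set0.
have -> : E N k = \big[setU/set0]_(i < cells N k) F i by rewrite /E /miss_set big_mkcond.
rewrite -bigcup_mkord; exists i => //; rewrite /F ifT; last by apply/asboolP; exists x.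
split; first exact: set_mem.
apply/eqP/eqP; rewrite -leqn0.
have ET : visits T [set` thin_cell (- N%:R) (d * r k) (r k) i] (visits f Y (n k) x) x =
    visits f (Y `&` [set` thin_cell (- N%:R) (d * r k) (r k) i]) (n k) x.
  rewrite visits_first_return//; apply: eq_visits => j; exact: (ind_T ind).
apply: leq_trans (visits_mono T _ _ vis) _; rewrite ET leqn0.
apply/visits_eq0P => j hj [_ /mem_set yt].
by have := far j hj; rewrite ltNge (thin_dist xi yt).
Qed.

End upper_scales.

Lemma ln_le_sub1 (R : realType) (x : R) : 0 < x -> ln x <= x - 1.
Proof.
move=> x0; have : -1 < x - 1 by lra.
by move=> /le_ln1Dx; rewrite addrC subrK.
Qed.

(** The terms are the powers [(k v) ^ -(1 + e)], which telescope against [(k v) ^ -e]; the needed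
    difference comes from [ln (k / s) <= k / s - 1 = - 1 / s] with [s = k + 1]. *)
Lemma expR_log_series (R : realType) (v e : R) : 0 < v -> 0 < e ->
  exists B, forall k0 N, (2 <= k0)%N ->
    \sum_(k0 <= k < N) expR (- ((1 + e) * ln (k%:R * v))) <= B.
Proof.
move=> v0 e0; pose b k := expR (- (e * ln (k%:R * v))) : R.
have step k : (1 <= k)%N ->
    expR (- ((1 + e) * ln (k.+1%:R * v))) <= (e * v)^-1 * (b k - b k.+1).
  move=> k1; have kp : 0 < k%:R :> R by rewrite ltr0n.
  have sk : k.+1%:R = k%:R + 1 :> R by rewrite natr1.
  rewrite /b; move: (k.+1%:R : R) sk => s sk.
  have sp : 0 < s by rewrite sk ltr_wpDr.
  have l1 : ln (k%:R * v) <= ln (s * v) - s^-1.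
    rewrite !lnM ?posrE//.
    have : ln (k%:R / s) <= k%:R / s - 1 by apply: ln_le_sub1; rewrite divr_gt0.
    rewrite ln_div ?posrE// (_ : k%:R / s - 1 = - s^-1); first by move=> h; lra.
    by rewrite sk; field; rewrite -sk gt_eqF.
  have bb : expR (- (e * ln (s * v))) * (1 + e / s) <= expR (- (e * ln (k%:R * v))).
    apply: (@le_trans _ _ (expR (- (e * ln (s * v))) * expR (e / s))).
      by rewrite ler_wpM2l ?expR_ge0// expR_ge1Dx.
    rewrite -expRD ler_expR.
    have : e * ln (k%:R * v) <= e * (ln (s * v) - s^-1) by rewrite ler_wpM2l// ltW.
    by rewrite mulrBr => h; lra.
  have -> : expR (- ((1 + e) * ln (s * v))) = expR (- (e * ln (s * v))) / (s * v).
    rewrite mulrDl mul1r opprD expRD mulrC; congr (_ * _).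
    by rewrite expRN lnK// posrE mulr_gt0.
  rewrite [leRHS]mulrC ler_pdivlMr ?mulr_gt0//.
  set bs := expR (- (e * ln (s * v))) in bb *.
  rewrite (_ : _ * (e * v) = bs * (e / s)); last by field; rewrite !gt_eqF.
  by rewrite mulrDr mulr1 in bb; lra.
have b0 k : 0 <= b k by exact: expR_ge0.
have ev0 : 0 <= (e * v)^-1 by rewrite invr_ge0 mulr_ge0// ltW.
exists ((e * v)^-1 * b 1%N) => k0 N k02.
have dec k : (1 <= k)%N -> b k <= b 1%N.
  elim: k => // k IH _; case: k IH => // k IH; apply: le_trans (IH isT).
  have := le_trans (expR_ge0 _) (step k.+1 isT).
  by rewrite pmulr_rge0 ?subr_ge0// invr_gt0 mulr_gt0.
case: k0 k02 => // k0 k02.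
have [kN|Nk] := leqP k0.+1 N; last first.
  by rewrite big_geq ?(ltnW Nk)// mulr_ge0.
case: N kN => // N kN.
apply: (@le_trans _ _ (\sum_(k0 <= k < N) (e * v)^-1 * (b k - b k.+1))).
  rewrite big_add1/= big_nat_cond [leRHS]big_nat_cond.
  apply: ler_sum => k /andP[/andP[h _] _]; apply: step.
  by apply: leq_trans h.
rewrite -mulr_sumr ler_wpM2l//.
have -> : \sum_(k0 <= k < N) (b k - b k.+1) = b k0 - b N.
  rewrite -[RHS]opprB -telescope_sumr// -sumrN; apply: eq_bigr => k _; by rewrite opprB.
have := dec k0 k02; have := b0 N; lra.
Qed.

(** * From the scales to all times, and densities bounded below *)

Section closest_return_upper.
Context (R : realType) (X : set R) (f : R -> R) (mu : probability (measurableTypeR R) R)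
  (rho : R -> R) (hmu : ergodic_acip X f mu) (hhyp : asymptotically_hyperbolic X f mu)
  (hrho : is_density X mu rho).
Let g := totalize X f.
Let mX : measurable (X : set (measurableTypeR R)). Proof. by case: hmu. Qed.

(** A return found by time [n k] remains available up to [n k.+1], so it is enough to have [rad k]
    below [r N] for all [N] of that block. *)
Lemma eventually_close (n : nat -> nat) (rad r : nat -> R) (x : R) :
  (forall M, exists k0, forall k, (k0 <= k)%N -> (M <= n k)%N) ->
  (exists K, forall k, (K <= k)%N -> exists2 j, (0 < j <= n k)%N & `|iter j g x - x| <= rad k) ->
  (exists K, forall k N, (K <= k)%N -> (n k <= N < n k.+1)%N -> rad k < r N) ->
  \forall N \near \oo, closest_return g N x < r N.
Proof.
move=> nunb [K hK] [K' hK']; pose L := maxn K K'.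
exists (n L) => // N /= LN.
have [k Lk hk] : exists2 k, (L <= k)%N & (n k <= N < n k.+1)%N.
  apply: contrapT => h.
  have all i : (n (L + i) <= N)%N.
    elim: i => [|i IH]; first by rewrite addn0.
    rewrite addnS leqNgt; apply/negP => lt; apply: h; exists (L + i)%N; first exact: leq_addr.
    by rewrite IH.
  have [k0 hk0] := nunb N.+1.
  by have := hk0 _ (leq_addl L k0); rewrite ltnNge all.
have [j /andP[j0 jn] xj] := hK k (leq_trans (leq_maxl _ _) Lk).
apply: le_lt_trans (hK' k N (leq_trans (leq_maxr _ _) Lk) hk).
apply: le_trans xj; apply: closest_return_le; rewrite j0 (leq_trans jn)//.
by case/andP: hk.
Qed.

Lemma closest_return_upper_of_scales (r : nat -> R) (lam : R) (n : nat -> nat)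
    (rad : nat -> R) (A : R) (p k0 : nat) (low : R -> R) (d B : R) :
  1 < lam -> 0 < A ->
  (forall k, (k0 <= k)%N -> lam ^+ k <= (n k)%:R <= 2 * lam ^+ k) ->
  (forall k, (k0 <= k)%N -> A^-1 <= (n k)%:R * rad k * k.+1%:R ^+ p /\
     (n k)%:R * rad k <= A * k.+1%:R ^+ p) ->
  measurable_fun setT (low : measurableTypeR R -> R) ->
  (forall x, 0 <= low x) -> (forall x, X x -> low x <= rho x) -> 0 < d < 1 ->
  (forall k, (k0 <= k)%N -> forall x y, X x -> X y -> `|x - y| <= rad k ->
    2 * ((n k)%:R * rad k) * (low y - low x) <= 1) ->
  (forall N, \sum_(k0 <= k < N)
     ex mu (fun x => expR (- (2 * (1 - d) ^+ 3 * ((n k)%:R * rad k) * low x))) <= B) ->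
  (exists K, forall k N, (K <= k)%N -> (n k <= N < n k.+1)%N -> rad k < r N) ->
  mu [set x | X x /\ \forall n \near \oo, closest_return f n x < r n] = 1%E.
Proof.
move=> lam1 A0 hn hr mlow low0 lowrho d01 osc lowB hrad.
have mg := measurable_totalize hmu; have pg := totalize_preserving hmu.
have eg := totalize_ergodic hmu.
set G : set (measurableTypeR R) := [set x | _].
have GE : G = X `&` [set x | \forall n \near \oo, closest_return g n x < r n].
  by apply/seteqP; split => x [Xx [N _ hN]]; split => //; exists N => // k Nk;
    have := hN k Nk; rewrite /= (closest_return_totalize hmu).
have mG : measurable G.
  rewrite GE; apply: measurableI => //.
  apply: (@measurable_near_infty _ _ (fun n => [set x | closest_return g n x < r n])) => k.
  rewrite (_ : [set _ | _] = closest_return g k @^-1` `]-oo, r k[); last first.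
    by apply/seteqP; split => x /=; rewrite in_itv/=.
  rewrite -[X in measurable X]setTI.
  exact: (measurable_closest_return k mg measurableT (measurable_itv _)).
apply: (almost_all_of_induced hmu hhyp) => // Y P T C th H ind YX.
have mY := ind_mY ind.
have h0 := upper_scales mg pg eg mX hrho ind YX lam1 A0 hn hr mlow low0 lowrho d01 osc lowB.
have mL : measurable (lim_sup_set (far_orbit g n rad) : set (measurableTypeR R)).
  apply: bigcap_measurableType => k _; apply: bigcup_measurable => j _.
  exact: (measurable_far_orbit mg).
apply/eqP; rewrite eq_le pr_ge0 andbT -h0; apply: le_pr.
- exact: measurableD.
- exact: measurableI.
move=> x [Yx nG]; split => //; apply: contrapT => nL; apply: nG; rewrite GE.
split; first exact: YX.
apply: (@eventually_close n rad) => //.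
  move=> M; have [k1 hk1] := scale_n_large lam1 hn M%:R.
  by exists k1 => k /hk1; rewrite ler_nat.
have [K hK] : exists K, forall k, (K <= k)%N -> ~ far_orbit g n rad k x.
  apply: contrapT => h; apply: nL => K _.
  by apply: contrapT => h'; apply: h; exists K => k Kk Fk; apply: h'; exists k.
exists K => k /hK /existsNP[j /not_implyP[hj /negP]]; rewrite -leNgt => xj.
by exists j.
Qed.

(** No constant may be lost at the threshold: the series has terms [(k v) ^ -Q] with
    [Q = 2 c w > 1], up to a loss of the factor [(1 - d) ^+ 3 / lam] in the exponent. Hence [d] is
    taken small and the ratio [lam = 1 + d] close to 1. *)
Lemma closest_return_upper_const (r : nat -> R) (c : R) :
  (forall x, X x -> 0 < rho x) -> 1 < 2 * c * inf [set rho x | x in X] ->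
  (forall n : nat, (1 < n)%N -> c * ln (ln n%:R) / n%:R < r n) ->
  mu [set x | X x /\ \forall n \near \oo, closest_return f n x < r n] = 1%E.
Proof.
move=> rho0; set w := inf _ => cw hr.
have lbw x : X x -> w <= rho x.
  move=> Xx; apply: ge_inf; last by exists x.
  by exists 0 => _ [y Xy <-]; rewrite ltW// rho0.
have w0 : 0 <= w.
  have [x Xx] : exists x, X x.
    apply: contrapT => h; have := acip_full hmu.
    rewrite (_ : X = set0) ?measure0 => [/eqP|]; first by rewrite eq_sym onee_eq0.
    by apply/seteqP; split => x // Xx; apply: h; exists x.
  by apply: lb_le_inf => [|_ [y Xy <-]]; [exists (rho x); exists x|rewrite ltW// rho0].
have {}w0 : 0 < w.
  rewrite lt_neqAle w0 andbT; apply/eqP => w0'; move: cw; rewrite -w0' mulr0; lra.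
have c0 : 0 < c.
  rewrite ltNge; apply/negP => c0; have : c * w <= 0 by rewrite mulr_le0_ge0// ltW.
  by lra.
(* This value leaves [Q (1 - 3 d) - (1 + d) = (Q - 1) / 2 > 0]; as [1 - 3 d <= (1 - d) ^+ 3], the
   exponent [1 + e] is still above 1. *)
pose Q := 2 * c * w; pose d := (Q - 1) / (2 * (3 * Q + 1)).
have Q1 : 1 < Q by [].
have dQ : (3 * Q + 1) * d = (Q - 1) / 2 by rewrite /d; field; rewrite gt_eqF//; lra.
have d0 : 0 < d by rewrite divr_gt0//; lra.
have d12 : d < 1 / 2 by rewrite /d ltr_pdivrMr; lra.
pose lam := 1 + d; pose v := ln lam.
have lam1 : 1 < lam by rewrite /lam; lra.
have lam0 : 0 < lam by lra.
have v0 : 0 < v by rewrite ln_gt0.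
pose e := Q * (1 - d) ^+ 3 / lam - 1.
have e0 : 0 < e.
  rewrite subr_gt0 ltr_pdivlMr// mul1r /lam.
  have h1 : 1 - 3 * d <= (1 - d) ^+ 3.
    have -> : (1 - d) ^+ 3 = 1 - 3 * d + d ^+ 2 * (3 - d) by ring.
    by rewrite lerDl mulr_ge0 ?sqr_ge0//; lra.
  have Q0 : 0 <= Q by lra.
  have h2 : Q * (1 - 3 * d) <= Q * (1 - d) ^+ 3 by rewrite ler_wpM2l.
  by move: dQ; rewrite mulrDl mul1r => dQ; lra.
pose n k := (Num.truncn (lam ^+ k)).+1.
(* A lower bound of [c ln (ln N) / N] for [N] between [lam ^+ k] and [lam ^+ k.+1], as [k v] is the
   logarithm of [lam ^+ k]. *)
pose rad k := c * ln (k%:R * v) / lam ^+ k.+1.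
have lk k : 1 <= lam ^+ k by rewrite exprn_ege1// ltW.
have lk0 k : 0 < lam ^+ k by rewrite exprn_gt0.
have hn k : lam ^+ k < (n k)%:R <= lam ^+ k + 1.
  by rewrite /n truncnS_gt -natr1 lerD2r truncn_le (ltW (lk0 k)).
pose k0 := (maxn 2 (Num.truncn (expR 1 / v)).+1).
have kv k : (k0 <= k)%N -> 1 <= ln (k%:R * v).
  rewrite geq_max => /andP[_ kk]; rewrite -[leLHS]expRK ler_ln ?posrE ?expR_gt0//; last first.
    by rewrite mulr_gt0// ltr0n (leq_trans _ kk).
  rewrite -ler_pdivrMr// ltW//; apply: lt_le_trans (truncnS_gt _) _.
  by rewrite ler_nat.
have nrad k : (n k)%:R * rad k = ((n k)%:R / lam ^+ k) * (c / lam * ln (k%:R * v)).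
  by rewrite /rad exprS; field; rewrite !gt_eqF.
have n1 k : 1 <= (n k)%:R / lam ^+ k <= 2.
  rewrite ler_pdivlMr// mul1r ler_pdivrMr//; have := hn k; have := lk k.
  by move=> h /andP[h1 h2]; apply/andP; split; lra.
have cl0 : 0 < c / lam by rewrite divr_gt0.
have nrad_ge k : (k0 <= k)%N -> c / lam * ln (k%:R * v) <= (n k)%:R * rad k.
  move=> kk; rewrite nrad ler_peMl//; last by case/andP: (n1 k).
  by rewrite mulr_ge0 ?(ltW cl0)// (le_trans ler01)// kv.
have A0 : 0 < lam / c + 2 * (c / lam) * v.
  by apply: addr_gt0; [rewrite divr_gt0|rewrite mulr_gt0// mulr_gt0].
have [B hB] := expR_log_series v0 e0.
apply: (@closest_return_upper_of_scales r lam n rad (lam / c + 2 * (c / lam) * v) 1 k0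
  (fun=> w) d B) => //.
- by move=> k kk; have := hn k; have := lk k => h /andP[h1 h2]; apply/andP; split; lra.
- move=> k kk; have lg := kv k kk; rewrite expr1; split.
    apply: (@le_trans _ _ (c / lam * ln (k%:R * v) * k.+1%:R)); last first.
      by rewrite ler_wpM2r// nrad_ge.
    apply: (@le_trans _ _ (c / lam)).
      rewrite -[leRHS]invrK lef_pV2 ?posrE ?invr_gt0//.
      by rewrite invf_div lerDl mulr_ge0 ?(ltW v0)// mulr_ge0 ?(ltW cl0).
    rewrite -mulrA ler_peMr ?(ltW cl0)//.
    by rewrite -[leLHS]mulr1 ler_pM// ler1n.
  rewrite nrad; apply: (@le_trans _ _ (2 * (c / lam * ln (k%:R * v)))).
    rewrite ler_wpM2r//; last by case/andP: (n1 k).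
    by rewrite mulr_ge0 ?(ltW cl0)// (le_trans ler01).
  have kv0 : 0 < k%:R * v.
    by rewrite mulr_gt0// ltr0n (leq_trans _ kk)// leq_max.
  have : ln (k%:R * v) <= k.+1%:R * v.
    have := ln_le_sub1 kv0; rewrite -natr1 mulrDl mul1r; lra.
  move=> h; apply: (@le_trans _ _ (2 * (c / lam * (k.+1%:R * v)))).
    by rewrite ler_wpM2l// ler_wpM2l// ltW.
  rewrite [leRHS]mulrDl [leLHS](_ : _ = 2 * (c / lam) * v * k.+1%:R); last by ring.
  by rewrite lerDr mulr_ge0// divr_ge0// ltW.
- by move=> x; exact: ltW.
- by rewrite d0; lra.
- by move=> k _ x y _ _ _; rewrite subrr mulr0.
- move=> N; apply: le_trans (hB k0 N _); last by rewrite leq_maxl.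
  rewrite big_nat_cond [leRHS]big_nat_cond; apply: ler_sum => k /andP[/andP[kk _] _].
  rewrite ex_cst ler_expR lerN2.
  have -> : (1 + e) * ln (k%:R * v) = 2 * (1 - d) ^+ 3 * (c / lam * ln (k%:R * v)) * w.
    by rewrite /e /Q; field; rewrite gt_eqF.
  rewrite ler_wpM2r ?(ltW w0)// ler_wpM2l ?nrad_ge//.
  by rewrite mulr_ge0// exprn_ge0//; lra.
exists k0 => k N kk /andP[nN Nn].
have N1 : (1 < N)%N.
  apply: leq_trans nN; rewrite -(ltr_nat R); have /andP[h _] := hn k.
  exact: le_lt_trans (lk k) h.
apply: le_lt_trans (hr N N1).
have Nl : N%:R <= lam ^+ k.+1.
  move: Nn; rewrite /n ltnS => h; apply: le_trans _ (_ : (Num.truncn (lam ^+ k.+1))%:R <= _).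
    by rewrite ler_nat.
  by rewrite truncn_le ltW.
have N0 : 0 < N%:R :> R by rewrite ltr0n (leq_trans _ N1).
have lN : lam ^+ k < N%:R.
  by case/andP: (hn k) => h _; apply: lt_le_trans h _; rewrite ler_nat.
have kv0 : 0 < k%:R * v.
  by rewrite mulr_gt0// ltr0n (leq_trans _ kk)// leq_max.
have lnN : k%:R * v <= ln N%:R.
  by rewrite mulr_natl -lnXn// ler_ln ?posrE// ltW.
rewrite /rad; apply: ler_pM.
- by rewrite mulr_ge0 ?(ltW c0)// (le_trans ler01)// kv.
- by rewrite invr_ge0 ltW.
- by rewrite ler_wpM2l ?(ltW c0)// ler_ln ?posrE// (lt_le_trans kv0).
- by rewrite lef_pV2 ?posrE.
Qed.

End closest_return_upper.

(** * Hölder continuous densities *)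

Section powR_bounds.
Context (R : realType).

Lemma powR_poly_bounds (a : R) : exists p, forall k, (1 <= k)%N ->
  1 <= k%:R `^ a * k.+1%:R ^+ p /\ k%:R `^ a <= k.+1%:R ^+ p.
Proof.
exists (Num.truncn `|a|).+1 => k k1; set p := (Num.truncn _).+1.
have ap : `|a| <= p%:R by apply: ltW; exact: truncnS_gt.
have k1R : 1 <= k%:R :> R by rewrite ler1n.
have kp : k%:R ^+ p <= k.+1%:R ^+ p :> R by apply: le_expr => //; rewrite ler_nat.
have kp0 : 0 < k%:R ^+ p :> R by rewrite exprn_gt0// (lt_le_trans ltr01).
split; last first.
  apply: le_trans kp; rewrite -powR_mulrn//; apply: ler_powR => //.
  by rewrite (le_trans (ler_norm _)).
apply: (@le_trans _ _ (k%:R `^ (- p%:R) * k%:R ^+ p)).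
  by rewrite powRN powR_mulrn// mulVf// gt_eqF.
apply: ler_pM => //; rewrite ?powR_ge0 ?(ltW kp0)//.
by apply: ler_powR => //; rewrite lerNl (le_trans _ ap)// -normrN ler_norm.
Qed.

(** The exponent may have either sign, so the least value may occur at either end. *)
Lemma powR_between (v s a : R) : 0 < v -> v <= s <= 2 * v ->
  Num.min (v `^ a) ((2 * v) `^ a) <= s `^ a.
Proof.
move=> v0 /andP[vs s2]; have s0 : 0 < s by exact: lt_le_trans vs.
rewrite ge_min; have [a0|a0] := leP 0 a; apply/orP; [left|right].
  by apply: ge0_ler_powR => //; rewrite nnegrE ltW.
have v20 : 0 < 2 * v by rewrite mulr_gt0.
rewrite -[a]opprK !(powRN _ (- a)) lef_pV2 ?posrE ?powR_gt0//.
by apply: ge0_ler_powR => //; rewrite ?nnegrE ?oppr_ge0 ltW.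
Qed.

Lemma powR_eventually_ge (a M : R) : 0 < a -> 0 < M ->
  exists K, forall k, (K <= k)%N -> M <= k%:R `^ a.
Proof.
move=> a0 M0; exists (Num.truncn (M `^ a^-1)).+1 => k Kk.
have h : M `^ a^-1 <= k%:R.
  by rewrite ltW//; apply: lt_le_trans (truncnS_gt _) _; rewrite ler_nat.
rewrite [leLHS](_ : _ = (M `^ a^-1) `^ a); last first.
  by rewrite -powRrM mulVf ?gt_eqF// powRr1// ltW.
by apply: ge0_ler_powR => //; rewrite ?nnegrE ?powR_ge0 ?(ltW a0).
Qed.

End powR_bounds.

Section closest_return_upper_hoelder.
Context (R : realType) (X : set R) (f : R -> R) (mu : probability (measurableTypeR R) R)
  (rho : R -> R) (hmu : ergodic_acip X f mu) (hhyp : asymptotically_hyperbolic X f mu)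
  (hrho : is_density X mu rho).
Let mX : measurable (X : set (measurableTypeR R)). Proof. by case: hmu. Qed.

(** The series converges for every [e] and [gamma > gamma0] leaves a power of [k] to absorb
    constants, so [lam = 2] and [d = 1 / 2] are precise enough. The radius is chosen to make
    [n k * rad k] equal to [k ^ gamma0], the quantity in the series; over such a radius Hölder
    continuity bounds the oscillation of the density by a polynomial in [k] times a geometric decay,
    which gives [osc]. *)
Lemma closest_return_upper_hoelder (r : nat -> R) (gamma gamma0 : R) :
  uniformly_hoelder X rho -> gamma0 < gamma ->
  (forall e : R, 0 < e -> (\sum_(1 <= k <oo) \int[lebesgue_measure]_(x in X)
     (rho x * expR (- (e * k%:R `^ gamma0 * rho x)))%:E < +oo)%E) ->
  (forall n : nat, (0 < n)%N -> ln n%:R `^ gamma / (2 * n%:R) < r n) ->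
  mu [set x | X x /\ \forall n \near \oo, closest_return f n x < r n] = 1%E.
Proof.
case: hrho => mrho rho0 _ [a [K [/andP[a0 a1] K0 hoel]]] g0g sumE hr.
pose low : R -> R := rho \_ X.
have lowE x : X x -> low x = rho x by move=> Xx; rewrite /low patchE mem_set.
have low0 x : 0 <= low x by rewrite /low patchE; case: ifPn => // /set_mem/rho0.
have mlow : measurable_fun setT (low : measurableTypeR R -> R).
  exact/(measurable_restrictT _ _).1.
pose rad k := k%:R `^ gamma0 / 2 ^+ k : R.
have [p hp] := powR_poly_bounds gamma0.
have two0 k : 0 < 2 ^+ k :> R by rewrite exprn_gt0.
have nrad k : (2 ^ k)%:R * rad k = k%:R `^ gamma0.
  by rewrite /rad natrX mulrCA mulfV ?mulr1// gt_eqF.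
pose y := (2^-1 : R) `^ a.
have yE : y = (2 `^ a)^-1 by rewrite /y -powR_inv1// -powRrM mulN1r powRN.
have y01 : 0 < y < 1.
  rewrite yE invr_gt0 powR_gt0//= invf_lt1 ?powR_gt0//.
  by rewrite /powR gt_eqF// -[ltLHS]expR0 ltr_expR mulr_gt0// ln_gt0// ltr1n.
have e0 : 0 < (2 * K)^-1 by rewrite invr_gt0 mulr_gt0.
have [k1 hk1] := poly_geo_small (2 * p) y01 e0.
have rad_a k : (1 <= k)%N -> rad k `^ a <= k.+1%:R ^+ p * y ^+ k.
  move=> kk; have [_ h] := hp k kk; have t1 : 1 <= k.+1%:R ^+ p :> R by rewrite exprn_ege1// ler1n.
  have r0 : 0 <= rad k by rewrite divr_ge0 ?powR_ge0// ltW.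
  have tp0 : 0 <= k.+1%:R ^+ p :> R by rewrite exprn_ge0.
  apply: (@le_trans _ _ ((k.+1%:R ^+ p * (2^-1) ^+ k) `^ a)).
    have q0 : 0 <= k.+1%:R ^+ p * 2^-1 ^+ k :> R by rewrite mulr_ge0// exprn_ge0.
    apply: ge0_ler_powR; rewrite ?nnegrE ?(ltW a0)//.
    by rewrite /rad -exprVn ler_wpM2r// exprn_ge0.
  rewrite powRM ?exprn_ge0//; apply: ler_pM; rewrite ?powR_ge0//.
    by rewrite -[leRHS](powRr1 tp0); exact: ler_powR.
  by rewrite /y -!powR_mulrn ?powR_ge0// -!powRrM mulrC.
(* For [2 ^ k <= N < 2 ^ k.+1] the quotient [ln N / k] lies between [ln 2] and [2 ln 2], whence the
   minimum; the 4 comes from [2 N <= 4 * 2 ^ k]. *)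
have [k2 hk2] : exists k2, forall k, (k2 <= k)%N ->
    4 / Num.min (ln 2 `^ gamma) ((2 * ln 2) `^ gamma) <= k%:R `^ (gamma - gamma0).
  apply: powR_eventually_ge; first by rewrite subr_gt0.
  by rewrite divr_gt0// lt_min !powR_gt0 ?mulr_gt0 ?ln_gt0// ltr1n.
have [B hB] : exists B, forall N, \sum_(1 <= k < N)
    ex mu (fun x => expR (- (2 * (1 - 2^-1) ^+ 3 * ((2 ^ k)%:R * rad k) * low x))) <= B.
  have q0 : 0 < 2 * (1 - 2^-1) ^+ 3 :> R by rewrite mulr_gt0// exprn_gt0//; lra.
  pose e := 2 * (1 - 2^-1) ^+ 3 : R.
  pose s k := (\int[lebesgue_measure]_(x in X) (rho x * expR (- (e * k%:R `^ gamma0 * rho x)))%:E)%E.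
  have sE k : s k = (ex mu (fun x => expR (- (e * ((2 ^ k)%:R * rad k) * low x))))%:E.
    have b : bmeasurable (fun x : measurableTypeR R => expR (- (e * ((2 ^ k)%:R * rad k) * low x))).
      apply: (@bm_itv _ _ _ _ 0 1) => [|x].
        apply: (measurableT_comp (@measurable_expR R)).
        by apply: (@measurable_funN _ _ _ _ (fun x => _ * low x)); apply: measurable_funM.
      rewrite expR_ge0/= -[leRHS]expR0 ler_expR oppr_le0 mulr_ge0//.
      by rewrite nrad mulr_ge0 ?powR_ge0// ltW.
    rewrite -(density_integral mX hrho b); apply: eq_integral => x /set_mem Xx.
    by rewrite nrad lowE.
  have s0 k : (0 <= s k)%E.
    by rewrite sE lee_fin; apply: ex_ge0 => x; exact: expR_ge0.
  exists (fine (\sum_(1 <= k <oo) s k)%E) => N.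
  rewrite -lee_fin fineK; last first.
    by rewrite ge0_fin_numE ?sumE//; exact: nneseries_ge0.
  rewrite -sumEFin; under eq_bigr do rewrite -sE.
  exact: nneseries_lim_ge.
apply: (@closest_return_upper_of_scales _ _ _ _ _ hmu hhyp hrho r 2 (fun k => (2 ^ k)%N) rad 1 p
  (maxn 1 k1) low 2^-1 B) => //.
- by rewrite ltr1n.
- by move=> k _; rewrite natrX lexx/= ler_peMl ?(ltW (two0 k))// ler1n.
- move=> k; rewrite geq_max => /andP[kk _]; rewrite nrad invr1 mul1r; exact: hp.
- by move=> x /lowE ->.
- by rewrite invr_gt0 ltr0n/= invf_lt1// ltr1n.
- move=> k; rewrite geq_max => /andP[kk k1k] x z Xx Xz xz; rewrite nrad !lowE//.
  have h1 : rho z - rho x <= K * (k.+1%:R ^+ p * y ^+ k).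
    apply: le_trans (ler_norm _) _; rewrite distrC; apply: le_trans (hoel x z Xx Xz) _.
    rewrite ler_wpM2l ?(ltW K0)//; apply: le_trans (rad_a k kk).
    apply: ge0_ler_powR; rewrite ?nnegrE ?(ltW a0)//.
    by rewrite divr_ge0 ?powR_ge0// ltW.
  have := hk1 k k1k; rewrite -[leRHS]mul1r ler_pdivlMr ?mulr_gt0// => h2.
  apply: le_trans h2; have [_ h3] := hp k kk.
  have t0 : 0 <= k.+1%:R ^+ p * y ^+ k.
    by rewrite mulr_ge0 ?exprn_ge0//; case/andP: y01 => /ltW.
  apply: (@le_trans _ _ (2 * k%:R `^ gamma0 * (K * (k.+1%:R ^+ p * y ^+ k)))).
    by rewrite ler_wpM2l// mulr_ge0// powR_ge0.
  apply: (@le_trans _ _ (2 * k.+1%:R ^+ p * (K * (k.+1%:R ^+ p * y ^+ k)))).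
    by rewrite ler_wpM2r ?ler_wpM2l// mulr_ge0// ltW.
  by rewrite mul2n -addnn exprD le_eqVlt; apply/orP; left; apply/eqP; ring.
- move=> N; apply: le_trans (hB N); have [N1|N1] := leqP (maxn 1 k1) N; last first.
    by rewrite big_geq ?(ltnW N1)//; apply: sumr_ge0 => k _; apply: ex_ge0 => x; exact: expR_ge0.
  rewrite [leRHS](big_cat_nat (leq_maxl 1 k1) N1)/= lerDr.
  by apply: sumr_ge0 => k _; apply: ex_ge0 => x; exact: expR_ge0.
exists (maxn 1 k2) => k N; rewrite geq_max => /andP[kk k2k] /andP[kN Nk].
have N0 : (0 < N)%N by apply: leq_trans kN; rewrite expn_gt0.
apply: le_lt_trans (hr N N0).
have v0 : 0 < ln 2 :> R by rewrite ln_gt0// ltr1n.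
have k0 : 0 < k%:R :> R by rewrite ltr0n.
have NR : 0 < N%:R :> R by rewrite ltr0n.
have N2 : N%:R <= 2 * 2 ^+ k :> R by rewrite -exprS -natrX ler_nat ltnW.
have lnN1 : ln 2 <= ln N%:R / k%:R :> R.
  by rewrite ler_pdivlMr// mulr_natr -lnXn// ler_ln ?posrE// -natrX ler_nat.
have lnN2 : ln N%:R / k%:R <= 2 * ln 2 :> R.
  rewrite ler_pdivrMr//; apply: (@le_trans _ _ (k.+1%:R * ln 2)).
    by rewrite mulr_natl -lnXn// ler_ln ?posrE ?exprn_gt0// exprS.
  have : 1 <= k%:R :> R by rewrite ler1n.
  by rewrite -natr1; nra.
set m := Num.min _ _ in hk2.
have m0 : 0 < m by rewrite lt_min !powR_gt0 ?mulr_gt0.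
have ln_ge : m * k%:R `^ gamma <= ln N%:R `^ gamma.
  rewrite -[ln N%:R](divfK (lt0r_neq0 k0)) powRM ?(ltW k0)//; last first.
    by rewrite (le_trans (ltW v0)).
  by rewrite ler_wpM2r ?powR_ge0// powR_between// lnN1.
have := hk2 k k2k; rewrite ler_pdivrMr// => h4.
have kg : k%:R `^ gamma = k%:R `^ gamma0 * k%:R `^ (gamma - gamma0).
  rewrite -powRD; first by rewrite addrC subrK.
  by apply/implyP => _; exact: lt0r_neq0.
rewrite ler_pdivlMr ?mulr_gt0//; apply: le_trans ln_ge; rewrite kg /rad.
apply: (@le_trans _ _ (k%:R `^ gamma0 * 4)).
  rewrite -mulrA ler_wpM2l ?powR_ge0// mulrC ler_pdivrMr//; lra.
by rewrite mulrCA ler_wpM2l ?powR_ge0// mulrC.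
Qed.

End closest_return_upper_hoelder.

(** * Poisson limits *)

Section elementary_bounds.
Context (R : realType).
Implicit Types (a s t z lam : R).

Lemma norm_expRN_sub s t : 0 <= s -> 0 <= t -> `|expR (- s) - expR (- t)| <= `|s - t|.
Proof.
wlog st : s t / s <= t.
  move=> h s0 t0; have [st|/ltW ts] := leP s t; first exact: h.
  by rewrite distrC [leRHS]distrC; exact: h.
move=> s0 t0; rewrite ger0_norm; last by rewrite subr_ge0 ler_expR lerN2.
rewrite ler0_norm ?subr_le0// opprB.
rewrite (_ : expR (- t) = expR (- s) * expR (- (t - s))); last by rewrite -expRD; congr expR; ring.
have e1 : expR (- s) <= 1 by rewrite -[leRHS]expR0 ler_expR oppr_le0.
have e2 : 1 - (t - s) <= expR (- (t - s)) by exact: expR_ge1Dx.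
have := expR_ge0 (- s) => e3.
apply: (@le_trans _ _ (expR (- s) * (t - s))).
  by rewrite -[X in X - _]mulr1 -mulrBr ler_wpM2l//; lra.
by rewrite ler_piMl// subr_ge0.
Qed.

Lemma norm_expr_sub s t m : 0 <= s <= 1 -> 0 <= t <= 1 ->
  `|s ^+ m - t ^+ m| <= m%:R * `|s - t|.
Proof.
move=> /andP[s0 s1] /andP[t0 t1]; elim: m => [|m IH]; first by rewrite !expr0 subrr normr0 mul0r.
rewrite !exprS (_ : _ - _ = s * (s ^+ m - t ^+ m) + (s - t) * t ^+ m); last by ring.
rewrite [leRHS](_ : _ = m%:R * `|s - t| + `|s - t|); last by rewrite -natr1 mulrDl mul1r.
rewrite (le_trans (ler_normD _ _))//; apply: lerD.
  by rewrite normrM (ger0_norm s0) (le_trans _ IH)// ler_piMl.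
by rewrite normrM ler_piMr// ger0_norm ?exprn_ge0// exprn_ile1.
Qed.

(** Two products of [m] factors in [0, 1] are compared factor by factor, and [expR (- a) - (1 - a)]
    is at most [a ^+ 2]. *)
Lemma norm_onem_pow_exp a m : 0 <= a <= 1 ->
  `|(1 - a) ^+ m - expR (- (m%:R * a))| <= m%:R * a ^+ 2.
Proof.
move=> /andP[a0 a1]; rewrite -mulrN mulrC expRM_natr.
apply: le_trans (norm_expr_sub _ _ _) _.
- by apply/andP; split; lra.
- by rewrite expR_ge0/= -[leRHS]expR0 ler_expR oppr_le0.
rewrite ler_wpM2l// distrC ger0_norm; last by rewrite subr_ge0 expR_ge1Dx.
have h1 : expR (- a) * (1 + a) <= 1.
  apply: (@le_trans _ _ (expR (- a) * expR a)).
    by rewrite ler_wpM2l ?expR_ge0// expR_ge1Dx.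
  by rewrite -expRD addNr expR0.
rewrite -(ler_pM2r (_ : 0 < 1 + a)); last by lra.
have : 0 <= a ^+ 2 * a by rewrite mulr_ge0// sqr_ge0.
by rewrite mulrBl !expr2; lra.
Qed.

(** The exponential is the generating function at [z] of the Poisson law with parameter [lam], and
    the terms from [k] on have total mass at most 1, hence sum to at most [z ^+ k]. *)
Lemma exp_series_remainder lam z k : 0 <= lam -> 0 <= z <= 1 ->
  `|expR (- ((1 - z) * lam)) - \sum_(i < k) z ^+ i * (lam ^+ i / i`!%:R * expR (- lam))|
    <= z ^+ k.
Proof.
move=> l0 /andP[z0 z1].
pose S x N := \sum_(i < N) (x ^+ i / i`!%:R) : R.
have SE x N : series (exp_coeff x) N = S x N by rewrite /series/= big_mkord.
have S_le x N : 0 <= x -> S x N <= expR x.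
  move=> x0; rewrite -SE; apply: nondecreasing_cvgn_le; last exact: is_cvg_series_exp_coeff.
  by apply/nondecreasing_seqP => n; rewrite /series/= big_nat_recr//= lerDl exp_coeff_ge0.
have zl0 : 0 <= z * lam by rewrite mulr_ge0.
have S_ge : expR (z * lam) <= S (z * lam) k + z ^+ k * expR lam.
  apply: limr_le; first exact: is_cvg_series_exp_coeff.
  near=> N; rewrite SE.
  have kN : (k <= N)%N by near: N; exists k.
  have zk : 0 <= z ^+ k by rewrite exprn_ge0.
  apply: (@le_trans _ _ (S (z * lam) k + z ^+ k * S lam N)); last first.
    by rewrite lerD2l ler_wpM2l// S_le.
  rewrite /S -!(big_mkord xpredT (fun i => _ ^+ i / i`!%:R)).
  rewrite (big_cat_nat (leq0n k) kN)/= lerD2l mulr_sumr (big_cat_nat (leq0n k) kN)/=.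
  rewrite -[leLHS]add0r; apply: lerD.
    by apply: sumr_ge0 => i _; rewrite mulr_ge0// divr_ge0// exprn_ge0.
  rewrite big_nat_cond [leRHS]big_nat_cond; apply: ler_sum => i /andP[/andP[ki _] _].
  rewrite exprMn mulrA ler_wpM2r ?invr_ge0// ler_wpM2r ?exprn_ge0//.
  exact: ler_wiXn2l.
have -> : expR (- ((1 - z) * lam)) - \sum_(i < k) z ^+ i * (lam ^+ i / i`!%:R * expR (- lam))
    = (expR (z * lam) - S (z * lam) k) * expR (- lam).
  rewrite [RHS]mulrBl -expRD; congr (expR _ - _); first by ring.
  by rewrite /S mulr_suml; apply: eq_bigr => i _; rewrite exprMn; ring.
rewrite ger0_norm; last by rewrite mulr_ge0 ?expR_ge0// subr_ge0 S_le.
rewrite -[leRHS]mulr1 -(expRxMexpNx_1 lam) mulrA ler_wpM2r ?expR_ge0//.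
by rewrite lerBlDl.
Unshelve. all: by end_near. Qed.

Lemma pow_series_remainder z k j : 0 <= z <= 1 ->
  `|z ^+ j - \sum_(i < k) z ^+ i * (j == i)%:R| <= z ^+ k.
Proof.
move=> /andP[z0 z1]; have [jk|kj] := ltnP j k.
  rewrite (bigD1 (Ordinal jk))//= eqxx mulr1 big1 ?addr0 ?subrr ?normr0 ?exprn_ge0//.
  by move=> i /eqP ij; case: eqP => [ji|_]; rewrite ?mulr0//; exfalso; apply: ij; exact: val_inj.
rewrite big1 ?subr0; last first.
  by move=> i _; rewrite gtn_eqF ?mulr0// (leq_trans (ltn_ord i)).
by rewrite ger0_norm ?exprn_ge0//; exact: ler_wiXn2l.
Qed.

(** Coefficients are recovered one after the other from values of [z] near 0: when those below [k]
    converge, dividing by [z ^+ k] isolates the next one up to an error of order [z]. *)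
Lemma pgf_cvg (p : nat -> nat -> R) (q : nat -> R) (E : R -> nat -> R) (G : R -> R) :
  (forall z, 0 < z < 1 -> E z n @[n --> \oo] --> G z) ->
  (forall z k n, 0 < z < 1 -> `|E z n - \sum_(i < k) z ^+ i * p n i| <= z ^+ k) ->
  (forall z k, 0 < z < 1 -> `|G z - \sum_(i < k) z ^+ i * q i| <= z ^+ k) ->
  forall k, p n k @[n --> \oo] --> q k.
Proof.
move=> EG Ep Gq k; elim/ltn_ind: k => k IH.
have sumc z k' : (k' <= k)%N -> (\sum_(i < k') z ^+ i * p n i) @[n --> \oo] -->
    \sum_(i < k') z ^+ i * q i.
  elim: k' => [|k' IH'] kk; first by rewrite big_ord0; under eq_fun do rewrite big_ord0; exact: cvg_cst.
  rewrite big_ord_recr/=; under eq_fun do rewrite big_ord_recr/=.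
  by apply: cvgD; [exact: IH' (ltnW kk)|apply: cvgMr; exact: IH].
apply/cvgrPdist_le => e e0.
(* Four errors add up, each at most [e / 4 * z ^+ k]; two of them are remainders [z ^+ k.+1], which
   is why [z <= e / 4]. *)
pose z := Num.min (1 / 2) (e / 4).
have z0 : 0 < z by rewrite lt_min divr_gt0// divr_gt0.
have z1 : z < 1 by rewrite gt_min; apply/orP; left; lra.
have ze : z <= e / 4 by rewrite ge_min lexx orbT.
have z01 : 0 < z < 1 by rewrite z0.
have zk : 0 < z ^+ k by rewrite exprn_gt0.
have e4 : 0 < e / 4 * z ^+ k by rewrite mulr_gt0// divr_gt0.
have /cvgrPdist_le/(_ _ e4) h1 := EG z z01.
have /cvgrPdist_le/(_ _ e4) h2 := sumc z k (leqnn k).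
near=> n.
have a1 : `|G z - E z n| <= e / 4 * z ^+ k by near: n.
have a2 : `|\sum_(i < k) z ^+ i * q i - \sum_(i < k) z ^+ i * p n i| <= e / 4 * z ^+ k by near: n.
have a3 := Ep z k.+1 n z01; have a4 := Gq z k.+1 z01.
rewrite !big_ord_recr/= in a3 a4.
set s1 := \sum_(i < k) _ in a2 a4; set s2 := \sum_(i < k) _ in a2 a3.
rewrite -(ler_pM2l zk) -{1}(ger0_norm (ltW zk)) -normrM.
have b : z ^+ k.+1 <= e / 4 * z ^+ k by rewrite exprS ler_wpM2r// ltW.
move: a1 a2 a3 a4; rewrite !ler_norml mulrBr.
move: (z ^+ k * q k) (z ^+ k * p n k) => u v /andP[a1 a1'] /andP[a2 a2'] /andP[a3 a3'] /andP[a4 a4'].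
by apply/andP; split; lra.
Unshelve. all: by end_near. Qed.

End elementary_bounds.

Lemma pr_limsup_sub0 d (T : measurableType d) (R : realType) (P : probability T R)
    (A : nat -> set T) (B : set T) : (forall n, measurable (A n)) -> measurable B ->
  pr P B = 0 -> lim_sup_set A `<=` B -> (pr P (A n)) @[n --> \oo] --> (0 : R).
Proof.
move=> mA mB B0 AB; apply: pr_limsup0 => //; apply/eqP; rewrite eq_le pr_ge0 andbT -B0.
apply: le_pr => //; apply: bigcap_measurableType => n _.
by apply: bigcup_measurable => k _.
Qed.

Lemma cvgD0 (R : realType) (u v : nat -> R) : u n @[n --> \oo] --> (0 : R) ->
  v n @[n --> \oo] --> (0 : R) -> (u n + v n) @[n --> \oo] --> (0 : R).
Proof. move=> hu hv; have h := cvgD hu hv; rewrite addr0 in h; exact: h. Qed.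

Lemma cvgMr0 (R : realType) (c : R) (u : nat -> R) : u n @[n --> \oo] --> (0 : R) ->
  (c * u n) @[n --> \oo] --> (0 : R).
Proof. move=> hu; have h := cvgM (cvg_cst c) hu; rewrite mulr0 in h; exact: h. Qed.

Lemma cvg_sum0 (R : realType) (s : seq nat) (u : nat -> nat -> R) :
  (forall g, g \in s -> u g n @[n --> \oo] --> (0 : R)) ->
  (\sum_(g <- s) u g n) @[n --> \oo] --> (0 : R).
Proof.
elim: s => [_|g s IH us]; first by under eq_fun do rewrite big_nil; exact: cvg_cst.
under eq_fun do rewrite big_cons; apply: cvgD0.
  by apply: us; rewrite mem_head.
by apply: IH => h hs; apply: us; rewrite inE hs orbT.
Qed.

Lemma near_le0 (R : realType) (u : nat -> R) (e : R) : u n @[n --> \oo] --> (0 : R) ->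
  0 < e -> \forall n \near \oo, u n <= e.
Proof.
move=> /cvgrPdist_le h e0; apply: filterS (h _ e0) => n.
by rewrite sub0r normrN => /(le_trans (ler_norm _)).
Qed.

Lemma cvg0_le (R : realType) (u : nat -> R) : (forall n, 0 <= u n) ->
  (forall e, 0 < e -> \forall n \near \oo, u n <= e) -> u n @[n --> \oo] --> (0 : R).
Proof.
move=> u0 h; apply/cvgrPdist_le => e e0; apply: filterS (h e e0) => n.
by rewrite sub0r normrN ger0_norm.
Qed.

(** * Radii of order 1 / n *)

Section poisson_scale.
Context (R : realType) (mu : probability (measurableTypeR R) R) (f : R -> R)
  (mf : measurable_fun setT (f : measurableTypeR R -> measurableTypeR R))
  (pf : forall A : set (measurableTypeR R), measurable A -> mu (f @^-1` A) = mu A)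
  (ef : forall A : set (measurableTypeR R), measurable A -> f @^-1` A = A ->
    pr mu A = 0 \/ pr mu A = 1)
  (Y : set R) (P : probability (measurableTypeR R) R) (T : R -> R) (C th H : R)
  (ind : induced mu f Y P T C th H).
Context (tau : R) (tau0 : 0 < tau).
Implicit Types (A B : set (measurableTypeR R)).

Let ms := ind_ms ind.
Let mT := ms_meas ms.
Let mY := ind_mY ind.
Let y0 := pr mu Y.
Let ypos : 0 < y0 := ind_pos ind.
Let mi := @measurable_itvR R.
Let C0 : 0 <= C := ms_C ms.
Let H0 : 0 <= H := ms_H ms.
Let th01 : 0 < th < 1 := ms_th ms.

Definition prad (n : nat) : R := tau / (2 * n%:R).

Lemma prad_ge0 n : 0 <= prad n. Proof. by rewrite divr_ge0 ?mulr_ge0// ltW. Qed.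

Lemma prad_gt0 n : (0 < n)%N -> 0 < prad n.
Proof. by move=> n0; rewrite divr_gt0// mulr_gt0// ltr0n. Qed.

Lemma n_prad n : (0 < n)%N -> n%:R * prad n = tau / 2.
Proof. by move=> n0; rewrite /prad; field; rewrite pnatr_eq0 -lt0n. Qed.

Lemma n_prad_le n : n%:R * prad n <= tau / 2.
Proof. by case: n => [|n]; [rewrite mul0r divr_ge0// ltW|rewrite n_prad]. Qed.

Lemma prad_cvg0 : prad n @[n --> \oo] --> (0 : R).
Proof.
apply: cvg0_le => [|e e0]; first exact: prad_ge0.
exists (Num.truncn (tau / e)).+1 => // n /= hn.
have n0 : (0 < n)%N by apply: leq_trans hn.
rewrite /prad ler_pdivrMr ?mulr_gt0 ?ltr0n//.
have : tau / e < n%:R by apply: lt_le_trans (truncnS_gt _) _; rewrite ler_nat.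
by rewrite ltr_pdivrMr// => h; have := tau0; nra.
Qed.

Lemma prad_cvgM c : c * prad n @[n --> \oo] --> (0 : R).
Proof. by apply: cvgMr0; exact: prad_cvg0. Qed.

Lemma near_prad_gt0 : \forall n \near \oo, (0 < n)%N.
Proof. by exists 1%N. Qed.

Let limsup_close (h : nat -> R -> R) c x :
  lim_sup_set (fun n => [set x | `|h n x - x| <= c * prad n]) x ->
  forall e, 0 < e -> exists n, `|h n x - x| <= e.
Proof.
move=> Lx e e0; have [N _ hN] := near_le0 (prad_cvgM c) e0.
by have [n /= Nn hn] := Lx N Logic.I; exists n; rewrite (le_trans hn)// hN.
Qed.

(** A point in infinitely many of these sets is fixed by the iterate number [g], and periodic points
    are null. No rate results, and none is needed for a limit in distribution. *)
Lemma near_return_cvg0 g c : (0 < g)%N ->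
  pr P (near_return T g (c * prad n)) @[n --> \oo] --> (0 : R).
Proof.
move=> g0; apply: (@pr_limsup_sub0 _ (measurableTypeR R) R P (fun n => near_return T g (c * prad n)) (near_return T g 0)).
- by move=> n; exact: (measurable_near_return ms).
- exact: (measurable_near_return ms).
- rewrite (_ : near_return T g 0 = [set x | iter g T x = x]); first exact: (pr_periodic ms).
  by apply/seteqP; split => x; rewrite /near_return/= normr_le0 subr_eq0 => /eqP.
move=> x Lx; rewrite /near_return/=; apply/ler_addgt0Pl => e e0; rewrite addr0.
by have [n] := limsup_close Lx e0.
Qed.

Lemma f_return_cvg0 j : (0 < j)%N ->
  pr mu (Y `&` [set x | `|iter j f x - x| <= prad n]) @[n --> \oo] --> (0 : R).
Proof.
move=> j0; pose B : set (measurableTypeR R) := Y `&` \bigcup_p [set x | iter p.+1 f x = x].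
have mc r : measurable ([set x | `|iter j f x - x| <= r] : set (measurableTypeR R)).
  by apply: measurable_close; [exact: measurable_iter|exact: measurable_id].
apply: (@pr_limsup_sub0 _ _ _ _ _ B).
- by move=> n; exact: measurableI.
- apply: measurableI => //; apply: bigcupT_measurable => p.
  rewrite (_ : [set _ | _] = [set x | `|iter p.+1 f x - x| <= 0]).
    by apply: measurable_close; [exact: measurable_iter|exact: measurable_id].
  by apply/seteqP; split => x; rewrite /= normr_le0 subr_eq0 => /eqP.
- exact: (periodic_null mf ind).
move=> x Lx; split; first by have [n _ []] := Lx 0%N Logic.I.
exists j.-1 => //=; rewrite -iterS prednK//; apply/eqP; rewrite -subr_eq0 -normr_le0.
apply/ler_addgt0Pl => e e0; rewrite addr0.
have [N _ hN] := near_le0 prad_cvg0 e0.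
by have [n /= Nn [_ hn]] := Lx N Logic.I; rewrite (le_trans hn)// hN.
Qed.

Lemma few_visits_cvg0 M :
  pr mu [set x | (visits f Y n x < M)%N] @[n --> \oo] --> (0 : R).
Proof.
pose B := lim_sup_set (freq_dev mu f Y (y0 / 2)).
have mB : measurable (B : set (measurableTypeR R)).
  apply: bigcap_measurableType => k _; apply: bigcup_measurable => j _.
  exact: (measurable_freq_dev mu mf).
apply: (@pr_limsup_sub0 _ (measurableTypeR R) R mu (fun n => [set x | (visits f Y n x < M)%N]) B) => //.
- move=> n; rewrite (_ : [set _ | _] = ~` [set x | M%:R <= (visits f Y n x)%:R :> R]).
    by apply: measurableC; exact: measurable_visits_ge.
  by apply/seteqP; split => x /=; rewrite ler_nat ltnNge => /negP.
- exact: (few_visits_null mf pf ef ind).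
move=> x Lx; apply: contrapT => nB.
have [K hK] := visits_unbounded ind M nB.
by have [n /= /hK] := Lx K Logic.I; rewrite leqNgt => /negP.
Qed.

(** A gap of order sqrt n makes both [pgap n * prad n] and the mixing error [n * th ^+ pgap n] tend
    to 0. Short returns are treated without (A2), so its range of times is no constraint here. *)
Definition pgap (n : nat) : nat := Num.truncn (Num.sqrt (n%:R : R)).

Lemma pgap_sq n : (pgap n)%:R ^+ 2 <= n%:R :> R.
Proof.
rewrite -[leRHS](@sqr_sqrtr _ n%:R)//; apply: le_expr => //.
by rewrite truncn_le sqrtr_ge0.
Qed.

Lemma pgap_lt n : n.+1%:R <= (pgap n).+1%:R ^+ 2 :> R.
Proof.
rewrite -natrX ler_nat -(ltr_nat R) natrX -[ltLHS](@sqr_sqrtr _ n%:R)//.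
rewrite ltr_pXn2r// ?nnegrE ?sqrtr_ge0//; exact: truncnS_gt.
Qed.

Lemma pgap_large k : \forall n \near \oo, (k <= pgap n)%N.
Proof.
exists (k ^ 2)%N => // n /= kn; rewrite -ltnS -(ltr_nat R).
rewrite -(ltr_pXn2r (n := 2))// ?nnegrE//; apply: lt_le_trans (pgap_lt n).
by rewrite -natrX ltr_nat ltnS.
Qed.

Lemma pgap_prad : (pgap n)%:R * prad n @[n --> \oo] --> (0 : R).
Proof.
apply: cvg0_le => [n|e e0]; first by rewrite mulr_ge0 ?prad_ge0.
have e20 : 0 < e ^+ 2 by rewrite exprn_gt0.
have := near_le0 (prad_cvgM (tau / 2)) e20; apply: filterS => n hn.
rewrite -(ler_pXn2r (n := 2))// ?nnegrE ?mulr_ge0 ?prad_ge0 ?(ltW e0)//; last exact: ltW.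
apply: le_trans hn; rewrite exprMn expr2 [X in _ * X]expr2.
apply: (@le_trans _ _ (n%:R * (prad n * prad n))).
  apply: ler_wpM2r; first by rewrite mulr_ge0 ?prad_ge0.
  by rewrite -expr2; exact: pgap_sq.
by rewrite mulrA ler_wpM2r ?prad_ge0// n_prad_le.
Qed.

(** The sum is split at a fixed time: each of the finitely many early terms tends to 0, and the late
    ones are bounded by mixing, with a geometric tail and a total of order [pgap n * prad n]. *)
Lemma sum_near_return_cvg0 :
  (\sum_(g <- iota 1 (pgap n)) pr P (near_return T g (3 * prad n))) @[n --> \oo] --> (0 : R).
Proof.
apply: cvg0_le => [n|e e0]; first by apply: sumr_ge0 => g _; exact: pr_ge0.
have e8 : 0 < e / 16 by rewrite divr_gt0.
have [M0 hM0] := sum_Cth_small ms e8.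
have e2 : 0 < e / 4 by rewrite divr_gt0.
have h1 : \forall n \near \oo,
    \sum_(g <- iota 1 M0) pr P (near_return T g (3 * prad n)) <= e / 4.
  apply: near_le0 => //; apply: cvg_sum0 => g; rewrite mem_iota => /andP[g0 _].
  exact: near_return_cvg0.
have h2 : \forall n \near \oo, 12 * H * ((pgap n)%:R * prad n) <= e / 4.
  by apply: near_le0 => //; apply: cvgMr0; exact: pgap_prad.
near=> n.
have n0 : (0 < n)%N by near: n; exact: near_prad_gt0.
have r0 : 0 < 3 * prad n by rewrite mulr_gt0// prad_gt0.
have a1 : \sum_(g <- iota 1 M0) pr P (near_return T g (3 * prad n)) <= e / 4.
  by near: n; exact: h1.
have a2 : 12 * H * ((pgap n)%:R * prad n) <= e / 4 by near: n; exact: h2.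
set u := fun g => pr P (near_return T g (3 * prad n)) in a1 *.
have u0 g : 0 <= u g by exact: pr_ge0.
have s0 (s : seq nat) : 0 <= \sum_(g <- s) u g by apply: sumr_ge0.
apply: (@le_trans _ _ (\sum_(g <- iota 1 M0) u g + \sum_(g <- iota M0.+1 (pgap n - M0)) u g)).
  have [qM|/ltnW Mq] := leqP (pgap n) M0.
    rewrite -[in leRHS](subnKC qM) (iotaD 1) big_cat/= -addrA lerDl addr_ge0//.
  by rewrite -[in leLHS](subnKC Mq) (iotaD 1) big_cat/= add1n.
have a3 : \sum_(g <- iota M0.+1 (pgap n - M0)) u g <= 12 * H * ((pgap n)%:R * prad n) + e / 4.
  apply: (@le_trans _ _ (\sum_(g <- iota M0.+1 (pgap n - M0)) (12 * H * prad n + 4 * (C * th ^+ g)))).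
    apply: ler_sum => g _; apply: le_trans (pr_near_return_le ms g r0) _.
    by rewrite mulrDr le_eqVlt; apply/orP; left; apply/eqP; ring.
  rewrite big_split/= -mulr_sumr sum_iota_const; apply: lerD.
    rewrite ler_wpM2l ?mulr_ge0//.
    by rewrite ler_wpM2r ?prad_ge0// ler_nat leq_subr.
  by rewrite -mulr_sumr; have := hM0 M0.+1 (pgap n - M0)%N (leqnSn _); lra.
lra.
Unshelve. all: by end_near. Qed.

Lemma tot_err_cvg0 (B e : R) : 0 <= B -> 0 < e ->
  \forall n \near \oo, forall M m, (m <= n)%N -> M%:R <= B / prad n + 1 ->
    tot_err P T C th H (pgap n) m M (prad n) <= e.
Proof.
move=> B0 e0.
have e4 : 0 < e / 4 by rewrite divr_gt0.
pose c2 := (2 * B / tau + 2) * C.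
have c20 : 0 <= c2 by rewrite mulr_ge0// addr_ge0// divr_ge0 ?mulr_ge0// ltW.
have c2p : 0 < e / 4 / (c2 + 1) by rewrite divr_gt0// ltr_wpDl.
have [k0 hk0] := poly_geo_small 2 th01 c2p.
have h1 : \forall n \near \oo, (1 + 2 * tau * H) *
    \sum_(g <- iota 1 (pgap n)) pr P (near_return T g (3 * prad n)) <= e / 4.
  apply: near_le0 => //; apply: cvgMr0; exact: sum_near_return_cvg0.
have h3 : \forall n \near \oo, 3 * H * ((pgap n)%:R * prad n) <= e / 4.
  by apply: near_le0 => //; apply: cvgMr0; exact: pgap_prad.
have h4 : \forall n \near \oo, 9 * H ^+ 2 * (tau / 2) * ((pgap n)%:R * prad n) <= e / 4.
  apply: near_le0 => //; apply: cvgMr0; exact: pgap_prad.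
near=> n => M m mn hM.
have n0 : (0 < n)%N by near: n; exact: near_prad_gt0.
have r0 := prad_gt0 n0.
have mr : m%:R * prad n <= tau / 2.
  by apply: le_trans (n_prad_le n); rewrite ler_wpM2r ?ler_nat// ltW.
have a1 : (1 + 2 * tau * H) *
    \sum_(g <- iota 1 (pgap n)) pr P (near_return T g (3 * prad n)) <= e / 4 by near: n; exact: h1.
have a3 : 3 * H * ((pgap n)%:R * prad n) <= e / 4 by near: n; exact: h3.
have a4 : 9 * H ^+ 2 * (tau / 2) * ((pgap n)%:R * prad n) <= e / 4 by near: n; exact: h4.
have b1 : (1 + 4 * m%:R * H * prad n) *
    \sum_(g <- iota 1 (pgap n)) pr P (near_return T g (3 * prad n)) <= e / 4.
  apply: le_trans a1; apply: ler_wpM2r; first by apply: sumr_ge0 => g _; exact: pr_ge0.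
  rewrite lerD2l [leLHS](_ : _ = 4 * H * (m%:R * prad n)); last by ring.
  rewrite [leRHS](_ : _ = 4 * H * (tau / 2)); last by field.
  by rewrite ler_wpM2l// mulr_ge0.
have b2 : (M%:R + m%:R) * (C * th ^+ pgap n) <= e / 4.
  have q0 : (k0 <= pgap n)%N by near: n; exact: pgap_large.
  have th0 : 0 <= th ^+ pgap n by exact: (ms_th0 ms).
  have Br : B / prad n = 2 * B / tau * n%:R.
    by rewrite /prad; field; rewrite gt_eqF// pnatr_eq0 -lt0n.
  have Mm : M%:R + m%:R <= (2 * B / tau + 2) * n.+1%:R.
    have mn' : m%:R <= n%:R :> R by rewrite ler_nat.
    have bt : 0 <= 2 * B / tau by rewrite divr_ge0 ?mulr_ge0// ltW.
    by rewrite Br in hM; rewrite -natr1; move: hM bt; set b := 2 * B / tau => hM bt; have := ler0n R n; lra.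
  apply: (@le_trans _ _ (c2 * (n.+1%:R * th ^+ pgap n))).
    rewrite (_ : c2 * _ = (2 * B / tau + 2) * n.+1%:R * (C * th ^+ pgap n)); last by rewrite /c2; ring.
    by rewrite ler_wpM2r// mulr_ge0.
  apply: (@le_trans _ _ ((c2 + 1) * ((pgap n).+1%:R ^+ 2 * th ^+ pgap n))).
    by apply: ler_pM => //; rewrite ?mulr_ge0// ?lerDl// ler_wpM2r// pgap_lt.
  rewrite mulrC -ler_pdivlMr ?ltr_wpDl//; exact: hk0.
have b3 : 3 * H * (pgap n)%:R * prad n <= e / 4 by rewrite -mulrA.
have b4 : 9 * H ^+ 2 * m%:R * (pgap n)%:R * prad n ^+ 2 <= e / 4.
  apply: le_trans a4.
  rewrite [leLHS](_ : _ = 9 * H ^+ 2 * (m%:R * prad n) * ((pgap n)%:R * prad n)); last by ring.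
  apply: ler_wpM2r; first by rewrite mulr_ge0// ltW.
  by apply: ler_wpM2l => //; rewrite mulr_ge0// exprn_ge0.
by rewrite /tot_err; lra.
Unshelve. all: by end_near. Qed.

(** A window of about [2 d n] late times, each with a return of probability of order [H * prad n],
    has a total of order [H tau d]. It will bridge the fluctuation of the number of visits to [Y]
    around its mean. *)
Lemma window_return_small e : 0 < e -> exists2 d, 0 < d < y0 &
  \forall n \near \oo, forall a b, (y0 - d) * n%:R - 1 <= a%:R -> (a <= b)%N ->
    b%:R <= (y0 + d) * n%:R + 1 ->
    \sum_(j <- iota a.+1 (b - a)) pr P (near_return T j (prad n)) <= e.
Proof.
move=> e0; pose d := Num.min (y0 / 2) (e / 4 / (4 * H * tau + 1)).
have D0 : 0 < 4 * H * tau + 1 by rewrite ltr_wpDl// !mulr_ge0// ltW.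
have d0 : 0 < d by rewrite lt_min !divr_gt0.
have dy : d <= y0 / 2 by rewrite ge_min lexx.
have dH : 4 * H * tau * d <= e / 4.
  have : d <= e / 4 / (4 * H * tau + 1) by rewrite ge_min lexx orbT.
  by rewrite ler_pdivlMr// => h; nra.
exists d; first by apply/andP; split => //; have := ypos; lra.
have e16 : 0 < e / 16 by rewrite divr_gt0.
have [M0 hM0] := sum_Cth_small ms e16.
have h8 : \forall n \near \oo, 8 * H * prad n <= e / 4.
  by apply: near_le0; [exact: prad_cvgM|rewrite divr_gt0].
near=> n => a b ha ab hb.
have n0 : (0 < n)%N by near: n; exact: near_prad_gt0.
have r0 := prad_gt0 n0.
have a8 : 8 * H * prad n <= e / 4 by near: n; exact: h8.
have Ma : (M0 <= a.+1)%N.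
  rewrite -(ler_nat R) -natr1; apply: (@le_trans _ _ ((y0 - d) * n%:R)); last by lra.
  apply: (@le_trans _ _ (y0 / 2 * n%:R)); last by rewrite ler_wpM2r//; lra.
  rewrite mulrC -ler_pdivrMr ?divr_gt0//; near: n.
  exists (Num.truncn (M0%:R / (y0 / 2))).+1 => // k /= hk.
  by rewrite ltW//; apply: lt_le_trans (truncnS_gt _) _; rewrite ler_nat.
have ba : (b - a)%:R <= 2 * d * n%:R + 2 by rewrite natrB//; lra.
apply: (@le_trans _ _ (\sum_(j <- iota a.+1 (b - a)) (4 * H * prad n + 4 * (C * th ^+ j)))).
  apply: ler_sum => j _; apply: le_trans (pr_near_return_le ms j r0) _.
  by rewrite mulrDr mulrA.
rewrite big_split/= sum_iota_const -mulr_sumr.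
have := hM0 _ (b - a)%N Ma; set S := \sum_(i <- _) _ => hS.
have hr : (b - a)%:R * (4 * H * prad n) <= 4 * H * tau * d + 8 * H * prad n.
  apply: (@le_trans _ _ ((2 * d * n%:R + 2) * (4 * H * prad n))).
    by rewrite ler_wpM2r// !mulr_ge0// ltW.
  rewrite [leLHS](_ : _ = 8 * H * d * (n%:R * prad n) + 8 * H * prad n); last by ring.
  by rewrite n_prad//; lra.
lra.
Unshelve. all: by end_near. Qed.

End poisson_scale.

Definition local_density (R : realType) (mu : probability (measurableTypeR R) R) (Y : set R)
    (low : R -> R) : Prop :=
  exists N0 : set (measurableTypeR R), [/\ measurable N0, pr mu N0 = 0 &
    forall x (e : R), Y x -> ~ N0 x -> 0 < e -> exists2 c : R, 0 < c & forall r : R, 0 < r < c ->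
      `|pr mu (ball (x : R) r `&` Y) - 2 * r * low x| <= e * r /\
      pr mu (ball (x : R) r `&` ~` Y) <= e * r].

(** * Uniformity of the density asymptotics *)

Section uniform_sets.
Context (R : realType) (mu : probability (measurableTypeR R) R) (Y : set R)
  (mY : measurable (Y : set (measurableTypeR R))) (low : R -> R)
  (mlow : measurable_fun setT (low : measurableTypeR R -> R))
  (dens : local_density mu Y low)
  (tau : R) (tau0 : 0 < tau) (d delta : R) (d0 : 0 < d) (d1 : d < 1) (delta0 : 0 < delta).

Let r := prad tau.

(** For cells of length [d * r n], the ball of radius [(1 - d) * r n] around a point of the cell
    lies in the thin cell, and the one of radius [(1 + 2 * d) * r n] contains the fat cell, whose
    points are within [(1 + d) * r n]. *)
Definition typical (n : nat) : set R := [set x | [/\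
  `|pr mu (ball (x : R) ((1 - d) * r n) `&` Y) - 2 * ((1 - d) * r n) * low x| <= delta * r n,
  `|pr mu (ball (x : R) ((1 + 2 * d) * r n) `&` Y) - 2 * ((1 + 2 * d) * r n) * low x|
    <= delta * r n &
  pr mu (ball (x : R) ((1 + 2 * d) * r n) `&` ~` Y) <= delta * r n]].

Definition uniformly_typical (N : nat) : set R := [set x | [/\ Y x, - N%:R <= x < N%:R &
  forall n, (N <= n)%N -> (0 < n)%N -> typical n x]].

Let measurable_pr_ball (B : set (measurableTypeR R)) w : measurable B ->
  measurable_fun setT (fun x : measurableTypeR R => pr mu (ball (x : R) w `&` B)).
Proof.
move=> mB; apply: (measurableT_comp (@fine_measurable R setT measurableT)) => //.
exact: measurable_ball_measureI.
Qed.

Let measurable_le_cst (g : measurableTypeR R -> R) c : measurable_fun setT g ->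
  measurable ([set x | g x <= c] : set (measurableTypeR R)).
Proof.
move=> mg; rewrite (_ : [set _ | _] = g @^-1` `]-oo, c]).
  by rewrite -[X in measurable X]setTI; exact: (mg measurableT _ (measurable_itv _)).
by apply/seteqP; split => x /=; rewrite in_itv.
Qed.

Let measurable_typical n : measurable (typical n : set (measurableTypeR R)).
Proof.
have mdev w : measurable_fun setT
    (fun x : measurableTypeR R => `|pr mu (ball (x : R) w `&` Y) - 2 * w * low x|).
  apply: measurableT_comp => //; apply: measurable_funB; first exact: measurable_pr_ball.
  exact: measurable_funM.
rewrite (_ : typical n =
  [set x | `|pr mu (ball (x : R) ((1 - d) * r n) `&` Y) - 2 * ((1 - d) * r n) * low x|
     <= delta * r n] `&`
  [set x | `|pr mu (ball (x : R) ((1 + 2 * d) * r n) `&` Y) - 2 * ((1 + 2 * d) * r n) * low x|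
     <= delta * r n] `&`
  [set x | pr mu (ball (x : R) ((1 + 2 * d) * r n) `&` ~` Y) <= delta * r n]).
  apply: measurableI; first by apply: measurableI; apply: measurable_le_cst; exact: mdev.
  by apply: measurable_le_cst; apply: measurable_pr_ball; exact: measurableC.
by apply/seteqP; split => x; [case|move=> [[]]]; split.
Qed.

Lemma measurable_uniformly_typical N :
  measurable (uniformly_typical N : set (measurableTypeR R)).
Proof.
rewrite (_ : uniformly_typical N = Y `&` `[- N%:R, N%:R[ `&`
    \bigcap_(n in [set n | (N <= n)%N /\ (0 < n)%N]) typical n).
  apply: measurableI; last by apply: bigcap_measurableType => n _; exact: measurable_typical.
  by apply: measurableI => //; exact: measurable_itv.
apply/seteqP; split => x.
  by move=> [Yx xN h]; split => [|n []]; [split => //=; rewrite in_itv|exact: h].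
by move=> [[Yx /=]]; rewrite in_itv/= => xN h; split => // n Nn n0; exact: h.
Qed.

(** An Egorov type statement: at almost every point of [Y] the asymptotics hold from some index on,
    so for a fixed tolerance they hold uniformly off a set of small measure. *)
Lemma uniformly_typical_cvg :
  pr mu (Y `\` uniformly_typical N) @[N --> \oo] --> (0 : R).
Proof.
have [N0 [mN0 N00 hN0]] := dens.
apply: (@pr_limsup_sub0 _ (measurableTypeR R) R mu (fun N => Y `\` uniformly_typical N) N0) => //.
  by move=> N; apply: measurableD => //; exact: measurable_uniformly_typical.
move=> x Lx; apply: contrapT => nx.
have Yx : Y x by have [n _ []] := Lx 0%N Logic.I.
have e0 : 0 < delta / 3 by rewrite divr_gt0.
have [c c0 hc] := hN0 x _ Yx nx e0.
have c3 : 0 < c / 6 by rewrite divr_gt0.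
have [K _ hK] := near_le0 (prad_cvg0 tau0) c3.
pose N := maxn K (Num.truncn `|x|).+1.
have good n : (N <= n)%N -> uniformly_typical n x.
  move=> Nn; split => //.
    have h1 : `|x| < n%:R.
      apply: lt_le_trans (truncnS_gt _) _; rewrite ler_nat (leq_trans _ Nn)//.
      exact: leq_maxr.
    have := ler_norm x; have := ler_norm (- x); rewrite normrN => h2 h3.
    by apply/andP; split; lra.
  move=> k nk k0; have rk : 0 < r k by exact: prad_gt0.
  have rc : r k <= c / 6.
    by apply: hK; rewrite /= (leq_trans _ nk)// (leq_trans _ Nn)// leq_maxl.
  have key w : 0 < w <= 3 * r k -> `|pr mu (ball (x : R) w `&` Y) - 2 * w * low x| <= delta * r k /\
      pr mu (ball (x : R) w `&` ~` Y) <= delta * r k.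
    move=> /andP[w0 w3]; have wc : 0 < w < c by rewrite w0/=; lra.
    have dw : delta / 3 * w <= delta * r k.
      by rewrite -mulrA ler_wpM2l ?(ltW delta0)//; lra.
    by have [h1 h2] := hc w wc; split; [exact: le_trans h1 dw|exact: le_trans h2 dw].
  have dr : 0 < d * r k by rewrite mulr_gt0.
  have dr1 : d * r k < r k by rewrite gtr_pMl.
  have w1 : 0 < (1 - d) * r k <= 3 * r k by apply/andP; split; lra.
  have w2 : 0 < (1 + 2 * d) * r k <= 3 * r k by apply/andP; split; lra.
  by split; [exact: (key _ w1).1|exact: (key _ w2).1|exact: (key _ w2).2].
by have [n /= Nn [_]] := Lx N Logic.I; apply; exact: good.
Qed.

End uniform_sets.

(** * Close returns outside the induced set *)

Section escape.
Context (R : realType) (mu : probability (measurableTypeR R) R) (f : R -> R)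
  (mf : measurable_fun setT (f : measurableTypeR R -> measurableTypeR R))
  (pf : forall A : set (measurableTypeR R), measurable A -> mu (f @^-1` A) = mu A)
  (ef : forall A : set (measurableTypeR R), measurable A -> f @^-1` A = A ->
    pr mu A = 0 \/ pr mu A = 1)
  (Y : set R) (P : probability (measurableTypeR R) R) (T : R -> R) (C th H : R)
  (ind : induced mu f Y P T C th H).

Let ms := ind_ms ind.
Let mT := ms_meas ms.
Let mY := ind_mY ind.
Let y0 := pr mu Y.
Let ypos : 0 < y0 := ind_pos ind.
Let mi := @measurable_itvR R.

(** A close return outside [Y] is an excursion from [Y] into the part of a fat cell off [Y], of
    measure at most [c]. Mixing is applied at each induced time from [M0] on: the main terms add up
    to [n + 1] because cells have total mass at most 1, and the delay [M0] keeps the mixing tail,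
    multiplied by the number of cells, under control. *)
Lemma escape_bound (G : set R) a s r w M M0 n c : 0 < s -> r + s < w -> 0 <= c ->
  (forall x, G x -> [/\ Y x, a <= x < a + s * M%:R & pr mu (ball (x : R) w `&` ~` Y) <= c]) ->
  exists B : set (measurableTypeR R), [/\ measurable B,
    forall x j, G x -> (j <= n)%N -> ~ Y (iter j f x) -> `|iter j f x - x| <= r ->
      (M0 <= visits f Y j x)%N -> B x &
    pr P B <= (n.+1%:R + M%:R * \sum_(m <- iota M0 n.+1) C * th ^+ m) * (c / y0)].
Proof.
move=> s0 rsw c0 hG.
have cy0 : 0 <= c / y0 by rewrite divr_ge0// ltW.
have mCY : measurable (~` Y : set (measurableTypeR R)) by exact: measurableC.
pose J i : set (measurableTypeR R) := [set` fat_cell a s r i] `&` ~` Y.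
have mJ i : measurable (J i) by apply: measurableI => //; exact: mi.
have mE i := (excursion_bound mf pf mY (mJ i)).1.
pose A m i : set (measurableTypeR R) := if meets G a s i then
  [set` cell a s i] `&` iter (M0 + m) T @^-1` excursion f Y (J i) else set0.
have mA m i : measurable (A m i).
  rewrite /A; case: ifP => // _; apply: measurableI; first exact: mi.
  exact: (measurable_iter_preimage mT).
pose D m : set (measurableTypeR R) := \big[setU/set0]_(i < M) A m i.
have mD m : measurable (D m) by exact: bigsetU_measurable.
exists (\big[setU/set0]_(m < n.+1) D m); split; first exact: bigsetU_measurable.
  move=> x j Gx jn nYj close M0j; have [Yx xM _] := hG x Gx.
  have [t E nY] := orbit_T ind j Yx; set v := visits f Y j x in M0j E nY.
  have vj : (v <= j)%N by rewrite /v -[leqRHS](visits_setC f Y j x) leq_addr.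
  have [i iM xi] := cell_cover s0 xM.
  rewrite -bigcup_mkord; exists (v - M0)%N => /=.
    by rewrite ltnS (leq_trans (leq_subr _ _))// (leq_trans vj).
  rewrite /D -bigcup_mkord; exists i => //; rewrite /A ifT; last by apply/asboolP; exists x.
  split; first exact: set_mem.
  rewrite /preimage/= subnKC//; split.
    by rewrite (ind_T ind)//; exact: iter_first_return_in.
  by exists t => //; rewrite -E; split => //; apply: set_mem; exact: dist_fat_cell close.
have PA m i : pr P (A m i) <= (pr P [set` cell a s i] + C * th ^+ (M0 + m)) * (c / y0).
  rewrite /A; case: ifP => [/asboolP[x xi Gx]|_]; last first.
    by rewrite pr0 mulr_ge0// addr_ge0 ?pr_ge0// (ms_Cth0 ms).
  have [_ _ xc] := hG x Gx.
  apply: le_trans (mixing_sets ms _ _ (mE i)) _.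
  apply: ler_wpM2l; first by rewrite addr_ge0 ?pr_ge0// (ms_Cth0 ms).
  apply: le_trans (pr_induced_le ind (mE i)) _; rewrite ler_pM2r ?invr_gt0//.
  apply: le_trans (excursion_bound mf pf mY (mJ i)).2 _; apply: le_trans xc.
  apply: le_pr => //; first by apply: measurableI => //; exact: measurable_ball.
  move=> y [/mem_set yi nYy]; split => //; rewrite /ball/= distrC.
  by apply: le_lt_trans (fat_cell_dist xi yi) _.
apply: le_trans (pr_bigcup_ord _ _ mD) _.
have PD m : pr P (D m) <= (1 + M%:R * (C * th ^+ (M0 + m))) * (c / y0).
  apply: le_trans (pr_bigcup_ord _ _ (mA m)) _.
  apply: le_trans; first by apply: ler_sum => i _; exact: PA.
  rewrite -mulr_suml ler_wpM2r// big_split/= lerD//; first exact: sum_pr_cell_le1.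
  by rewrite sumr_const card_ord mulr_natl.
apply: le_trans; first by apply: ler_sum => m _; exact: PD.
have IE := iotaDl M0 0 n.+1; rewrite addn0 in IE; set I := iota M0 n.+1 in IE *.
rewrite -mulr_suml ler_wpM2r// big_split/= sumr_const card_ord lerD2l -mulr_sumr.
rewrite IE big_map.
by rewrite -(big_mkord xpredT (fun m => C * th ^+ (M0 + m))) /index_iota subn0.
Qed.

Context (low : R -> R)
  (mlow : measurable_fun setT (low : measurableTypeR R -> R))
  (dens : local_density mu Y low)
  (tau : R) (tau0 : 0 < tau).

Let r := prad tau.

Definition escape (n : nat) : set R := [set x | Y x /\ exists j, [/\ (0 < j <= n)%N,
  ~ Y (iter j f x) & `|iter j f x - x| <= r n]].

Lemma measurable_close_iter j c :
  measurable ([set x | `|iter j f x - x| <= c] : set (measurableTypeR R)).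
Proof. by apply: measurable_close; [exact: measurable_iter|exact: measurable_id]. Qed.

Lemma measurable_escape n : measurable (escape n : set (measurableTypeR R)).
Proof.
rewrite (_ : escape n = Y `&` \bigcup_(j in [set j | (0 < j <= n)%N])
    (iter j f @^-1` (~` Y) `&` [set x | `|iter j f x - x| <= r n])).
  apply: measurableI => //; apply: bigcup_measurable => j _; apply: measurableI.
    by apply: (measurable_iter_preimage mf); exact: measurableC.
  exact: measurable_close_iter.
apply/seteqP; split => x [Yx [j]]; first by move=> [hj nj cj]; split => //; exists j.
by move=> hj [nj cj]; split => //; exists j.
Qed.

(** Around typical points the complement of [Y] has measure at most [delta r] and [n r] is bounded,
    so escapes after [M0] visits have measure of order [delta]. Up to a small set, the remaining
    ones occur before a fixed time and vanish with the radius. *)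
Lemma escape_cvg0 : pr mu (escape n) @[n --> \oo] --> (0 : R).
Proof.
apply: cvg0_le => [n|e e0]; first exact: pr_ge0.
have e4 : 0 < e / 4 by rewrite divr_gt0.
pose delta := e / 4 / (tau + 1).
have tau1 : 0 < tau + 1 by rewrite addr_gt0.
have delta0 : 0 < delta by rewrite divr_gt0.
have h20 : 0 < (2^-1 : R) by rewrite invr_gt0.
have h21 : (2^-1 : R) < 1 by rewrite invf_lt1// ltr1n.
have [N _ hN] := near_le0 (uniformly_typical_cvg mY mlow dens tau0 h20 h21 delta0) e4.
have {hN} := hN N (leqnn N); set G := uniformly_typical _ _ _ _ _ _ _ => hN.
have mG : measurable (G : set (measurableTypeR R)) by exact: measurable_uniformly_typical.
(* The number of cells of length [r / 2] over [-N, N[ is at most [(4 N + tau) / r]; this tolerance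
   for the mixing tail compensates it. *)
have N4 : 0 < (4 * N%:R + tau)^-1 by rewrite invr_gt0 ltr_wpDl.
have [M0 hM0] := sum_Cth_small ms N4.
(* By time [k0] all points outside a set of measure at most [e / 4] have made [M0] visits to [Y]. *)
have [k0 _ hk0] := near_le0 (few_visits_cvg0 mf pf ef ind M0) e4.
have {hk0} hk0 := hk0 k0 (leqnn k0).
pose V : set (measurableTypeR R) := [set x | (visits f Y k0 x < M0)%N].
have mV : measurable V.
  rewrite (_ : V = ~` [set x | M0%:R <= (visits f Y k0 x)%:R :> R]).
    by apply: measurableC; exact: measurable_visits_ge.
  by apply/seteqP; split => x; rewrite /V/= ler_nat ltnNge => /negP.
pose L n j : set (measurableTypeR R) := Y `&` [set x | `|iter j.+1 f x - x| <= r n].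
have mL n j : measurable (L n j) by apply: measurableI => //; exact: measurable_close_iter.
have h4 : \forall n \near \oo, \sum_(j <- iota 0 k0) pr mu (L n j) <= e / 4.
  by apply: near_le0 => //; apply: cvg_sum0 => j _; exact: (f_return_cvg0 mf ind).
near=> n.
have n0 : (0 < n)%N by near: n; exact: near_prad_gt0.
have nN : (N <= n)%N by near: n; exists N.
have r0 : 0 < r n by exact: prad_gt0.
have a4 : \sum_(j <- iota 0 k0) pr mu (L n j) <= e / 4 by near: n; exact: h4.
pose s := r n / 2.
have s0 : 0 < s by rewrite divr_gt0.
pose M := (Num.truncn (2 * N%:R / s)).+1.
have rw : r n + s < (1 + 2 * 2^-1) * r n by rewrite /s; lra.
have c0 : 0 <= delta * r n by rewrite mulr_ge0// ltW.
have hG x : G x -> [/\ Y x, - N%:R <= x < - N%:R + s * M%:R &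
    pr mu (ball (x : R) ((1 + 2 * 2^-1) * r n) `&` ~` Y) <= delta * r n].
  move=> [Yx /andP[x1 x2] /(_ n nN n0)[_ _ h]]; split => //; rewrite x1/=.
  apply: (lt_le_trans x2); have := truncnS_gt (2 * N%:R / s).
  by rewrite ltr_pdivrMr// -/M => h'; lra.
have [B [mB hB PB]] := escape_bound M0 n s0 rw c0 hG.
have nr : n.+1%:R * r n <= tau.
  have := n_prad tau n0; rewrite -/(r n) => h; have n1 : (1 : R) <= n%:R by rewrite ler1n.
  by rewrite -natr1; nra.
have Mr : M%:R * r n <= 4 * N%:R + tau.
  have : (Num.truncn (2 * N%:R / s))%:R <= 2 * N%:R / s.
    by rewrite truncn_le divr_ge0 ?mulr_ge0// ltW.
  rewrite ler_pdivlMr// /M -natr1 /s => h.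
  have rt : r n <= tau by apply: le_trans nr; rewrite ler_peMl ?(ltW r0)// ler1n.
  by lra.
have muB : pr mu (B `&` Y) <= e / 4.
  rewrite (_ : pr mu (B `&` Y) = pr P B * y0); last first.
    by rewrite (ind_P ind)// divfK// gt_eqF.
  apply: le_trans (ler_wpM2r (ltW ypos) PB) _.
  rewrite -[leLHS]mulrA divfK; last by rewrite gt_eqF.
  set S := \sum_(m <- _) _; have := hM0 M0 n.+1 (leqnn _); rewrite -/S => hS.
  have S0 : 0 <= S by apply: sumr_ge0 => m _; exact: (ms_Cth0 ms).
  have MS : M%:R * r n * S <= 1.
    apply: (@le_trans _ _ ((4 * N%:R + tau) * (4 * N%:R + tau)^-1)).
      by apply: ler_pM => //; rewrite mulr_ge0// ltW.
    by rewrite divff// gt_eqF// ltr_wpDl.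
  rewrite [leLHS](_ : _ = (n.+1%:R * r n + M%:R * r n * S) * delta); last by ring.
  apply: (@le_trans _ _ ((tau + 1) * delta)).
    by rewrite ler_wpM2r ?(ltW delta0)// lerD.
  by rewrite /delta mulrC divfK// gt_eqF.
pose U : set (measurableTypeR R) := \big[setU/set0]_(j < k0) L n j.
have mU : measurable U by exact: bigsetU_measurable.
have muU : pr mu U <= e / 4.
  apply: le_trans (pr_bigcup_ord _ _ (mL n)) _; apply: le_trans a4.
  by rewrite -(big_mkord xpredT (fun j => pr mu (L n j))) /index_iota subn0.
have mYG : measurable (Y `\` G : set (measurableTypeR R)) by exact: measurableD.
have mBY : measurable (B `&` Y) by exact: measurableI.
apply: (@le_trans _ _ (pr mu ((Y `\` G `|` V) `|` (U `|` (B `&` Y))))).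
  apply: le_pr; first exact: measurable_escape.
    by apply: measurableU; exact: measurableU.
  move=> x [Yx [j [/andP[j0 jn] nj cj]]].
  have [Gx|nG] := pselect (G x); last by left; left.
  have [Vx|nV] := pselect (V x); first by left; right.
  right; have [jk|kj] := leqP j k0.
    left; rewrite /U -bigcup_mkord; exists j.-1 => /=; first by rewrite prednK.
    by rewrite /L prednK.
  right; split => //; apply: (hB x j) => //.
  apply: leq_trans (visits_mono f Y x (ltnW kj)).
  by rewrite leqNgt; apply/negP.
apply: le_trans (prU _ _ _) _; [exact: measurableU|exact: measurableU|].
have h1 := prU mu mYG mV; have h2 := prU mu mU mBY; lra.
Unshelve. all: by end_near. Qed.

End escape.

(** * Return counts between visits to thin and to fat cells *)

Section return_count.
Context (R : realType) (P : probability (measurableTypeR R) R) (T : R -> R)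
  (mT : measurable_fun setT (T : measurableTypeR R -> measurableTypeR R)).

Lemma return_countSr n r x : return_count T n.+1 r x =
  (return_count T n r x + (`|iter n.+1 T x - x| <= r)%R)%N.
Proof. by rewrite /return_count -[in LHS](addn1 n) iotaD count_cat /= addn0. Qed.

Lemma bm_return_count n r (z : R) : 0 <= z <= 1 ->
  bmeasurable (fun x : measurableTypeR R => z ^+ return_count T n r x).
Proof.
move=> z01; elim: n => [|n IH].
  by under eq_fun do rewrite /return_count/= expr0; exact: bm_cst.
have mn : measurable ([set x | `|iter n.+1 T x - x| <= r] : set (measurableTypeR R)).
  by apply: measurable_close; [exact: measurable_iter|exact: measurable_id].
rewrite (_ : (fun x => _) = (fun x : measurableTypeR R => z ^+ return_count T n r x *
    (1 - (1 - z) * \1_[set x | `|iter n.+1 T x - x| <= r] x))).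
  apply: bmM => //; apply: bmB; first exact: bm_cst.
  by apply: bmM; [exact: bm_cst|exact: bm_indic].
apply/funext => x; rewrite return_countSr exprD indicE; congr *%R.
have [h|/negP h] := boolP (`|iter n.+1 T x - x| <= r).
  by rewrite mem_set// expr1 mulr1 subKr.
by rewrite memNset// expr0 mulr0 subr0.
Qed.

Lemma sum_cell_pick (a s : R) M i x (F : nat -> R) : 0 < s -> (i < M)%N ->
  x \in [set` cell a s i] -> \sum_(k < M) \1_[set` cell a s k] x * F k = F i.
Proof.
move=> s0 iM xi; rewrite (bigD1 (Ordinal iM))//= indicE xi mul1r big1 ?addr0// => k ki.
rewrite indicE; have [xk|] := boolP (_ \in _); last by rewrite mul0r.
by case/eqP: ki; apply: val_inj; exact: (cell_disj s0 xk xi).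
Qed.

Lemma visits_le_count n r x (J : set R) : (forall y, J y -> `|y - x| <= r) ->
  (visits T J n x <= return_count T n r x)%N.
Proof. by move=> h; apply: sub_count => j /set_mem; exact: h. Qed.

Lemma count_le_visits n r x (J : set R) : (forall y, `|y - x| <= r -> J y) ->
  (return_count T n r x <= visits T J n x)%N.
Proof. by move=> h; apply: sub_count => j hj; apply: mem_set; exact: h. Qed.

End return_count.

Section sandwich.
Context (R : realType) (P : probability (measurableTypeR R) R) (T : R -> R)
  (C th H : R) (ms : mixing_system P T C th H).
Let mT := ms_meas ms.
Let mi := @measurable_itvR R.
Context (a s r z : R) (M m q : nat) (sr : 0 < s <= r) (z01 : 0 <= z <= 1).

Let pgf (J : nat -> interval R) (x : R) : R :=
  \sum_(i < M) \1_[set` cell a s i] x * z ^+ visits T [set` J i] m x.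
Let limit (J : nat -> interval R) (x : R) : R :=
  \sum_(i < M) \1_[set` cell a s i] x * (1 - (1 - z) * pr P [set` J i]) ^+ m.

Let bm_term (g : R -> R) i : bmeasurable (g : measurableTypeR R -> R) ->
  bmeasurable (fun x : measurableTypeR R => \1_[set` cell a s i] x * g x : R).
Proof. by move=> bg; apply: bmM => //; apply: bm_indic; exact: mi. Qed.

Let bm_pgf J : bmeasurable (pgf J : measurableTypeR R -> R).
Proof.
apply: (@bm_sum _ _ _ _ (index_enum 'I_M) xpredT (fun i x =>
  \1_[set` cell a s i] x * z ^+ visits T [set` J i] m x)) => i.
by apply: bm_term; apply: (bm_visits ms) => //; exact: mi.
Qed.

Let bm_limit J : bmeasurable (limit J : measurableTypeR R -> R).
Proof.
apply: (@bm_sum _ _ _ _ (index_enum 'I_M) xpredT (fun i x =>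
  \1_[set` cell a s i] x * (1 - (1 - z) * pr P [set` J i]) ^+ m)) => i.
by apply: bm_term; exact: bm_cst.
Qed.

Let ex_pgf_limit (J : nat -> interval R) : (forall k, [set` J k] `<=` [set` fat_cell a s r k]) ->
  `|ex P (pgf J) - ex P (limit J)| <= tot_err P T C th H q m M r.
Proof.
move=> Jfat; apply: le_trans (sum_local_pgf ms M m q sr z01 Jfat).
rewrite /pgf /limit.
rewrite (@ex_sum _ _ _ P _ (index_enum 'I_M) xpredT (fun i x =>
  \1_[set` cell a s i] x * z ^+ visits T [set` J i] m x)); last first.
  by move=> i; apply: bm_term; apply: (bm_visits ms) => //; exact: mi.
rewrite (@ex_sum _ _ _ P _ (index_enum 'I_M) xpredT (fun i x =>
  \1_[set` cell a s i] x * (1 - (1 - z) * pr P [set` J i]) ^+ m)); last first.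
  by move=> i; apply: bm_term; exact: bm_cst.
rewrite -sumrB; apply: le_trans (ler_norm_sum _ _ _) _; apply: ler_sum => i _.
rewrite le_eqVlt; apply/orP; left; apply/eqP; congr (`|_ - _|).
have mc : measurable ([set` cell a s i] : set (measurableTypeR R)) by exact: mi.
under eq_ex do rewrite mulrC; rewrite exZ; last exact: bm_indic.
by rewrite ex_indic// mulrC.
Qed.

Let p01 (J : nat -> interval R) i : 0 <= 1 - (1 - z) * pr P [set` J i] <= 1.
Proof.
have p1 : pr P [set` J i] <= 1 by apply: pr_le1; exact: mi.
have p0 := pr_ge0 P [set` J i].
by case/andP: z01 => z0 z1; apply/andP; split; nra.
Qed.

Let limit_itv J x : 0 <= limit J x <= 1.
Proof.
have s0 : 0 < s by case/andP: sr.
have q01 i : 0 <= (1 - (1 - z) * pr P [set` J i]) ^+ m <= 1.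
  by have /andP[h1 h2] := p01 J i; rewrite exprn_ge0//= exprn_ile1.
apply/andP; split; first by apply: sumr_ge0 => i _; rewrite mulr_ge0//; case/andP: (q01 i).
apply: le_trans (sum_cell_le1 a M x s0); apply: ler_sum => i _.
by rewrite ler_piMr//; case/andP: (q01 i).
Qed.

(** Powers of [z] decrease with the count, so visits to the thin cell bound the generating function
    from above and visits to the fat cell from below. Off [G] the trivial bound 1 is used at most
    twice, in the comparison with visits and in that with [t]. *)
Lemma return_pgf_sandwich (G : set (measurableTypeR R)) (t : R -> R) c :
  measurable G -> bmeasurable (t : measurableTypeR R -> R) -> (forall x, 0 <= t x <= 1) ->
  0 <= c -> (forall x, G x -> a <= x < a + s * M%:R) ->
  (forall x i, G x -> x \in [set` cell a s i] ->
    `|(1 - (1 - z) * pr P [set` thin_cell a s r i]) ^+ m - t x| <= c /\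
    `|(1 - (1 - z) * pr P [set` fat_cell a s r i]) ^+ m - t x| <= c) ->
  `|ex P (fun x => z ^+ return_count T m r x) - ex P t| <=
    tot_err P T C th H q m M r + c + 2 * pr P (~` G).
Proof.
move=> mG bt t01 c0 Gcov Gt; have /andP[s0 _] := sr; have /andP[z0 z1] := z01.
have mCG : measurable (~` G) by exact: measurableC.
have bQ := bm_return_count mT m r z01.
have bI : bmeasurable (\1_(~` G) : measurableTypeR R -> R) by exact: bm_indic.
have I0 (x : R) : 0 <= (\1_(~` G) x : R) by [].
have I1 (x : R) : ~ G x -> (\1_(~` G) x : R) = 1 by move=> nG; rewrite indicE mem_set.
have Q01 x : 0 <= z ^+ return_count T m r x <= 1 by exact: expr_itv01.
have thinE := ex_pgf_limit (fun k => @thin_sub_fat _ a s r k (ltW s0)).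
have fatE := ex_pgf_limit (fun k => @subset_refl _ [set` fat_cell a s r k]).
have bth : bmeasurable (fun x : measurableTypeR R => pgf (thin_cell a s r) x + \1_(~` G) x).
  exact: bmD.
have btc : bmeasurable (fun x : measurableTypeR R => t x + c) by apply: bmD => //; exact: bm_cst.
have btI : bmeasurable (fun x : measurableTypeR R => t x + c + \1_(~` G) x) by exact: bmD.
have bfI : bmeasurable (fun x : measurableTypeR R => limit (fat_cell a s r) x + c).
  by apply: bmD => //; exact: bm_cst.
have bfII : bmeasurable (fun x : measurableTypeR R => limit (fat_cell a s r) x + c + \1_(~` G) x).
  exact: bmD.
have u1 : ex P (fun x => z ^+ return_count T m r x) <=
    ex P (pgf (thin_cell a s r)) + pr P (~` G).
  rewrite -(ex_indic P mCG) -exD//; apply: le_ex => // x.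
  have [Gx|nG] := pselect (G x); last first.
    rewrite I1// ler_wpDl ?(andP (Q01 x)).2//; apply: sumr_ge0 => i _.
    by rewrite mulr_ge0// exprn_ge0.
  have [i iM xi] := cell_cover s0 (Gcov x Gx); rewrite /pgf.
  rewrite (sum_cell_pick (fun k => z ^+ visits T [set` thin_cell a s r k] m x) s0 iM xi).
  rewrite ler_wpDr//; apply: ler_wiXn2l => //; apply: visits_le_count => y /mem_set yi.
  exact: thin_dist xi yi.
have u2 : ex P (limit (thin_cell a s r)) <= ex P t + c + pr P (~` G).
  rewrite -(ex_indic P mCG) -[X in _ + X + _](ex_cst P c) -exD//; last exact: bm_cst.
  rewrite -exD//; apply: le_ex => // x; have /andP[t0 t1] := t01 x.
  have /andP[l0 l1] := limit_itv (thin_cell a s r) x.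
  have [Gx|nG] := pselect (G x); last by rewrite I1//; lra.
  have [i iM xi] := cell_cover s0 (Gcov x Gx).
  have := (Gt x i Gx xi).1; rewrite /limit.
  rewrite (sum_cell_pick (fun k => (1 - (1 - z) * pr P [set` thin_cell a s r k]) ^+ m) s0 iM xi).
  by rewrite ler_norml => /andP[_ h]; have := I0 x; lra.
have l1 : ex P (pgf (fat_cell a s r)) <= ex P (fun x => z ^+ return_count T m r x).
  apply: le_ex => // x.
  have [[i [iM xi]]|ni] := pselect (exists i, (i < M)%N /\ x \in [set` cell a s i]).
    rewrite /pgf.
    rewrite (sum_cell_pick (fun k => z ^+ visits T [set` fat_cell a s r k] m x) s0 iM xi).
    apply: ler_wiXn2l => //; apply: count_le_visits => y xy; apply: set_mem.
    exact: dist_fat_cell xi xy.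
  rewrite /pgf big1 ?(andP (Q01 x)).1// => i _; rewrite indicE.
  have [xi|] := boolP (_ \in _); last by rewrite mul0r.
  by exfalso; apply: ni; exists i.
have l2 : ex P t <= ex P (limit (fat_cell a s r)) + c + pr P (~` G).
  rewrite -(ex_indic P mCG) -[X in _ + X + _](ex_cst P c) -exD//; last exact: bm_cst.
  rewrite -exD//; apply: le_ex => // x; have /andP[t0 t1] := t01 x.
  have /andP[b0 b1] := limit_itv (fat_cell a s r) x.
  have [Gx|nG] := pselect (G x); last by rewrite I1//; lra.
  have [i iM xi] := cell_cover s0 (Gcov x Gx).
  have := (Gt x i Gx xi).2; rewrite /limit.
  rewrite (sum_cell_pick (fun k => (1 - (1 - z) * pr P [set` fat_cell a s r k]) ^+ m) s0 iM xi).
  by rewrite ler_norml => /andP[h _]; have := I0 x; lra.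
have G0 := pr_ge0 P (~` G).
move: thinE fatE; rewrite !ler_norml => /andP[_ h1] /andP[h2 _].
by apply/andP; split; lra.
Qed.

End sandwich.

(* [u] stands for the probability, conditionally on [Y], of a thin or fat cell of radius [r]
   near a point of density [l], [y] for the measure of [Y], and [m] for the typical number
   of visits to [Y] up to time [n]. *)
Lemma cell_pgf_estimate (R : realType) (y u l r tau z H k : R) (n m : nat) :
  0 < y <= 1 -> 0 <= r -> 0 <= l -> 0 <= z <= 1 -> 0 <= u <= 1 -> u <= H * (3 * r) -> 0 <= H ->
  n%:R * r = tau / 2 -> m = Num.truncn (y * n%:R) -> `|y * u - 2 * r * l| <= k * r ->
  `|(1 - (1 - z) * u) ^+ m - expR (- ((1 - z) * (tau * l)))| <=
    (9 * H ^+ 2 * (tau / 2) + 3 * H) * r + k * (tau / 2).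
Proof.
move=> /andP[y0 y1] r0 l0 /andP[z0 z1] /andP[u0 u1] uH H0 nr mE yu.
have tau0 : 0 <= tau / 2 by rewrite -nr mulr_ge0.
have yn : 0 <= y * n%:R by rewrite mulr_ge0// ltW.
have m1 : m%:R <= y * n%:R by rewrite mE truncn_le.
have m2 : y * n%:R - 1 <= m%:R.
  by have := truncnS_gt (y * n%:R); rewrite -mE -natr1 => h; lra.
have mn : m%:R <= n%:R :> R by apply: le_trans m1 _; rewrite ler_piMl.
have v01 : 0 <= (1 - z) * u <= 1 by apply/andP; split; nra.
have vu : (1 - z) * u <= u by rewrite ler_piMl// lerBlDr lerDl.
have /andP[v0 v1] := v01.
apply: (@le_trans _ _ (m%:R * ((1 - z) * u) ^+ 2 +
    `|m%:R * ((1 - z) * u) - (1 - z) * (tau * l)|)).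
  apply: le_trans (ler_distD (expR (- (m%:R * ((1 - z) * u)))) _ _) _.
  apply: lerD; first exact: norm_onem_pow_exp.
  apply: norm_expRN_sub; first by rewrite mulr_ge0.
  by rewrite !mulr_ge0 ?subr_ge0//; lra.
have h1 : m%:R * ((1 - z) * u) ^+ 2 <= 9 * H ^+ 2 * (tau / 2) * r.
  apply: (@le_trans _ _ (n%:R * (H * (3 * r)) ^+ 2)).
    by apply: ler_pM => //; [exact: exprn_ge0|apply: le_expr => //; exact: le_trans vu uH].
  by rewrite -nr le_eqVlt; apply/orP; left; apply/eqP; ring.
have h2 : `|m%:R * u - tau * l| <= 3 * H * r + k * (tau / 2).
  have e1 : `|m%:R * u - y * n%:R * u| <= 3 * H * r.
    rewrite -mulrBl normrM (ger0_norm u0) ler0_norm; last by rewrite subr_le0.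
    apply: (@le_trans _ _ (1 * u)); last by rewrite mul1r; lra.
    by rewrite ler_wpM2r//; lra.
  have e2 : `|y * n%:R * u - tau * l| <= k * (tau / 2).
    rewrite (_ : _ - _ = n%:R * (y * u - 2 * r * l)); last first.
      rewrite mulrBr (_ : n%:R * (2 * r * l) = 2 * (n%:R * r) * l); last by ring.
      by rewrite nr; field.
    rewrite normrM ger0_norm// -nr mulrCA; by rewrite ler_wpM2l.
  by apply: le_trans (ler_distD (y * n%:R * u) _ _) _; exact: lerD.
rewrite [leRHS](_ : _ = 9 * H ^+ 2 * (tau / 2) * r + (3 * H * r + k * (tau / 2))); last by ring.
 apply: lerD => //; apply: le_trans h2.
rewrite (_ : _ - _ = (1 - z) * (m%:R * u - tau * l)); last by ring.
by rewrite normrM ger0_norm ?subr_ge0// ler_piMl// lerBlDr lerDl.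
Qed.

Lemma return_count_const (R : realType) (T : R -> R) a m r x : (a <= m)%N ->
  (forall j, (a < j <= m)%N -> r < `|iter j T x - x|) ->
  return_count T m r x = return_count T a r x.
Proof.
move=> am h; rewrite /return_count -(subnKC am) iotaD count_cat.
rewrite [X in (_ + X)%N](_ : _ = 0%N) ?addn0//; apply/eqP; rewrite -leqn0 leqNgt -has_count.
apply/hasPn => j; rewrite mem_iota add1n addSn subnKC// ltnS => hj.
by rewrite -ltNge; exact: h.
Qed.

(** * Generating functions on an induced set *)

Section induced_return_pgf.
Context (R : realType) (mu : probability (measurableTypeR R) R) (f : R -> R)
  (mf : measurable_fun setT (f : measurableTypeR R -> measurableTypeR R))
  (pf : forall A : set (measurableTypeR R), measurable A -> mu (f @^-1` A) = mu A)
  (ef : forall A : set (measurableTypeR R), measurable A -> f @^-1` A = A ->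
    pr mu A = 0 \/ pr mu A = 1)
  (Y : set R) (P : probability (measurableTypeR R) R) (T : R -> R) (C th H : R)
  (ind : induced mu f Y P T C th H).
Context (low : R -> R)
  (mlow : measurable_fun setT (low : measurableTypeR R -> R)) (low0 : forall x, 0 <= low x)
  (dens : local_density mu Y low)
  (tau : R) (tau0 : 0 < tau) (z : R) (z01 : 0 <= z <= 1).

Let ms := ind_ms ind.
Let mT := ms_meas ms.
Let mY := ind_mY ind.
Let y0 := pr mu Y.
Let ypos : 0 < y0 := ind_pos ind.
Let y1 : y0 <= 1. Proof. exact: pr_le1. Qed.
Let mi := @measurable_itvR R.
Let r := prad tau.
Let H0 : 0 <= H := ms_H ms.

Let t (x : R) := expR (- ((1 - z) * (tau * low x))).
Let m (n : nat) := Num.truncn (y0 * n%:R).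

Let t01 x : 0 <= t x <= 1.
Proof.
rewrite expR_ge0/= -[leRHS]expR0 ler_expR oppr_le0 !mulr_ge0//; last exact: ltW.
by case/andP: z01 => _ z1; rewrite subr_ge0.
Qed.

Let bt : bmeasurable (t : measurableTypeR R -> R).
Proof.
apply: (@bm_itv _ _ _ _ 0 1) => [|x]; last exact: t01.
apply: (measurableT_comp (@measurable_expR R)).
apply: (@measurable_funN _ _ _ _ (fun x => (1 - z) * (tau * low x))).
by apply: measurable_funM => //; exact: measurable_funM.
Qed.

Let m_le n : (m n <= n)%N.
Proof.
rewrite -(ler_nat R); apply: (@le_trans _ _ (y0 * n%:R)); last by rewrite ler_piMl.
by rewrite truncn_le mulr_ge0// ltW.
Qed.

(** One small parameter [d] serves both as the mesh relative to the radius and as the tolerance in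
    the density asymptotics. It is fixed before [n] tends to infinity, and its error is of order
    [d]. *)
Lemma conditional_pgf_near e : 0 < e ->
  \forall n \near \oo, `|ex P (fun x => z ^+ return_count T (m n) (r n) x) - ex P t| <= e.
Proof.
move=> e0; have th0 : 0 < tau / 2 by rewrite divr_gt0.
(* [(3 + 12 H) d r] will bound the deviation of the measure of a thin or fat cell, in [l4], and
   [n r = tau / 2]. *)
pose D := (3 + 12 * H) * (tau / 2) + 1.
have D0 : 0 < D by rewrite ltr_wpDl// mulr_ge0 ?(ltW th0)// addr_ge0// mulr_ge0.
have e8 : 0 < e / 8 by rewrite divr_gt0.
pose d := Num.min (2^-1) (e / 8 / D).
have d0 : 0 < d by rewrite lt_min invr_gt0 ltr0n divr_gt0.
have d2 : d <= 2^-1 by rewrite ge_min lexx.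
have dD : d * D <= e / 8 by rewrite -ler_pdivlMr// ge_min lexx orbT.
have d1 : d < 1 by apply: le_lt_trans d2 _; rewrite invf_lt1// ltr1n.
have ey : 0 < e / 8 * y0 by rewrite mulr_gt0.
have [N _ hN] := near_le0 (uniformly_typical_cvg mY mlow dens tau0 d0 d1 d0) ey.
have {hN} := hN N (leqnn N); set G := uniformly_typical _ _ _ _ _ _ _ => hN.
have mG : measurable (G : set (measurableTypeR R)) by exact: measurable_uniformly_typical.
have mCG : measurable (~` G : set (measurableTypeR R)) by exact: measurableC.
have PG : pr P (~` G) <= e / 8.
  by rewrite (ind_P ind)// ler_pdivrMr// setIC -setDE.
have B0 : 0 <= 2 * N%:R / d by rewrite divr_ge0 ?mulr_ge0// ltW.
have h1 := tot_err_cvg0 ind tau0 B0 e8.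
have h2 : \forall n \near \oo, (9 * H ^+ 2 * (tau / 2) + 3 * H) * r n <= e / 8.
  by apply: near_le0 => //; exact: prad_cvgM.
near=> n.
have n0 : (0 < n)%N by near: n; exact: near_prad_gt0.
have nN : (N <= n)%N by near: n; exists N.
have r0 : 0 < r n by exact: prad_gt0.
have a1 : forall M k, (k <= n)%N -> M%:R <= 2 * N%:R / d / r n + 1 ->
    tot_err P T C th H (pgap R n) k M (r n) <= e / 8 by near: n; exact: h1.
have a2 : (9 * H ^+ 2 * (tau / 2) + 3 * H) * r n <= e / 8 by near: n; exact: h2.
pose s := d * r n.
have s0 : 0 < s by rewrite mulr_gt0.
have sr : 0 < s <= r n by rewrite s0/= ler_piMl ?(ltW r0)// ltW.
pose M := (Num.truncn (2 * N%:R / s)).+1.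
have hM : M%:R <= 2 * N%:R / d / r n + 1.
  rewrite /M -natr1 lerD2r (_ : _ / _ / _ = 2 * N%:R / s); last first.
    by rewrite /s; field; rewrite !gt_eqF.
  by rewrite truncn_le divr_ge0 ?mulr_ge0// ltW.
pose c := (9 * H ^+ 2 * (tau / 2) + 3 * H) * r n + (3 + 12 * H) * d * (tau / 2).
have K0 : 0 <= (3 + 12 * H) * d by rewrite mulr_ge0 ?(ltW d0)// addr_ge0// mulr_ge0.
have c0 : 0 <= c.
  by rewrite addr_ge0 ?mulr_ge0 ?addr_ge0 ?mulr_ge0 ?exprn_ge0// ltW.
have cov x : G x -> - N%:R <= x < - N%:R + s * M%:R.
  move=> [_ /andP[-> x2] _] /=; apply: (lt_le_trans x2).
  by have := truncnS_gt (2 * N%:R / s); rewrite ltr_pdivrMr// -/M => h'; lra.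
have loc x i : G x -> x \in [set` cell (- N%:R) s i] ->
    `|(1 - (1 - z) * pr P [set` thin_cell (- N%:R) s (r n) i]) ^+ m n - t x| <= c /\
    `|(1 - (1 - z) * pr P [set` fat_cell (- N%:R) s (r n) i]) ^+ m n - t x| <= c.
  move=> [Yx _ /(_ n nN n0)[]]; rewrite -/(r n).
  set b1 := pr mu _; set b2 := pr mu _ => hb1 hb2 _ xi.
  have mfat : measurable ([set` fat_cell (- N%:R) s (r n) i] : set (measurableTypeR R)) by exact: mi.
  have mthin : measurable ([set` thin_cell (- N%:R) s (r n) i] : set (measurableTypeR R)) by exact: mi.
  have mball w : measurable (ball (x : R) w : set (measurableTypeR R)) by exact: measurable_ball.
  have yb w : y0 * pr P (ball (x : R) w) = pr mu (ball (x : R) w `&` Y).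
    by rewrite (ind_P ind)// mulrC divfK// gt_eqF.
  have u1 := le_pr P mthin mfat (@thin_sub_fat _ _ _ _ _ (ltW s0)).
  have u2 : b1 <= y0 * pr P [set` thin_cell (- N%:R) s (r n) i].
    rewrite ?/b1 ?/b2 -yb ler_pM2l//; apply: le_pr => //; rewrite mulrBl mul1r.
    exact: ball_thin.
  have u3 : y0 * pr P [set` fat_cell (- N%:R) s (r n) i] <= b2.
    rewrite ?/b1 ?/b2 -yb ler_pM2l//; apply: le_pr => // y /mem_set yi; rewrite /ball/= distrC.
    by apply: le_lt_trans (fat_cell_dist xi yi) _; rewrite /s; nra.
  have u4 : pr P [set` fat_cell (- N%:R) s (r n) i] <= H * (3 * r n).
    by apply: (pr_fat_cell_le ms); rewrite (ltW s0)/=; case/andP: sr.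
  move: u1 u2 u3 u4.
  have vth := pr_le1 P mthin; have vfat := pr_le1 P mfat.
  move: (pr_ge0 P [set` thin_cell (- N%:R) s (r n) i]) vth (pr_ge0 P [set` fat_cell (- N%:R) s (r n) i]) vfat.
  move: (pr P [set` thin_cell (- N%:R) s (r n) i]) (pr P [set` fat_cell (- N%:R) s (r n) i]).
  move=> u v pu0 pu1 pv0 pv1 uv b1u vb2 v3.
  rewrite !ler_norml in hb1 hb2; have /andP[g1 g2] := hb1; have /andP[g3 g4] := hb2.
  have lx := low0 x; set l := low x in lx g1 g2 g3 g4 *.
  have yu : y0 * u <= y0 * v by rewrite ler_pM2l.
  have yv : y0 * v <= v by rewrite ler_piMl.
  have rl0 : 0 <= r n * l by rewrite mulr_ge0// ltW.
  (* The thin cell has measure at most [3 H r], so [low] is at most [d + 3 H] at typical points;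
     relative errors due to the modified radii become absolute ones. *)
  have l3 : r n * l <= (d + 3 * H) * r n.
    have k1 : 2 * ((1 - d) * r n) * l <= d * r n + H * (3 * r n) by lra.
    apply: le_trans (_ : 2 * ((1 - d) * r n) * l <= _); last by lra.
    rewrite [leRHS](_ : _ = 2 * (1 - d) * (r n * l)); last by ring.
    by rewrite ler_peMl//; lra.
  have dr0 : 0 <= d * r n by rewrite mulr_ge0 ?ltW.
  have l4 : 4 * d * (r n * l) + d * r n <= (3 + 12 * H) * d * r n.
    apply: (@le_trans _ _ (4 * d * ((d + 3 * H) * r n) + d * r n)).
      by rewrite lerD2r ler_wpM2l// mulr_ge0// ltW.
    have : d * (d * r n) <= 2^-1 * (d * r n) by rewrite ler_wpM2r.
    move=> k2; rewrite [leRHS](_ : _ = 3 * (d * r n) + 12 * (H * (d * r n))); last by ring.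
    rewrite [leLHS](_ : _ = 4 * (d * (d * r n)) + 12 * (H * (d * r n)) + d * r n); last by ring.
    lra.
  have nr : n%:R * r n = tau / 2 by exact: n_prad.
  have yp : 0 < y0 <= 1 by rewrite ypos.
  have drl0 : 0 <= d * (r n * l) by rewrite mulr_ge0// ltW.
  rewrite /c /t -/l; split; apply: (cell_pgf_estimate (n := n) yp (ltW r0) lx z01 _ _ H0 nr) => //.
  - exact/andP.
  - exact: le_trans uv v3.
  - by rewrite ler_norml; apply/andP; split; lra.
  - exact/andP.
  - by rewrite ler_norml; apply/andP; split; lra.
apply: le_trans (return_pgf_sandwich ms (pgap R n) sr z01 mG bt t01 c0 cov loc) _.
have := a1 M (m n) (m_le n) hM => hT.
have cE : c <= e / 8 + e / 8.
  rewrite /c lerD//; apply: le_trans dD.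
  rewrite [leLHS](_ : _ = d * ((3 + 12 * H) * (tau / 2))); last by ring.
  by rewrite ler_wpM2l ?(ltW d0)// /D lerDl.
lra.
Unshelve. all: by end_near. Qed.

(** If all close returns happen in [Y], counting them for [f] and for the first return map differs
    by the clock only. *)
Let return_count_first_return n c x : Y x ->
  (forall j, (0 < j <= n)%N -> `|iter j f x - x| <= c -> Y (iter j f x)) ->
  return_count f n c x = return_count T (visits f Y n x) c x.
Proof.
move=> Yx h; pose B := [set w | `|w - x| <= c].
transitivity (visits f (Y `&` B) n x).
  apply: eq_in_count => j; rewrite mem_iota add1n ltnS => hj.
  apply/idP/idP => [cj|/set_mem[]//]; apply: mem_set; split => //.
  exact: h.
rewrite visits_first_return//; transitivity (visits T B (visits f Y n x) x).
  by apply: eq_visits => j; rewrite (ind_T ind).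
by apply: eq_count => j; apply/idP/idP => [/set_mem//|cj]; exact: mem_set.
Qed.

(** The count for [f] up to time [n] equals that for [T] up to the deterministic time [m n] off
    three rare events: a close return outside [Y], a number of visits to [Y] far from its mean, and
    a close return of the induced orbit in the window of times between the two clocks. *)
Lemma induced_return_pgf e : 0 < e -> \forall n \near \oo,
  `|ex mu (fun x => \1_Y x * z ^+ return_count f n (r n) x) - ex mu (fun x => \1_Y x * t x)| <= e.
Proof.
move=> e0; have e4 : 0 < e / 4 by rewrite divr_gt0.
have [d /andP[d0 dy] hwin] := window_return_small ind tau0 e4.
have h1 := conditional_pgf_near e4.
have h2 := near_le0 (escape_cvg0 mf pf ef ind mlow dens tau0) e4.
have h3 : \forall n \near \oo, pr mu (freq_dev mu f Y d n) <= e / 4.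
  apply: near_le0 => //; apply: pr_limsup0; first by move=> n; exact: (measurable_freq_dev mu mf).
  exact: (frequency_limsup mf pf ef).
near=> n.
have n0 : (0 < n)%N by near: n; exact: near_prad_gt0.
have nR : 0 < n%:R :> R by rewrite ltr0n.
have a1 : `|ex P (fun x => z ^+ return_count T (m n) (r n) x) - ex P t| <= e / 4.
  by near: n; exact: h1.
have a2 : pr mu (escape f Y tau n) <= e / 4 by near: n; exact: h2.
have a3 : pr mu (freq_dev mu f Y d n) <= e / 4 by near: n; exact: h3.
have a4 : forall a b, (y0 - d) * n%:R - 1 <= a%:R -> (a <= b)%N ->
    b%:R <= (y0 + d) * n%:R + 1 ->
    \sum_(j <- iota a.+1 (b - a)) pr P (near_return T j (r n)) <= e / 4.
  by near: n; exact: hwin.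
(* The window of induced times: it contains [m n] and, unless the visit frequency deviates by [d] or
   more, the actual number of visits. *)
pose a := Num.truncn ((y0 - d) * n%:R); pose b := (Num.truncn ((y0 + d) * n%:R)).+1.
have an : 0 <= (y0 - d) * n%:R by rewrite mulr_ge0// subr_ge0 ltW.
have bn : 0 <= (y0 + d) * n%:R by rewrite mulr_ge0// addr_ge0// ltW.
have ha1 : a%:R <= (y0 - d) * n%:R by rewrite truncn_le.
have ha2 : (y0 - d) * n%:R - 1 <= a%:R.
  by have := truncnS_gt ((y0 - d) * n%:R); rewrite -/a -natr1 => h; lra.
have hb1 : b%:R <= (y0 + d) * n%:R + 1 by rewrite /b -natr1 lerD2r truncn_le.
have hb2 : (y0 + d) * n%:R < b%:R by exact: truncnS_gt.
have dn : 0 < d * n%:R by rewrite mulr_gt0.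
have ab : (a <= b)%N by rewrite -(ler_nat R); lra.
have yn : 0 <= y0 * n%:R by rewrite mulr_ge0// ltW.
have mb : (m n <= b)%N.
  have : (m n)%:R <= y0 * n%:R by rewrite truncn_le.
  by rewrite -(ler_nat R) => h; lra.
have am : (a <= m n)%N.
  have := truncnS_gt (y0 * n%:R); rewrite -/(m n) => h.
  by rewrite -ltnS -(ltr_nat R); lra.
pose L k : set (measurableTypeR R) := near_return T (a.+1 + k) (r n).
pose W : set (measurableTypeR R) := \big[setU/set0]_(k < b - a) L k.
have mL k : measurable (L k).
  exact: (measurable_near_return ms).
have mW : measurable W by exact: bigsetU_measurable.
have muW : pr mu (W `&` Y) <= e / 4.
  have -> : pr mu (W `&` Y) = pr P W * y0 by rewrite (ind_P ind)// divfK// gt_eqF.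
  apply: (@le_trans _ _ (pr P W)); first by rewrite ler_piMr// pr_ge0.
  apply: le_trans (pr_bigcup_ord _ _ mL) _.
  apply: le_trans (a4 a b ha2 ab hb1).
  rewrite -[in leRHS](addn0 a.+1) iotaDl big_map.
  by rewrite -(big_mkord xpredT (fun k => pr P (near_return T (a.+1 + k) (r n)))) /index_iota subn0.
have mE := measurable_escape mf ind tau n.
have mF : measurable (freq_dev mu f Y d n : set (measurableTypeR R)).
  exact: (measurable_freq_dev mu mf).
have mWY : measurable (W `&` Y) by exact: measurableI.
pose Bad : set (measurableTypeR R) := escape f Y tau n `|` (freq_dev mu f Y d n `|` (W `&` Y)).
have mBad : measurable Bad by apply: measurableU => //; exact: measurableU.
have muBad : pr mu Bad <= 3 * (e / 4).
  have k1 := prU mu mF mWY.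
  have k2 := prU mu mE (measurableU _ _ mF mWY).
  by rewrite /Bad; lra.
have bRf := bm_return_count mf n (r n) z01.
have bRT := bm_return_count mT (m n) (r n) z01.
have bY : bmeasurable (\1_Y : measurableTypeR R -> R) by exact: bm_indic.
have key : `|ex mu (fun x => \1_Y x * z ^+ return_count f n (r n) x) -
    ex mu (fun x => \1_Y x * z ^+ return_count T (m n) (r n) x)| <= pr mu Bad.
  rewrite -exB; [|exact: bmM|exact: bmM].
  rewrite -(ex_indic mu mBad); apply: norm_ex_le; [by apply: bmB; exact: bmM|exact: bm_indic|].
  move=> x; rewrite -mulrBr.
  have [Yx|nY] := pselect (Y x); last first.
    by rewrite [X in X * _]indicE memNset// mul0r normr0.
  rewrite [X in X * _]indicE mem_set// mul1r.
  have [Bx|nB] := pselect (Bad x).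
    rewrite [leRHS]indicE mem_set//=; have /andP[p1 p2] := expr_itv01 (return_count f n (r n) x) z01.
    have /andP[q1 q2] := expr_itv01 (return_count T (m n) (r n) x) z01.
    by rewrite ler_norml; apply/andP; split; lra.
  rewrite [leRHS]indicE memNset//.
  suff -> : return_count f n (r n) x = return_count T (m n) (r n) x by rewrite subrr normr0.
  move: nB => /not_orP[nE /not_orP[nF nW]].
  rewrite return_count_first_return//; last first.
    by move=> j hj cj; apply: contrapT => nj; apply: nE; split => //; exists j.
  have far j : (a < j <= b)%N -> r n < `|iter j T x - x|.
    move=> /andP[aj jb]; rewrite ltNge; apply/negP => cj; apply: nW; split => //.
    rewrite /W -bigcup_mkord; exists (j - a.+1)%N ; first by rewrite /mkset ltn_subLR// addSn subnKC.
    by rewrite /L subnKC.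
  move: nF; rewrite /freq_dev/= => /negP; rewrite -ltNge ltr_norml -/y0 => /andP[v1 v2].
  have vb : (visits f Y n x <= b)%N by rewrite -(ler_nat R); lra.
  have av : (a <= visits f Y n x)%N by rewrite -(ler_nat R); lra.
  rewrite (return_count_const av); last first.
    by move=> j /andP[aj jv]; apply: far; rewrite aj (leq_trans jv).
  by rewrite (return_count_const am)// => j /andP[aj jv]; apply: far; rewrite aj (leq_trans jv).
have E1 : ex mu (fun x => \1_Y x * z ^+ return_count T (m n) (r n) x) =
    y0 * ex P (fun x => z ^+ return_count T (m n) (r n) x).
  rewrite (ex_induced ind bRT); first by rewrite mulrC divfK// gt_eqF.
  by move=> x; case/andP: (expr_itv01 (return_count T (m n) (r n) x) z01).
have E2 : ex mu (fun x => \1_Y x * t x) = y0 * ex P t.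
  rewrite (ex_induced ind bt); first by rewrite mulrC divfK// gt_eqF.
  by move=> x; case/andP: (t01 x).
apply: le_trans (ler_distD (ex mu (fun x => \1_Y x * z ^+ return_count T (m n) (r n) x)) _ _) _.
rewrite [leRHS](_ : _ = 3 * (e / 4) + e / 4); last by field.
apply: lerD; first exact: le_trans key muBad.
rewrite E1 E2 -mulrBr normrM ger0_norm ?(ltW ypos)//.
by apply: le_trans a1; rewrite ler_piMl.
Unshelve. all: by end_near. Qed.

End induced_return_pgf.

Lemma poisson_weight_itv (R : realType) (x : R) k : 0 <= x ->
  0 <= x ^+ k / k`!%:R * expR (- x) <= 1.
Proof.
move=> x0; rewrite !mulr_ge0 ?invr_ge0 ?exprn_ge0 ?expR_ge0//=.
rewrite expRN ler_pdivrMr ?expR_gt0// mul1r; case: k => [|k].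
  by rewrite expr0 fact0 divr1 -[leLHS]expR0 ler_expR.
by apply: le_trans (expR_ge1Dxn k x0); rewrite lerDr.
Qed.

Lemma measurable_return_count_eq (R : realType) (T : R -> R) n (r : R) k :
  measurable_fun setT (T : measurableTypeR R -> measurableTypeR R) ->
  measurable ([set x | return_count T n r x = k] : set (measurableTypeR R)).
Proof.
move=> mT.
have m : measurable_fun setT (fun x : measurableTypeR R => (return_count T n r x)%:R : R).
  elim: n => [|n IH]; first exact: measurable_cst.
  under eq_fun do rewrite return_countSr natrD.
  apply: measurable_funD => //.
  have mn : measurable ([set x | `|iter n.+1 T x - x| <= r] : set (measurableTypeR R)).
    by apply: measurable_close; [exact: measurable_iter|exact: measurable_id].
  have := (bm_indic R mn).1; apply: eq_measurable_fun => x _; rewrite indicE.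
  have [h|/negP h] := boolP (`|iter n.+1 T x - x| <= r); first by rewrite mem_set.
  by rewrite memNset.
rewrite (_ : [set _ | _] = (fun x => (return_count T n r x)%:R : R) @^-1` [set k%:R]).
  by rewrite -[X in measurable X]setTI; exact: (m measurableT _ (measurable_set1 _)).
apply/seteqP; split => x /=; first by move=> ->.
by move=> /eqP; rewrite eqr_nat => /eqP.
Qed.

(** * The limit law of the return count *)

Section return_distribution.
Context (R : realType) (X : set R) (f : R -> R) (mu : probability (measurableTypeR R) R)
  (rho : R -> R) (hmu : ergodic_acip X f mu) (hhyp : asymptotically_hyperbolic X f mu)
  (hrho : is_density X mu rho) (tau : R) (tau0 : 0 < tau).

Let g := totalize X f.
Let low : R -> R := rho \_ X.
Let mX : measurable (X : set (measurableTypeR R)). Proof. by case: hmu. Qed.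
Let mg := measurable_totalize hmu.
Let r := prad tau.

Let lowE x : X x -> low x = rho x.
Proof. by move=> Xx; rewrite /low patchE mem_set. Qed.

Let low0 x : 0 <= low x.
Proof.
by case: hrho => _ rho0 _; rewrite /low patchE; case: ifPn => // /set_mem/rho0.
Qed.

Let mlow : measurable_fun setT (low : measurableTypeR R -> R).
Proof. by case: hrho => mrho _ _; exact/(measurable_restrictT _ _).1. Qed.

Let t z (x : R) := expR (- ((1 - z) * (tau * low x))).

Let t01 z x : 0 <= z <= 1 -> 0 <= t z x <= 1.
Proof.
move=> /andP[_ z1]; rewrite expR_ge0/= -[leRHS]expR0 ler_expR oppr_le0.
by rewrite !mulr_ge0 ?subr_ge0// ltW.
Qed.

Let bt z : 0 <= z <= 1 -> bmeasurable (t z : measurableTypeR R -> R).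
Proof.
move=> z01; apply: (@bm_itv _ _ _ _ 0 1) => [|x]; last exact: t01.
apply: (measurableT_comp (@measurable_expR R)).
apply: (@measurable_funN _ _ _ _ (fun x => (1 - z) * (tau * low x))).
by apply: measurable_funM => //; exact: measurable_funM.
Qed.

(** The estimate off [Y] is the difference of two density statements, for the whole line and for
    [Y], each with tolerance [e / 2]. *)
Let dens Y : measurable (Y : set (measurableTypeR R)) -> Y `<=` X ->
  local_density mu Y low.
Proof.
move=> mY YX.
have [N1 [mN1 N10 h1]] := density_points mX hrho mY.
have [N2 [mN2 N20 h2]] := density_points mX hrho (measurableT : measurable (setT : set (measurableTypeR R))).
exists (N1 `|` N2); split; first exact: measurableU.
  by apply/eqP; rewrite eq_le pr_ge0 andbT (le_trans (prU _ _ _))// N10 N20 addr0.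
move=> x e Yx /not_orP[n1 n2] e0; have Xx := YX x Yx.
have e2 : 0 < e / 2 by rewrite divr_gt0.
have [c1 c10 hc1] := h1 x _ Yx Xx n1 e2.
have [c2 c20 hc2] := h2 x _ Logic.I Xx n2 e2.
exists (Num.min c1 c2); first by rewrite lt_min c10.
move=> s; rewrite lt_min => /andP[s0 /andP[s1 s2]].
have := hc1 s; rewrite s0 s1 => /(_ isT) k1; have := hc2 s; rewrite s0 s2 setIT => /(_ isT) k2.
have mb : measurable (ball (x : R) s : set (measurableTypeR R)) by exact: measurable_ball.
have := prDI mu mb mY; rewrite setDE => E.
rewrite lowE//; move: k1 k2; rewrite E !ler_norml => /andP[a1 a2] /andP[a3 a4].
have es : 0 < e * s by rewrite mulr_gt0.
by split; [apply/andP; split|]; lra.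
Qed.

(** Discarding the complement of [Y] costs at most its measure on each side, as the integrands lie
    in [0, 1]; [Y] is chosen before [n], with complement at most [e / 3]. *)
Lemma return_pgf_cvg z : 0 < z < 1 ->
  ex mu (fun x => z ^+ return_count g n (r n) x) @[n --> \oo] --> ex mu (t z).
Proof.
move=> /andP[/ltW z0 /ltW z1]; have z01 : 0 <= z <= 1 by rewrite z0.
apply/cvgrPdist_le => e' e'0; pose e : R := e'; have e0 : 0 < e by [].
have e3 : 0 < e / 3 by rewrite divr_gt0.
have [Y [P [T [C [th [H [ind Ye YX]]]]]]] := induced_exists hmu hhyp e3.
have mY : measurable (Y : set (measurableTypeR R)) by exact: ind_mY ind.
have mCY : measurable (~` Y : set (measurableTypeR R)) by exact: measurableC.
have := induced_return_pgf mg (totalize_preserving hmu) (totalize_ergodic hmu) ind mlow low0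
  (dens mY YX) tau0 z01 e3.
have bY : bmeasurable (\1_Y : measurableTypeR R -> R) by exact: bm_indic.
have drop (h : R -> R) : bmeasurable (h : measurableTypeR R -> R) -> (forall x, 0 <= h x <= 1) ->
    `|ex mu h - ex mu (fun x => \1_Y x * h x)| <= e / 3.
  move=> bh h01; apply: le_trans Ye; rewrite -exB//; last exact: bmM.
  rewrite -(ex_indic mu mCY); apply: norm_ex_le.
  - by apply: bmB => //; exact: bmM.
  - exact: bm_indic.
  move=> x; rewrite !indicE; have [Yx|nY] := pselect (Y x).
    by rewrite mem_set// mul1r subrr normr0.
  by rewrite memNset// mem_set// mul0r subr0 ger0_norm; case/andP: (h01 x).
apply: filterS => n hn.
have b1 := drop _ (bt z01) (fun x => t01 x z01).
have b2 := drop _ (bm_return_count mg n (r n) z01) (fun x => expr_itv01 _ z01).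
change (`|ex mu (t z) - ex mu (fun x => z ^+ return_count g n (r n) x)| <= e).
move: b1 b2 hn; rewrite !ler_norml => /andP[b1 b2] /andP[b3 b4] /andP[b5 b6].
by apply/andP; split; lra.
Qed.

Let weight k (x : R) := (tau * low x) ^+ k / k`!%:R * expR (- (tau * low x)).

Let bweight k : bmeasurable (weight k : measurableTypeR R -> R).
Proof.
have mt : measurable_fun setT (fun x : measurableTypeR R => tau * low x) by exact: measurable_funM.
apply: (@bm_itv _ _ _ _ 0 1) => [|x].
  apply: measurable_funM.
    by apply: measurable_funM => //; exact: measurable_funX.
  by apply: (measurableT_comp (@measurable_expR R)); exact: measurable_funN.
by apply: poisson_weight_itv; rewrite mulr_ge0// ltW.
Qed.

Lemma pr_return_count_cvg k :
  pr mu [set x | return_count g n (r n) x = k] @[n --> \oo] --> ex mu (weight k).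
Proof.
pose A n i : set (measurableTypeR R) := [set x | return_count g n (r n) x = i].
have mA n i : measurable (A n i) by exact: measurable_return_count_eq.
apply: (pgf_cvg (p := fun n i => pr mu (A n i)) (q := fun i => ex mu (weight i)) return_pgf_cvg).
- move=> z K n /andP[/ltW z0 /ltW z1]; have z01 : 0 <= z <= 1 by rewrite z0.
  have bA i : bmeasurable (fun x : measurableTypeR R => z ^+ i * \1_(A n i) x : R).
    by apply: bmM; [exact: bm_cst|exact: bm_indic].
  have bR := bm_return_count mg n (r n) z01.
  rewrite (eq_bigr (fun i : 'I_K => ex mu (fun x => z ^+ i * \1_(A n i) x))); last first.
    by move=> i _; rewrite exZ ?ex_indic//; exact: bm_indic.
  rewrite -(@ex_sum _ _ _ mu _ (index_enum 'I_K) xpredT (fun i x => z ^+ i * \1_(A n i) x))//.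
  rewrite -exB//; last first.
    by apply: (@bm_sum _ _ _ _ (index_enum 'I_K) xpredT (fun i x => z ^+ i * \1_(A n i) x)) => i; exact: bA.
  rewrite -[leRHS](ex_cst mu); apply: norm_ex_le; [|exact: bm_cst|].
    apply: bmB => //.
    by apply: (@bm_sum _ _ _ _ (index_enum 'I_K) xpredT (fun i x => z ^+ i * \1_(A n i) x)) => i; exact: bA.
  move=> x; apply: le_trans (pow_series_remainder K (return_count g n (r n) x) z01).
  rewrite le_eqVlt; apply/orP; left; apply/eqP; congr (`|_ - _|); apply: eq_bigr => i _.
  congr (_ * _); rewrite indicE; have [E|E] := eqVneq (return_count g n (r n) x) i.
    by rewrite mem_set.
  by rewrite memNset//; apply/eqP.
move=> z K /andP[/ltW z0 /ltW z1]; have z01 : 0 <= z <= 1 by rewrite z0.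
have bw i : bmeasurable (fun x : measurableTypeR R => z ^+ i * weight i x).
  by apply: bmM => //; exact: bm_cst.
rewrite (eq_bigr (fun i : 'I_K => ex mu (fun x => z ^+ i * weight i x))); last first.
  by move=> i _; rewrite exZ.
rewrite -(@ex_sum _ _ _ mu _ (index_enum 'I_K) xpredT (fun i x => z ^+ i * weight i x))//.
have bs : bmeasurable (fun x : measurableTypeR R => \sum_(i < K) z ^+ i * weight i x).
  by apply: (@bm_sum _ _ _ _ (index_enum 'I_K) xpredT (fun i x => z ^+ i * weight i x)) => i; exact: bw.
rewrite -exB//; last exact: bt.
rewrite -[leRHS](ex_cst mu); apply: norm_ex_le; [apply: bmB => //; exact: bt|exact: bm_cst|].
by move=> x; apply: exp_series_remainder => //; rewrite mulr_ge0// ltW.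
Qed.

Lemma return_count_law k :
  (fun n => mu [set x | X x /\ return_count f n (tau / (2 * n%:R)) x = k]) @ \oo -->
  (\int[lebesgue_measure]_(x in X)
     (tau ^+ k * rho x ^+ k.+1 / (k`!)%:R * expR (- (rho x * tau)))%:E)%E.
Proof.
(* One of the [k + 1] factors [rho] is the density of [mu]; the others belong to the Poisson weight
   with parameter [tau * rho x]. *)
have -> : (\int[lebesgue_measure]_(x in X)
     (tau ^+ k * rho x ^+ k.+1 / (k`!)%:R * expR (- (rho x * tau)))%:E)%E =
   (ex mu (weight k))%:E.
  rewrite -(density_integral mX hrho (bweight k)); apply: eq_integral => x /set_mem Xx.
  by rewrite /weight lowE// exprS exprMn [rho x * tau]mulrC; congr EFin; ring.
have E n : mu [set x | X x /\ return_count f n (tau / (2 * n%:R)) x = k] =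
    (pr mu [set x | return_count g n (r n) x = k])%:E.
  have mA := measurable_return_count_eq n (r n) k mg.
  rewrite -(pr_acipI hmu mA) -pr_EFin; last exact: measurableI.
  congr (mu _); apply/seteqP; split => x.
    by move=> [Xx h]; split => //=; rewrite (return_count_totalize hmu).
  by move=> [/= h Xx]; split => //; rewrite -(return_count_totalize hmu).
under eq_fun do rewrite E.
by apply: cvg_EFin; [exact: nearW|exact: pr_return_count_cvg].
Qed.

End return_distribution.

Theorem theorem3p2 (R : realType) (X : set R) (f : R -> R)
    (mu : probability (measurableTypeR R) R) (rho : R -> R)
    (hX : is_interval X)
    (hmu : ergodic_acip X f mu)
    (hrho : is_density X mu rho)
    (hhyp : asymptotically_hyperbolic X f mu) :
  [/\
    (forall (tau : R) (k : nat), 0 < tau ->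
       (fun n : nat =>
          mu [set x | X x /\ return_count f n (tau / (2 * n%:R)) x = k])
         @ \oo -->
       (\int[lebesgue_measure]_(x in X)
          (tau ^+ k * rho x ^+ k.+1 / (k`!)%:R * expR (- (rho x * tau)))%:E)%E),

    (forall r : nat -> R,
       ((forall x, X x -> 0 < rho x) /\
        exists c : R,
          1 < 2 * c * inf [set rho x | x in X] /\
          forall n : nat, (1 < n)%N -> c * ln (ln n%:R) / n%:R < r n)
       \/
       (uniformly_hoelder X rho /\
        exists gamma gamma0 : R,
          [/\ gamma0 < gamma,
              (forall e : R, 0 < e ->
                 (\sum_(1 <= k <oo) \int[lebesgue_measure]_(x in X)
                    (rho x * expR (- (e * k%:R `^ gamma0 * rho x)))%:E
                  < +oo)%E) &
              forall n : nat, (0 < n)%N ->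
                ln n%:R `^ gamma / (2 * n%:R) < r n]) ->
       mu [set x | X x /\ \forall n \near \oo, closest_return f n x < r n]
         = 1%E)
    &
    (forall r : nat -> R,
       (forall m n : nat, (0 < m <= n)%N -> r n <= r m) ->
       (\sum_(1 <= n <oo) \int[mu]_(x in X) mu (ball (x : R) (r n)) < +oo)%E ->
       mu [set x | X x /\ \forall n \near \oo, r n < closest_return f n x]
         = 1%E)].
Proof.
split.
- by move=> tau k tau0; exact: (return_count_law hmu hhyp hrho tau0).
- move=> r [[rho0 [c [hc hr]]]|[hoel [gamma [gamma0 [g0g sumE hr]]]]].
    exact: (closest_return_upper_const hmu hhyp hrho rho0 hc hr).
  exact: (closest_return_upper_hoelder hmu hhyp hrho hoel g0g sumE hr).
- by move=> r rdec rsum; exact: (closest_return_lower hmu hhyp rdec rsum).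
Qed.
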